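(* Let $(M,\mathrm{g}_M)$ and $(N,\mathrm{g}_N)$ be smooth connected Riemannian manifolds without boundary, and suppose $M$ is compact with $\dim M\ge 2$. Assume that there exists $\sigma>0$ such that the sectional curvatures $\sec_M$ of $M$ and $\sec_N$ of $N$ satisfy $$\sec_N\le\sigma\le\sec_M .$$ Let $f:M\to N$ be a smooth minimal map. Let $\mathrm{g}=\mathrm{g}_M+f^*\mathrm{g}_N$, let $\mathrm{s}=\mathrm{g}_M-f^*\mathrm{g}_N$, and let $\operatorname{tr}(\mathrm{s})$ be the trace of $\mathrm{s}$ with respect to $\mathrm{g}$. Assume that $$\operatorname{tr}(\mathrm{s})\ge 0 \quad\text{on } M.$$ Further, assume there is a finite constant $\kappa$ such that $$\kappa^2>1\qquad\text{and}\qquad f^*\mathrm{g}_N<\kappa^2\,\mathrm{g}_M,$$ and such that the second fundamental tensor $\mathrm{A}$ of the graph $\Gamma(f)$ satisfies $$\|\mathrm{A}\|^2\le\frac{\kappa^2\sigma}{\kappa^4-1}\operatorname{tr}(\mathrm{s})\quad\text{on } M.$$ Then one of the following holds. (i) $f$ is a constant map. (ii) $f$ is a totally geodesic isometric immersion, $\sec_M=\sigma$, and the restriction of $\sec_N$ to $\mathrm{d}f(TM)$ is equal to $\sigma$. Moreover, $\Gamma(f)$ is a totally geodesic submanifold of $M\times N$.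
   Context: For a smooth map $f:M\to N$ between Riemannian manifolds, the graph is $\Gamma(f)=\{(x,f(x)):x\in M\}\subset M\times N$, the image of the embedding $F:M\to M\times N$, $F(x)=(x,f(x))$. The product $M\times N$ carries the product metric $\mathrm{g}_{M\times N}=\mathrm{g}_M\times\mathrm{g}_N$. The map $f$ is called minimal if $\Gamma(f)$ is a minimal submanifold of $(M\times N,\mathrm{g}_{M\times N})$, i.e. its mean curvature vector (the trace of $\mathrm{A}$ with respect to $\mathrm{g}$) vanishes identically. The induced metric on $M$ is $\mathrm{g}=F^*\mathrm{g}_{M\times N}=\mathrm{g}_M+f^*\mathrm{g}_N$, with Levi-Civita connection $\nabla$. For a local $\mathrm{g}$-orthonormal frame $\{e_1,\dots,e_m\}$ of $TM$, $m=\dim M$, one sets $\operatorname{tr}(\mathrm{s})=\sum_{k=1}^m\mathrm{s}(e_k,e_k)$. The second fundamental tensor of the graph is $\mathrm{A}(v,w)=\nabla^{\mathrm{g}_{M\times N}}_{\mathrm{d}F(v)}\mathrm{d}F(w)-\mathrm{d}F(\nabla_v w)$, where $\nabla^{\mathrm{g}_{M\times N}}$ is the Levi-Civita connection of $\mathrm{g}_{M\times N}$; its norm is $\|\mathrm{A}\|^2=\sum_{i,j=1}^m\mathrm{g}_{M\times N}(\mathrm{A}(e_i,e_j),\mathrm{A}(e_i,e_j))$. The inequality $f^*\mathrm{g}_N<\kappa^2\mathrm{g}_M$ means that $\kappa^2\mathrm{g}_M-f^*\mathrm{g}_N$ is positive definite at every point of $M$. Curvature inequalities are required for all tangent $2$-planes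 (and are vacuous if the manifold is one-dimensional). *)

(* Defs.v *)
From HB Require Import structures.
From mathcomp Require Import all_boot all_order all_algebra.
From mathcomp Require Import all_classical all_reals all_analysis.

Set Implicit Arguments.
Unset Strict Implicit.
Unset Printing Implicit Defensive.

Import Order.TTheory GRing.Theory Num.Theory.
Import numFieldNormedType.Exports.

Local Open Scope classical_set_scope.
Local Open Scope ring_scope.

(* Tangent vectors are row vectors of components with respect to the coordinate
   frame of a chart, and a field of bilinear forms is a matrix-valued function
   of the coordinates. *)
Section coordinate_calculus.
Context {R : realType}.

(* C^infinity on an open set U: every iterated directional derivative exists
   and is continuous on U. *)
Definition smooth_on (m : nat) (V : normedModType R) (U : set 'rV[R]_m)
    (f : 'rV[R]_m -> V) : Prop :=
  forall (vs : seq 'rV[R]_m) (x : 'rV[R]_m), U x ->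
    let g := foldr (fun v h => 'D_v h) f vs in
    {for x, continuous g} /\ forall v, derivable g x v.

Definition inner (n : nat) (G : 'M[R]_n) (u v : 'rV[R]_n) : R :=
  (u *m G *m v^T) ord0 ord0.

Definition symmetric_matrix (n : nat) (G : 'M[R]_n) : Prop := G^T = G.

Definition positive_definite (n : nat) (G : 'M[R]_n) : Prop :=
  forall u : 'rV[R]_n, u != 0 -> 0 < inner G u u.

Definition orthonormal_frame (n : nat) (G : 'M[R]_n)
    (e : 'I_n -> 'rV[R]_n) : Prop :=
  forall k l, inner G (e k) (e l) = (k == l)%:R.

Definition pullback (m n : nat) (phi : 'rV[R]_m -> 'rV[R]_n)
    (H : 'rV[R]_n -> 'M[R]_n) (x : 'rV[R]_m) : 'M[R]_m :=
  \matrix_(k, l) inner (H (phi x)) ('D_(delta_mx 0 k) phi x)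
                                   ('D_(delta_mx 0 l) phi x).

(* The covector is the right-hand side of the Koszul formula for the constant
   (hence commuting) coordinate fields u, v; multiplying by the inverse metric
   raises the index, so that the k-th component of christoffel G x u v is
   \sum_(i, j) Gamma^k_(i j) u^i v^j. *)
Definition christoffel (n : nat) (G : 'rV[R]_n -> 'M[R]_n)
    (x u v : 'rV[R]_n) : 'rV[R]_n :=
  (\row_l (2^-1 *
     ('D_u (fun y => inner (G y) v (delta_mx 0 l)) x
    + 'D_v (fun y => inner (G y) u (delta_mx 0 l)) x
    - 'D_(delta_mx 0 l) (fun y => inner (G y) u v) x))) *m invmx (G x).

Definition levi_civita (n : nat) (G : 'rV[R]_n -> 'M[R]_n) (v : 'rV[R]_n)
    (W : 'rV[R]_n -> 'rV[R]_n) (x : 'rV[R]_n) : 'rV[R]_n :=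
  'D_v W x + christoffel G x v (W x).

(* R(u, v) w; u, v, w are extended by constant coordinate fields, so the
   bracket term vanishes. *)
Definition curvature (n : nat) (G : 'rV[R]_n -> 'M[R]_n)
    (x u v w : 'rV[R]_n) : 'rV[R]_n :=
  levi_civita G u (levi_civita G v (cst w)) x
  - levi_civita G v (levi_civita G u (cst w)) x.

Definition sectional (n : nat) (G : 'rV[R]_n -> 'M[R]_n)
    (x u v : 'rV[R]_n) : R :=
  inner (G x) (curvature G x u v v) u /
  (inner (G x) u u * inner (G x) v v - inner (G x) u v ^+ 2).

Definition independent (n : nat) (u v : 'rV[R]_n) : Prop :=
  row_free (col_mx u v).

(* nabla^H_(dphi u) dphi(v) - dphi(nabla^G_u v) for constant coordinate fields
   u and v; the first term is the covariant derivative along phi. *)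
Definition second_fundamental (m n : nat) (G : 'rV[R]_m -> 'M[R]_m)
    (H : 'rV[R]_n -> 'M[R]_n) (phi : 'rV[R]_m -> 'rV[R]_n)
    (x u v : 'rV[R]_m) : 'rV[R]_n :=
  'D_u ('D_v phi) x + christoffel H (phi x) ('D_u phi x) ('D_v phi x)
  - 'D_(levi_civita G u (cst v) x) phi x.

End coordinate_calculus.

(* A space with charts and coordinate expressions of a metric. The fields
   chart a and chart_inv a are total functions, meaningful on chart_dom a and on
   its image only; metric a is a function of the coordinates of the chart a. *)
Record metric_atlas (R : realType) (n : nat) := MetricAtlas {
  carrier :> topologicalType;
  chart_index : Type;
  chart_dom : chart_index -> set carrier;
  chart : chart_index -> carrier -> 'rV[R]_n;
  chart_inv : chart_index -> 'rV[R]_n -> carrier;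
  metric : chart_index -> 'rV[R]_n -> 'M[R]_n }.

Section manifolds.
Context {R : realType}.

Definition in_charts (m n : nat) (M : metric_atlas R m) (N : metric_atlas R n)
    (f : M -> N) (a : chart_index M) (b : chart_index N)
    : 'rV[R]_m -> 'rV[R]_n :=
  @chart R n N b \o f \o @chart_inv R m M a.

Definition smooth_map (m n : nat) (M : metric_atlas R m) (N : metric_atlas R n)
    (f : M -> N) : Prop :=
  continuous f /\
  forall (a : chart_index M) (b : chart_index N),
    smooth_on (chart a @` (chart_dom a `&` f @^-1` chart_dom b))
              (in_charts f a b).

Definition smooth_manifold (n : nat) (M : metric_atlas R n) : Prop :=
  [/\ hausdorff_space M,
      @second_countable M,
      forall x : M, exists a : chart_index M, chart_dom a x,
      forall a : chart_index M,
        [/\ open (chart_dom a),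
            open (chart a @` chart_dom a),
            forall x, chart_dom a x -> chart_inv a (chart a x) = x,
            forall x, chart_dom a x -> {for x, continuous (chart a)} &
            forall x, chart_dom a x ->
              {for chart a x, continuous (@chart_inv R n M a)}] &
      forall a b : chart_index M,
        smooth_on (chart a @` (chart_dom a `&` chart_dom b))
                  (in_charts (@id M) a b)].

(* The last clause is the tensor transformation law: the transition maps carry
   the coordinate expressions of the metric into each other. *)
Definition riemannian_metric (n : nat) (M : metric_atlas R n) : Prop :=
  [/\ forall a : chart_index M,
        smooth_on (chart a @` chart_dom a) (@metric R n M a),
      forall (a : chart_index M) (x : M), chart_dom a x ->
        symmetric_matrix (metric a (chart a x)) /\
        positive_definite (metric a (chart a x)) &
      forall (a b : chart_index M) (x : M), chart_dom a x -> chart_dom b x ->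
        metric a (chart a x) =
        pullback (in_charts (@id M) a b) (@metric R n M b) (chart a x)].

Definition riemannian_manifold (n : nat) (M : metric_atlas R n) : Prop :=
  smooth_manifold M /\ riemannian_metric M.

Definition product (m n : nat) (M : metric_atlas R m) (N : metric_atlas R n)
    : metric_atlas R (m + n) :=
  @MetricAtlas R (m + n) (M * N)%type
    (chart_index M * chart_index N)%type
    (fun c => chart_dom c.1 `*` chart_dom c.2)
    (fun c p => row_mx (chart c.1 p.1) (chart c.2 p.2))
    (fun c z => (chart_inv c.1 (lsubmx z), chart_inv c.2 (rsubmx z)))
    (fun c z => block_mx (metric c.1 (lsubmx z)) 0 0 (metric c.2 (rsubmx z))).

Definition graph (m n : nat) (M : metric_atlas R m) (N : metric_atlas R n)
    (f : M -> N) : M -> product M N :=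
  fun x => (x, f x).

Definition pullback_metric (m n : nat) (M : metric_atlas R m)
    (N : metric_atlas R n) (f : M -> N) (a : chart_index M) (b : chart_index N)
    : 'rV[R]_m -> 'M[R]_m :=
  pullback (in_charts f a b) (@metric R n N b).

(* The Levi-Civita connection on the source is that of the induced metric
   F^* g_P, so this is meant for immersions F. *)
Definition second_form (m p : nat) (M : metric_atlas R m) (P : metric_atlas R p)
    (F : M -> P) (a : chart_index M) (c : chart_index P)
    : 'rV[R]_m -> 'rV[R]_m -> 'rV[R]_m -> 'rV[R]_p :=
  second_fundamental (pullback_metric F a c) (@metric R p P c)
                     (in_charts F a c).

Definition minimal_immersion (m p : nat) (M : metric_atlas R m)
    (P : metric_atlas R p) (F : M -> P) : Prop :=
  forall (a : chart_index M) (c : chart_index P) (x : M)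
         (e : 'I_m -> 'rV[R]_m),
    chart_dom a x -> chart_dom c (F x) ->
    orthonormal_frame (pullback_metric F a c (chart a x)) e ->
    \sum_(k < m) second_form F a c (chart a x) (e k) (e k) = 0.

Definition totally_geodesic_immersion (m p : nat) (M : metric_atlas R m)
    (P : metric_atlas R p) (F : M -> P) : Prop :=
  forall (a : chart_index M) (c : chart_index P) (x : M) (u v : 'rV[R]_m),
    chart_dom a x -> chart_dom c (F x) ->
    second_form F a c (chart a x) u v = 0.

Definition isometric_immersion (m n : nat) (M : metric_atlas R m)
    (N : metric_atlas R n) (f : M -> N) : Prop :=
  forall (a : chart_index M) (b : chart_index N) (x : M),
    chart_dom a x -> chart_dom b (f x) ->
    pullback_metric f a b (chart a x) = metric a (chart a x).

Definition minimal_map (m n : nat) (M : metric_atlas R m)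
    (N : metric_atlas R n) (f : M -> N) : Prop :=
  minimal_immersion (graph f).

Definition graph_metric (m n : nat) (M : metric_atlas R m)
    (N : metric_atlas R n) (f : M -> N) (a : chart_index M) (b : chart_index N)
    (y : 'rV[R]_m) : 'M[R]_m :=
  metric a y + pullback_metric f a b y.

Definition s_tensor (m n : nat) (M : metric_atlas R m)
    (N : metric_atlas R n) (f : M -> N) (a : chart_index M) (b : chart_index N)
    (y : 'rV[R]_m) : 'M[R]_m :=
  metric a y - pullback_metric f a b y.

Definition frame_trace (m : nat) (S : 'M[R]_m) (e : 'I_m -> 'rV[R]_m) : R :=
  \sum_(k < m) inner S (e k) (e k).

(* |A|^2 for A the second fundamental tensor of F, computed in the frame e. *)
Definition second_form_norm2 (m p : nat) (M : metric_atlas R m)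
    (P : metric_atlas R p) (F : M -> P) (a : chart_index M) (c : chart_index P)
    (y : 'rV[R]_m) (e : 'I_m -> 'rV[R]_m) : R :=
  \sum_(i < m) \sum_(j < m)
    inner (metric c (in_charts F a c y))
          (second_form F a c y (e i) (e j)) (second_form F a c y (e i) (e j)).

(* Tangent 2-planes are given by bases (u, v); vacuous when n < 2. *)
Definition all_sectional (n : nat) (M : metric_atlas R n) (P : R -> Prop)
    : Prop :=
  forall (a : chart_index M) (x : M) (u v : 'rV[R]_n),
    chart_dom a x -> independent u v ->
    P (sectional (@metric R n M a) (chart a x) u v).

(* The 2-planes contained in the image of df are those with a basis of the form
   (df u, df v). *)
Definition all_sectional_on_image (m n : nat) (M : metric_atlas R m)
    (N : metric_atlas R n) (f : M -> N) (P : R -> Prop) : Prop :=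
  forall (a : chart_index M) (b : chart_index N) (x : M) (u v : 'rV[R]_m),
    chart_dom a x -> chart_dom b (f x) ->
    let du := 'D_u (in_charts f a b) (chart a x) in
    let dv := 'D_v (in_charts f a b) (chart a x) in
    independent du dv ->
    P (sectional (@metric R n N b) (chart b (f x)) du dv).

End manifolds.

(* Main.v *)
(* Let c be the least eigenvalue of s with respect to g over M, attained at a point x
   by a g-unit vector v; f^* g_N < kappa^2 g_M forces c > (1 - kappa^2) / (1 + kappa^2).
   The form s - c g is nonnegative and vanishes on v.  Extend v by a field that is
   g-parallel at x.  The second order condition at x and the Bochner formulas for the
   harmonic maps id : (M, g) -> M and f : (M, g) -> N give
     0 <= - 4 c sum_k |A(e_k, v)|^2 - sigma (1 - c^2) (tr s - c).
   For c < 0 this contradicts the bound on |A|; for 0 < c < 1 it contradicts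
   tr s >= m c > c; and c = 1 means df = 0.  For c = 0 it gives tr s = 0, hence s = 0,
   at x.  The same inequality for a perturbed eigenvalue, combined with Hopf's barrier,
   shows that the set where s degenerates is open, so s = 0 on M: then f is isometric,
   A = 0, and equality in the curvature terms gives the statements on sec. *)
Require Import Defs.
From HB Require Import structures.
From mathcomp Require Import all_boot all_order all_algebra.
From mathcomp Require Import all_classical all_reals all_analysis.
From mathcomp Require Import ring lra.
Set Implicit Arguments.
Unset Strict Implicit.
Unset Printing Implicit Defensive.
Import Order.TTheory GRing.Theory Num.Theory.
Import numFieldNormedType.Exports.
Local Open Scope classical_set_scope.
Local Open Scope ring_scope.

(** * Smooth functions of several variables *)

(** The least eigenvalue of s need not be smooth where eigenvalues cross, so it is never
    differentiated. Its place is taken by smooth functions c with s - c g >= 0 and equality in one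
    direction at one point. The same estimate then serves for a constant c, the global minimum, and
    for a constant plus a multiple of Hopf's barrier. The minimum itself is found as the supremum of
    the levels c for which s - c g is positive definite on all of M.

    Harmonicity of the two maps is minimality of the graph read componentwise: A = (B1, B2), the
    second fundamental forms of id and f with respect to g. The weights 1 - c and 1 + c appear
    because s - c g = (1 - c) g_M - (1 + c) f^* g_N. In this combination the terms of the two
    Bochner formulas that have no sign cancel, since v lies in the kernel of the form. Normality of
    A to the graph gives (1 + c) |B1|^2 <= (1 - c) |B2|^2, which turns the gradient terms into - 4 c
    |A|^2. Frames are orthonormal at a single point only and constant in coordinates; the
    Christoffel terms make up for this. *)

Section differential_calculus.
Context {R : realType} {m : nat}.
Implicit Types (f g : 'rV[R]_m -> R) (U : set 'rV[R]_m) (x u v h : 'rV[R]_m) (s t : R).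

Lemma ler_coord_norm x (i : 'I_m) : `|x ord0 i| <= `|x|.
Proof.
rewrite [leRHS]/Num.Def.normr/= mx_normrE.
exact: (le_bigmax _ (fun ij : 'I_1 * 'I_m => `|x ij.1 ij.2|) (ord0, i)).
Qed.

Lemma norm_delta_le (i : 'I_m) : `|delta_mx 0 i : 'rV[R]_m| <= 1.
Proof.
rewrite [leLHS]/Num.Def.normr/= mx_normrE; apply: bigmax_le => // -[j k] _ /=.
by rewrite mxE; case: (_ && _); rewrite ?normr0 ?normr1.
Qed.

Lemma norm_row_le x (e : R) : 0 <= e -> (forall i, `|x ord0 i| <= e) -> `|x| <= e.
Proof.
move=> e0 xe; rewrite [leLHS]/Num.Def.normr/= mx_normrE.
by apply: bigmax_le => // -[j k] _ /=; rewrite ord1.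
Qed.

Lemma line_is_derive f x v t :
  derivable f (t *: v + x) v ->
  is_derive t 1 (fun s : R => f (s *: v + x)) ('D_v f (t *: v + x)).
Proof.
move=> dfx; have E (h : R) : h *: v + (t *: v + x) = (h%:A + t) *: v + x.
  by rewrite scalerDl addrA -[h%:A]/(h * 1) mulr1.
split; rewrite /derivable /derive /=.
  move: dfx; rewrite /derivable.
  by under eq_fun do rewrite /= E.
by under [in RHS]eq_fun do rewrite /= E.
Qed.

(** Both signs of [t] are allowed, since the coordinates of an increment have either sign. *)
Lemma mvt_line f x v t :
  (forall s : R, `|s| <= `|t| -> derivable f (s *: v + x) v) ->
  exists2 s : R, `|s| <= `|t| & f (t *: v + x) - f x = t * 'D_v f (s *: v + x).
Proof.
move=> dfx.
have contf (s : R) : `|s| <= `|t| -> {for s, continuous (fun s : R => f (s *: v + x))}.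
  move=> st; apply: differentiable_continuous; apply/derivable1_diffP.
  by have [] := line_is_derive (dfx s st).
have E0 : 0 *: v + x = x by rewrite scale0r add0r.
have [t0|t0] := leP 0 t.
  have [||s] := @MVT_segment R (fun s : R => f (s *: v + x))
    (fun s : R => 'D_v f (s *: v + x)) 0 t t0.
  - move=> s; rewrite in_itv /= => /andP[s0 st]; apply: line_is_derive; apply: dfx.
    by rewrite !ger0_norm // ltW.
  - apply: continuous_in_subspaceT => s; rewrite inE /= in_itv /= => /andP[s0 st].
    by apply: contf; rewrite !ger0_norm.
  rewrite in_itv /= => /andP[s0 st] E; exists s; first by rewrite !ger0_norm.
  by move: E; rewrite E0 subr0 mulrC.
have [||s] := @MVT_segment R (fun s : R => f (s *: v + x))
    (fun s : R => 'D_v f (s *: v + x)) t 0 (ltW t0).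
- move=> s; rewrite in_itv /= => /andP[ts s0]; apply: line_is_derive; apply: dfx.
  by rewrite !ler0_norm ?lerN2 // ltW.
- apply: continuous_in_subspaceT => s; rewrite inE /= in_itv /= => /andP[ts s0].
  by apply: contf; rewrite !ler0_norm ?lerN2 // ltW.
rewrite in_itv /= => /andP[ts s0] E.
exists s; first by rewrite !ler0_norm ?lerN2 // ltW.
by move: E; rewrite E0 sub0r mulrN -(opprB (f (t *: v + x))) => /oppr_inj ->; rewrite mulrC.
Qed.

Definition linear_form (a : 'I_m -> R) h : R := \sum_i h ord0 i * a i.

Lemma linear_form_continuous a : continuous (linear_form a).
Proof.
move=> h; have -> : linear_form a =
    \sum_(i < m) ((fun h : 'rV[R]_m => h ord0 i : R) * cst (a i)).
  by rewrite fct_sumE.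
apply: differentiable_continuous; apply: differentiable_sum => i.
by apply: differentiableM; [exact: differentiable_coord|exact: differentiable_cst].
Qed.

Lemma linear_form_is_linear a : linear (linear_form a : 'rV[R]_m -> R).
Proof.
move=> k u v; rewrite /linear_form scaler_sumr -big_split /=; apply: eq_bigr => i _.
by rewrite !mxE mulrDl -mulrA.
Qed.

(** [differentiable] speaks of the canonical differential; uniqueness of the first order expansion
    identifies it with the given linear form. *)
Lemma differentiable_of_linear_approx f x (a : 'I_m -> R) :
  (forall e, 0 < e -> \forall h \near (0 : 'rV[R]_m),
     `|f (h + x) - f x - linear_form a h| <= e * `|h|) ->
  differentiable f x.
Proof.
move=> H.
pose L : {linear 'rV[R]_m -> R} := HB.pack (linear_form a)
  (GRing.isLinear.Build _ _ _ _ _ (linear_form_is_linear a)).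
have Lc : continuous L by exact: linear_form_continuous.
have FE : f \o shift x = cst (f x) + linear_form a +o_ (0 : 'rV[R]_m) (@id 'rV[R]_m).
  apply/eqaddoP => e e0; have := H e e0; apply: filter_app; near=> h => /= hh.
  by rewrite /= !fctE opprD addrA.
apply/diff_locallyP; have -> : 'd f x = L :> (_ -> _) by exact: diff_unique.
by split.
Unshelve. all: by end_near. Qed.

(** Corners of the staircase from 0 to [h] that switches on one coordinate at a time. *)
Definition row_prefix h (k : nat) : 'rV[R]_m :=
  \row_j (if (j < k)%N then h ord0 j else 0).

Lemma row_prefix0 h : row_prefix h 0 = 0.
Proof. by apply/rowP => j; rewrite !mxE. Qed.

Lemma row_prefix_full h : row_prefix h m = h.
Proof. by apply/rowP => j; rewrite !mxE ltn_ord. Qed.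

Lemma row_prefixS h (k : 'I_m) :
  row_prefix h k.+1 = h ord0 k *: delta_mx 0 k + row_prefix h k.
Proof.
apply/rowP => j; rewrite !mxE eqxx /= ltnS leq_eqVlt.
have [->|jk] := eqVneq j k; first by rewrite eqxx ltnn mulr1 addr0.
have /negPf -> /= : (j != k :> nat) by [].
by rewrite mulr0 add0r.
Qed.

Lemma row_prefix_norm h k : `|row_prefix h k| <= `|h|.
Proof.
apply: norm_row_le => // i; rewrite mxE; case: ifP => _; last by rewrite normr0.
exact: ler_coord_norm.
Qed.

(** Telescoping along the staircase turns the increment into partial derivatives at nearby points,
    by the mean value theorem, and continuity compares these with the partials at [x]. *)
Lemma continuous_partials_differentiable f U x :
  open U -> U x ->
  (forall y, U y -> forall i : 'I_m, derivable f y (delta_mx 0 i)) ->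
  (forall i : 'I_m, {for x, continuous ('D_(delta_mx 0 i) f)}) ->
  differentiable f x.
Proof.
move=> oU Ux df cf.
apply: (@differentiable_of_linear_approx _ _ (fun i => 'D_(delta_mx 0 i) f x)).
move=> e e0.
(* The share of the error allotted to each of the [m] coordinates; [m.+1] keeps the quotient
   meaningful when [m = 0]. *)
have e'0 : 0 < e / m.+1%:R by rewrite divr_gt0.
have /nbhs_norm0P[d d0 dP] : \forall h \near (0 : 'rV[R]_m), U (h + x) /\
    forall i, `|'D_(delta_mx 0 i) f (h + x) - 'D_(delta_mx 0 i) f x| <= e / m.+1%:R.
  have : \forall y \near x, U y /\
      forall i, `|'D_(delta_mx 0 i) f y - 'D_(delta_mx 0 i) f x| <= e / m.+1%:R.
    near=> y; split; first by near: y; apply: open_nbhs_nbhs.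
    near: y; apply: filter_forall => i.
    have /cvgrPdist_le/(_ _ e'0) := cf i.
    by apply: filterS => y; rewrite distrC.
  by rewrite (near_shift 0) /= subr0.
(* Half the radius, because an intermediate point is displaced by a sum of two vectors of norm at
   most that of [h]. *)
apply/nbhs_norm0P; exists (d / 2); first by rewrite /= divr_gt0.
move=> h /= hd.
have key (k : 'I_m) : `|f (row_prefix h k.+1 + x) - f (row_prefix h k + x)
     - h ord0 k * 'D_(delta_mx 0 k) f x| <= e / m.+1%:R * `|h|.
  have small (s : R) : `|s| <= `|h ord0 k| ->
      `|s *: (delta_mx 0 k : 'rV[R]_m) + row_prefix h k| < d.
    move=> sh; apply: (le_lt_trans (ler_normD _ _)).
    rewrite (splitr d); apply: ler_ltD; last first.
      exact: le_lt_trans (row_prefix_norm _ _) hd.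
    rewrite normrZ; apply: le_trans _ (ltW hd); apply: le_trans _ (ler_coord_norm h k).
    apply: le_trans _ sh; rewrite -[leRHS]mulr1; apply: ler_wpM2l => //.
    exact: norm_delta_le.
  have [s|s sh] := @mvt_line f (row_prefix h k + x) (delta_mx 0 k) (h ord0 k).
    by move=> sh; apply: df; rewrite addrA; have [] := dP _ (small s sh).
  rewrite addrA -row_prefixS => ->; rewrite -mulrBr normrM mulrC addrA.
  apply: ler_pM => //; last exact: ler_coord_norm.
  by have [_ ->] := dP _ (small s sh).
have -> : f (h + x) - f x =
    \sum_(k < m) (f (row_prefix h k.+1 + x) - f (row_prefix h k + x)).
  rewrite -(big_mkord xpredT (fun k => f (row_prefix h k.+1 + x) - f (row_prefix h k + x))).
  by rewrite telescope_sumr // row_prefix0 row_prefix_full add0r.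
rewrite /linear_form -sumrB; apply: le_trans (ler_norm_sum _ _ _) _.
apply: le_trans (ler_sum _ (fun k _ => key k)) _.
rewrite sumr_const card_ord -[leLHS]mulr_natr -[e in leRHS](@divfK _ m.+1%:R) ?pnatr_eq0 //.
by rewrite mulrAC; apply: ler_wpM2r; rewrite ?ler_wpM2l ?ler_nat ?(ltW e'0).
Unshelve. all: by end_near. Qed.

End differential_calculus.

Lemma near_eq_continuous (T T' : topologicalType) (f g : T -> T') (x : T) :
  {near x, f =1 g} -> {for x, continuous f} -> {for x, continuous g}.
Proof.
move=> fg fc; rewrite /prop_for /continuous_at -(nbhs_singleton fg).
apply: cvg_trans fc; apply: near_eq_cvg; exact: fg.
Qed.

(** [h] and [k] may differ: in Schwarz's theorem the two orders of differentiation produce different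
    intermediate points. *)
Lemma eq_of_arbitrarily_close (R : realType) (V : normedModType R) (A B : V -> R) (x : V) :
  {for x, continuous A} -> {for x, continuous B} ->
  (forall d : R, 0 < d -> exists h k : V, [/\ `|h| < d, `|k| < d & A (h + x) = B (k + x)]) ->
  A x = B x.
Proof.
move=> cA cB AB; apply/eqP; rewrite -subr_eq0 -normr_le0; apply/ler_addgt0Pr => e e0.
rewrite add0r; have e20 : 0 < e / 2 by rewrite divr_gt0.
have /cvgrPdist_le/(_ _ e20)/nbhs_normP[d d0 dP] := cA.
have /cvgrPdist_le/(_ _ e20)/nbhs_normP[d' d'0 d'P] := cB.
have ballx (r : R) h : `|h| < r -> [set y | `|x - y| < r] (h + x).
  by rewrite /= opprD addrCA subrr addr0 normrN.
have [|h [k [hd kd hk]]] := AB (Num.min d d'); first by rewrite lt_min d0.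
move: hd kd; rewrite !lt_min => /andP[/ballx/dP hA _] /andP[_ /ballx/d'P hB].
rewrite -(subrKA (A (h + x))) (splitr e); apply: le_trans (ler_normD _ _) _.
by apply: lerD => //; rewrite hk distrC.
Qed.

Section smooth_functions.
Context {R : realType} {m : nat}.
Implicit Types (f g : 'rV[R]_m -> R) (U : set 'rV[R]_m) (x u v h : 'rV[R]_m) (s t : R).

Lemma open_near U x (P : 'rV[R]_m -> Prop) :
  open U -> U x -> (forall y, U y -> P y) -> \forall y \near x, P y.
Proof. by move=> oU Ux UP; near=> y; apply: UP; near: y; apply: open_nbhs_nbhs.
Unshelve. all: by end_near. Qed.

Lemma near_eq_differentiable f g x :
  {near x, f =1 g} -> differentiable f x -> differentiable g x.
Proof.
move=> fg df; have -> : g = f + (g - f) by rewrite addrC subrK.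
apply: differentiableD => //.
apply: (@differentiable_of_linear_approx _ _ _ _ (fun=> 0)) => e e0.
have E : \forall y \near x, (g - f) y = 0.
  by apply: filterS fg => y fgy; rewrite !fctE fgy subrr.
have := E; rewrite (near_shift 0) /=; apply: filterS => h.
rewrite subr0 /= => ->; rewrite (nbhs_singleton E) subrr sub0r /linear_form big1.
  by rewrite oppr0 normr0 mulr_ge0 // ltW.
by move=> i _; rewrite mulr0.
Qed.

(** Differentiability in the sense of Fréchet is asked at every order, whereas [smooth_on] speaks of
    directional derivatives: linearity in the direction and the chain rule rest on it. *)
Fixpoint Ck (k : nat) U f : Prop :=
  if k is k'.+1 then
    (forall x, U x -> differentiable f x) /\ forall v, Ck k' U ('D_v f)
  else forall x, U x -> {for x, continuous f}.

Definition smooth U f := forall k, Ck k U f.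

Lemma Ck_continuous k U f x : Ck k U f -> U x -> {for x, continuous f}.
Proof.
case: k => [|k] /= => [h Ux|[h _] Ux]; first exact: h.
by apply: differentiable_continuous; exact: h.
Qed.

Lemma CkW k U f : Ck k.+1 U f -> Ck k U f.
Proof.
elim: k f => [|k IH] f; first by move=> h x Ux; exact: Ck_continuous h Ux.
by move=> [df h]; split=> // v; apply: IH.
Qed.

Lemma smooth_diff U f x : smooth U f -> U x -> differentiable f x.
Proof. by move=> /(_ 1%N) [df _]; exact: df. Qed.

Lemma smooth_derive U f v : smooth U f -> smooth U ('D_v f).
Proof. by move=> fs k; have [_] := fs k.+1; apply. Qed.

Lemma smooth_continuous U f x : smooth U f -> U x -> {for x, continuous f}.
Proof. by move=> /(_ 0%N); exact: Ck_continuous. Qed.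

Section open_domain.
Variable U : set 'rV[R]_m.
Hypothesis oU : open U.

Lemma eq_derive_open (W : normedModType R) (f g : 'rV[R]_m -> W) v x :
  (forall y, U y -> f y = g y) -> U x -> 'D_v f x = 'D_v g x.
Proof. by move=> fg Ux; apply: near_eq_derive; exact: open_near fg. Qed.

Lemma eq_Ck k f g : (forall y, U y -> f y = g y) -> Ck k U f -> Ck k U g.
Proof.
elim: k f g => [|k IH] f g fg.
  move=> fc x Ux; have nfg : {near x, f =1 g} by exact: open_near fg.
  exact: near_eq_continuous nfg (fc x Ux).
move=> [df fs]; split=> [x Ux|v].
  by apply: near_eq_differentiable (df x Ux); exact: open_near fg.
by apply: IH (fs v) => y Uy; exact: eq_derive_open.
Qed.

Lemma eq_smooth f g : (forall y, U y -> f y = g y) -> smooth U f -> smooth U g.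
Proof. by move=> fg fs k; exact: eq_Ck (fs k). Qed.

Lemma Ck_cst k (a : R) : Ck k U (cst a).
Proof.
elim: k a => [a x _|k IH a]; first exact: cst_continuous.
split=> [x _|v]; first exact: differentiable_cst.
by apply: eq_Ck (IH 0) => y _; rewrite derive_cst.
Qed.

Lemma CkD k f g : Ck k U f -> Ck k U g -> Ck k U (fun y => f y + g y).
Proof.
elim: k f g => [|k IH] f g; first by move=> fc gc x Ux; apply: continuousD; [exact: fc|exact: gc].
move=> [df fs] [dg gs]; split=> [x Ux|v]; first by apply: differentiableD; [exact: df|exact: dg].
apply: eq_Ck (IH _ _ (fs v) (gs v)) => y Uy.
by rewrite deriveD //; apply: diff_derivable; [exact: df|exact: dg].
Qed.

Lemma CkM k f g : Ck k U f -> Ck k U g -> Ck k U (fun y => f y * g y).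
Proof.
elim: k f g => [|k IH] f g; first by move=> fc gc x Ux; apply: continuousM; [exact: fc|exact: gc].
move=> fs gs; have [df fs'] := fs; have [dg gs'] := gs.
split=> [x Ux|v]; first by apply: differentiableM; [exact: df|exact: dg].
apply: eq_Ck (CkD (IH _ _ (CkW fs) (gs' v)) (IH _ _ (CkW gs) (fs' v))) => y Uy.
by rewrite deriveM //; apply: diff_derivable; [exact: df|exact: dg].
Qed.

Lemma CkN k f : Ck k U f -> Ck k U (fun y => - f y).
Proof.
move=> fs; apply: eq_Ck (CkM (@Ck_cst k (-1)) fs) => y _.
by rewrite mulN1r.
Qed.

(** The derivative of 1/f is that of [f] times -(1/f)^2, so 1/f to one order less suffices. *)
Lemma CkV k f : (forall x, U x -> f x != 0) -> Ck k U f -> Ck k U (fun y => (f y)^-1).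
Proof.
move=> f0; elim: k => [|k IH]; first by move=> fc x Ux; apply: continuousV; [exact: f0|exact: fc].
move=> fs; have [df fs'] := fs; have IHf := IH (CkW fs).
split=> [x Ux|v]; first by apply: differentiableV; [exact: df|exact: f0].
apply: eq_Ck (CkN (CkM (CkM IHf IHf) (fs' v))) => y Uy.
rewrite deriveV; [|exact: f0|by apply: diff_derivable; exact: df].
by rewrite -expr2 exprVn -mulNr.
Qed.

Lemma Ck_sum k (I : Type) (r : seq I) (P : pred I) (F : I -> 'rV[R]_m -> R) :
  (forall i, P i -> Ck k U (F i)) -> Ck k U (fun y => \sum_(i <- r | P i) F i y).
Proof.
move=> FC; elim: r => [|i r IH].
  by apply: eq_Ck (@Ck_cst k 0) => y _; rewrite big_nil.
case Pi: (P i); last by apply: eq_Ck IH => y _; rewrite big_cons Pi.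
by apply: eq_Ck (CkD (FC i Pi) IH) => y _; rewrite big_cons Pi.
Qed.

Lemma Ck_prod k (I : Type) (r : seq I) (P : pred I) (F : I -> 'rV[R]_m -> R) :
  (forall i, P i -> Ck k U (F i)) -> Ck k U (fun y => \prod_(i <- r | P i) F i y).
Proof.
move=> FC; elim: r => [|i r IH].
  by apply: eq_Ck (@Ck_cst k 1) => y _; rewrite big_nil.
case Pi: (P i); last by apply: eq_Ck IH => y _; rewrite big_cons Pi.
by apply: eq_Ck (CkM (FC i Pi) IH) => y _; rewrite big_cons Pi.
Qed.

Lemma derive_coord (i : 'I_m) v x : 'D_v (fun y : 'rV[R]_m => y ord0 i) x = v ord0 i.
Proof.
have /derive_mx : derivable (@id 'rV[R]_m) x v by exact: derivable_id.
by rewrite derive_id => /(congr1 (fun A : 'rV[R]_m => A ord0 i)); rewrite mxE.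
Qed.

Lemma Ck_coord k (i : 'I_m) : Ck k U (fun y => y ord0 i).
Proof.
elim: k => [|k IH]; first by move=> x _; apply: differentiable_continuous; exact: differentiable_coord.
split=> [x _|v]; first exact: differentiable_coord.
by apply: eq_Ck (@Ck_cst k (v ord0 i)) => y _; rewrite derive_coord.
Qed.

Lemma smooth_on_derive (W : normedModType R) (f : 'rV[R]_m -> W) v :
  smooth_on U f -> smooth_on U ('D_v f).
Proof.
move=> fs vs x Ux; have := fs (rcons vs v) x Ux.
by rewrite -cats1 foldr_cat.
Qed.

End open_domain.

Lemma Ck_subset k U U' f : U' `<=` U -> Ck k U f -> Ck k U' f.
Proof.
move=> sU; elim: k f => [|k IH] f; first by move=> fc x /sU; exact: fc.
by move=> [df fs]; split=> [x /sU|v]; [exact: df|exact: IH (fs v)].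
Qed.

Lemma smooth_subset U U' f : U' `<=` U -> smooth U f -> smooth U' f.
Proof. by move=> sU fs k; exact: Ck_subset (fs k). Qed.

Lemma derive_dirE f x v : differentiable f x ->
  'D_v f x = \sum_i v ord0 i * 'D_(delta_mx 0 i) f x.
Proof.
move=> df; rewrite deriveE // {1}(row_sum_delta v) linear_sum.
by apply: eq_bigr => i _; rewrite linearZ deriveE.
Qed.

(** The mean value theorem is used along [b] for the difference between [f] and its translate by
    [t *: a], then along [a] for the derivative of [f] along [b]. *)
Lemma second_difference U f a b x t : t != 0 ->
  (forall y, U y -> differentiable f y) ->
  (forall y, U y -> differentiable ('D_b f) y) ->
  (forall s s', `|s| <= `|t| -> `|s'| <= `|t| -> U (s' *: a + (s *: b + x))) ->
  exists s s' : R, [/\ `|s| <= `|t|, `|s'| <= `|t| &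
    'D_a ('D_b f) (s' *: a + (s *: b + x)) = (f (t *: a + (t *: b + x))
      - f (t *: b + x) - (f (t *: a + x) - f x)) / (t * t)].
Proof.
move=> t0 df ddf inU.
pose phi := (f \o shift (t *: a)) - f.
have U0 s : `|s| <= `|t| -> U (s *: b + x).
  by move=> st; have := inU s 0 st; rewrite normr0 scale0r add0r; exact.
have dshift s : `|s| <= `|t| -> differentiable (f \o shift (t *: a)) (s *: b + x).
  move=> st; apply: differentiable_comp; first exact: differentiableD.
  by apply: df; rewrite /= addrC; apply: inU.
have dphi s : `|s| <= `|t| -> derivable phi (s *: b + x) b.
  move=> st; apply: diff_derivable; apply: differentiableB; first exact: dshift.
  by apply: df; exact: U0.
have [s st E] := mvt_line dphi.
have shiftD : 'D_b (f \o shift (t *: a)) (s *: b + x) = 'D_b f (t *: a + (s *: b + x)).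
  rewrite /derive; congr (lim (_ @ 0^')); apply/funext => r /=.
  by rewrite -addrA [in X in _ *: (_ - X)]addrC [s *: b + x + _]addrC.
have E' : 'D_b phi (s *: b + x) = 'D_b f (t *: a + (s *: b + x)) - 'D_b f (s *: b + x).
  rewrite deriveB; [by rewrite shiftD|apply: diff_derivable; exact: dshift|].
  by apply: diff_derivable; apply: df; exact: U0.
have [|s' st' E2] := @mvt_line R m ('D_b f) (s *: b + x) a t.
  by move=> s' st'; apply: diff_derivable; apply: ddf; exact: inU.
exists s, s'; split=> //.
apply/esym; move: E; rewrite E' E2 /phi !fctE /= => E.
rewrite -(addrC _ (t *: a)) -(addrC x (t *: a)) [f _ - _ - _]E.
by field.
Qed.

(* Both mixed derivatives are limits of the same second difference quotient. *)
Lemma schwarz U f u v x : open U -> U x ->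
  (forall y, U y -> differentiable f y) ->
  (forall y w, U y -> differentiable ('D_w f) y) ->
  {for x, continuous ('D_u ('D_v f))} -> {for x, continuous ('D_v ('D_u f))} ->
  'D_u ('D_v f) x = 'D_v ('D_u f) x.
Proof.
move=> oU Ux df ddf cuv cvu; apply: (eq_of_arbitrarily_close cuv cvu) => e e0.
have [d [d0 de dU]] : exists d : R, [/\ 0 < d, d <= e & forall h, `|h| < d -> U (h + x)].
  have := open_near oU Ux (fun y Uy => Uy).
  rewrite (near_shift 0) /= subr0 => /nbhs_norm0P[d d0 dP].
  exists (Num.min d e); rewrite lt_min d0 ge_min lexx orbT; split=> // h.
  by rewrite lt_min => /andP[hd _]; exact: dP.
(* Small enough that the whole parallelogram spanned by [t *: u] and [t *: v] stays within [d]; the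
   summand 1 keeps the denominator positive when [u] and [v] vanish. *)
pose t := d / 2 / (`|u| + `|v| + 1).
have D0 : 0 < `|u| + `|v| + 1 by rewrite ltr_wpDl // addr_ge0.
have t0 : 0 < t by rewrite !divr_gt0.
have small s s' : `|s| <= `|t| -> `|s'| <= `|t| -> `|s' *: u + s *: v| < d.
  rewrite [`|t|]gtr0_norm // => st st'; apply: le_lt_trans (ler_normD _ _) _.
  rewrite !normrZ; apply: (@le_lt_trans _ _ (t * (`|u| + `|v| + 1))).
    rewrite !mulrDr mulr1 -[leLHS]addr0; apply: lerD; last exact: ltW.
    by apply: lerD; exact: ler_wpM2r.
  by rewrite /t divfK ?gt_eqF // ltr_pdivrMr // ltr_pMr // ltr1n.
have [|||s [s' [st st' E1]]] := @second_difference U f u v x t _ df.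
- by rewrite gt_eqF.
- by move=> y Uy; exact: ddf.
- by move=> s s' st st'; rewrite addrA; exact: dU (small s s' st st').
have [|||r [r' [rt rt' E2]]] := @second_difference U f v u x t _ df.
- by rewrite gt_eqF.
- by move=> y Uy; exact: ddf.
- by move=> s1 s2 st1 st2; rewrite addrA [_ *: v + _]addrC; exact: dU (small _ _ st2 st1).
exists (s' *: u + s *: v), (r *: u + r' *: v); split.
- exact: lt_le_trans (small s s' st st') de.
- exact: lt_le_trans (small r' r rt' rt) de.
rewrite -[in LHS](addrA (s' *: u)) [r *: u + _]addrC -[in RHS](addrA (r' *: v)).
by rewrite E1 E2 (addrCA (t *: u)); congr (_ / _); ring.
Qed.

Lemma smooth_schwarz U f u v x : open U -> U x -> smooth U f ->
  'D_u ('D_v f) x = 'D_v ('D_u f) x.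
Proof.
move=> oU Ux fs; apply: (schwarz oU Ux).
- by move=> y; exact: smooth_diff.
- by move=> y w; apply: smooth_diff; exact: smooth_derive.
- by apply: (smooth_continuous _ Ux); do 2 apply: smooth_derive.
- by apply: (smooth_continuous _ Ux); do 2 apply: smooth_derive.
Qed.

End smooth_functions.

Definition msmooth (R : realType) m p q (U : set 'rV[R]_m)
    (F : 'rV[R]_m -> 'M[R]_(p, q)) : Prop :=
  forall i j, smooth U (fun y => F y i j).

Section smooth_matrices.
Context {R : realType} {m : nat}.
Implicit Types (U : set 'rV[R]_m) (x u v : 'rV[R]_m).

Lemma derive_entry p q (F : 'rV[R]_m -> 'M[R]_(p, q)) v x i j :
  derivable F x v -> 'D_v F x i j = 'D_v (fun y => F y i j) x.
Proof. by move=> /derive_mx ->; rewrite mxE. Qed.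

Lemma continuous_entry p q (F : 'rV[R]_m -> 'M[R]_(p, q)) x i j :
  {for x, continuous F} -> {for x, continuous (fun y => F y i j)}.
Proof.
move=> Fc; apply: (@continuous_comp _ _ _ F (fun A : 'M[R]_(p, q) => A i j)) => //.
exact: coord_continuous.
Qed.

Lemma differentiable_row n (F : 'rV[R]_m -> 'rV[R]_n) x :
  (forall i, differentiable (fun y => F y ord0 i) x) -> differentiable F x.
Proof.
move=> dF; have -> : F = \sum_(i < n) (fun y => F y ord0 i *: (delta_mx 0 i : 'rV[R]_n)).
  by apply/funext => y; rewrite fct_sumE [LHS]row_sum_delta.
by apply: differentiable_sum => i; apply: differentiableZl; exact: dF.
Qed.

Lemma derive_comp n (W : normedModType R) (F : 'rV[R]_m -> 'rV[R]_n)
    (f : 'rV[R]_n -> W) x v :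
  differentiable F x -> differentiable f (F x) ->
  'D_v (f \o F) x = 'D_('D_v F x) f (F x).
Proof.
move=> dF df; rewrite !deriveE //; first by rewrite diff_comp.
exact: differentiable_comp.
Qed.

Section open_domain.
Variable U : set 'rV[R]_m.
Hypothesis oU : open U.

(** Words of length one in [smooth_on] give continuous partials, hence Fréchet differentiability;
    the induction then passes to directional derivatives. *)
Lemma smooth_on_msmooth p q (F : 'rV[R]_m -> 'M[R]_(p, q)) :
  smooth_on U F -> msmooth U F.
Proof.
move=> Fs i j k; elim: k F Fs => [|k IH] F Fs.
  by move=> x Ux; apply: continuous_entry; have [] := Fs [::] x Ux.
have dF y v : U y -> derivable F y v by move=> Uy; have [_ h] := Fs [::] y Uy; exact: h.
split=> [x Ux|v].
  apply: (continuous_partials_differentiable oU Ux) => [y Uy a|a].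
    by have /derivable_mxP := dF y (delta_mx 0 a) Uy; apply.
  have ent y : U y -> 'D_(delta_mx 0 a) F y i j = 'D_(delta_mx 0 a) (fun y => F y i j) y.
    by move=> Uy; apply: derive_entry; exact: dF.
  apply: (near_eq_continuous (open_near oU Ux ent)).
  by apply: continuous_entry; have [] := Fs [:: delta_mx 0 a] x Ux.
apply: (eq_Ck oU _ (IH _ (smooth_on_derive v Fs))) => y Uy.
by apply: derive_entry; exact: dF.
Qed.

Lemma msmooth_derivable p q (F : 'rV[R]_m -> 'M[R]_(p, q)) x v :
  msmooth U F -> U x -> derivable F x v.
Proof.
move=> Fs Ux; apply/derivable_mxP => i j; apply: diff_derivable.
exact: (smooth_diff (Fs i j)).
Qed.

Lemma msmooth_diff n (F : 'rV[R]_m -> 'rV[R]_n) x :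
  msmooth U F -> U x -> differentiable F x.
Proof. by move=> Fs Ux; apply: differentiable_row => i; exact: (smooth_diff (Fs _ i)). Qed.

Lemma msmooth_derive p q (F : 'rV[R]_m -> 'M[R]_(p, q)) v :
  msmooth U F -> msmooth U ('D_v F).
Proof.
move=> Fs i j; apply: (eq_smooth oU _ (smooth_derive v (Fs i j))) => y Uy.
by rewrite derive_entry //; exact: msmooth_derivable.
Qed.

Lemma eq_msmooth p q (F F' : 'rV[R]_m -> 'M[R]_(p, q)) :
  (forall y, U y -> F y = F' y) -> msmooth U F -> msmooth U F'.
Proof. by move=> FF Fs i j; apply: (eq_smooth oU _ (Fs i j)) => y /FF ->. Qed.

Lemma msmooth_cst p q (A : 'M[R]_(p, q)) : msmooth U (fun=> A).
Proof. by move=> i j k; exact: Ck_cst. Qed.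

Lemma msmooth_id : msmooth U id.
Proof. by move=> i j k; rewrite ord1; exact: Ck_coord. Qed.

Lemma msmoothD p q (F G : 'rV[R]_m -> 'M[R]_(p, q)) :
  msmooth U F -> msmooth U G -> msmooth U (fun y => F y + G y).
Proof.
move=> Fs Gs i j k; apply: (eq_Ck oU _ (CkD oU (Fs i j k) (Gs i j k))) => y _.
by rewrite mxE.
Qed.

Lemma msmoothN p q (F : 'rV[R]_m -> 'M[R]_(p, q)) :
  msmooth U F -> msmooth U (fun y => - F y).
Proof. by move=> Fs i j k; apply: (eq_Ck oU _ (CkN oU (Fs i j k))) => y _; rewrite mxE. Qed.

Lemma msmoothZ p q (a : 'rV[R]_m -> R) (F : 'rV[R]_m -> 'M[R]_(p, q)) :
  smooth U a -> msmooth U F -> msmooth U (fun y => a y *: F y).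
Proof.
move=> sa Fs i j k; apply: (eq_Ck oU _ (CkM oU (sa k) (Fs i j k))) => y _.
by rewrite mxE.
Qed.

Lemma msmooth_sum p q (I : Type) (r : seq I) (P : pred I)
    (F : I -> 'rV[R]_m -> 'M[R]_(p, q)) :
  (forall i, P i -> msmooth U (F i)) -> msmooth U (fun y => \sum_(i <- r | P i) F i y).
Proof.
move=> Fs i j k.
apply: (eq_Ck oU _ (Ck_sum oU r (fun a Pa => Fs a Pa i j k))) => y _.
by rewrite summxE.
Qed.

Lemma msmooth_mulmx p q r (A : 'rV[R]_m -> 'M[R]_(p, q)) (B : 'rV[R]_m -> 'M[R]_(q, r)) :
  msmooth U A -> msmooth U B -> msmooth U (fun y => A y *m B y).
Proof.
move=> As Bs i j k.
apply: (eq_Ck oU _ (Ck_sum oU _ (fun a _ => CkM oU (As i a k) (Bs a j k)))) => y _.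
by rewrite mxE.
Qed.

Lemma msmooth_trmx p q (A : 'rV[R]_m -> 'M[R]_(p, q)) :
  msmooth U A -> msmooth U (fun y => (A y)^T).
Proof. by move=> As i j k; apply: (eq_Ck oU _ (As j i k)) => y _; rewrite mxE. Qed.

(** The chain rule writes a derivative of the composite as a sum of products with partials of [f]
    along [F], to which the induction applies. *)
Lemma Ck_comp k n (U' : set 'rV[R]_n) (F : 'rV[R]_m -> 'rV[R]_n) (f : 'rV[R]_n -> R) :
  msmooth U F -> (forall y, U y -> U' (F y)) -> Ck k U' f -> Ck k U (f \o F).
Proof.
move=> Fs FU; elim: k f => [|k IH] f fs.
  move=> x Ux; apply: continuous_comp; last exact: (fs _ (FU _ Ux)).
  by apply: differentiable_continuous; exact: msmooth_diff.
have [df fs'] := fs; split=> [x Ux|v].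
  by apply: differentiable_comp; [exact: msmooth_diff|apply: df; exact: FU].
apply: (eq_Ck oU _ (Ck_sum oU (index_enum 'I_n) (fun a (_ : xpredT a) => CkM oU
  (smooth_derive v (Fs ord0 a) k) (IH _ (fs' (delta_mx 0 a)))))) => y Uy /=.
rewrite derive_comp; [|exact: msmooth_diff|by apply: df; exact: FU].
rewrite derive_dirE; last by apply: df; exact: FU.
apply: eq_bigr => a _; rewrite derive_entry //; exact: msmooth_derivable.
Qed.

Lemma smooth_comp n (U' : set 'rV[R]_n) (F : 'rV[R]_m -> 'rV[R]_n) (f : 'rV[R]_n -> R) :
  msmooth U F -> (forall y, U y -> U' (F y)) -> smooth U' f -> smooth U (f \o F).
Proof. by move=> Fs FU fs k; exact: Ck_comp (fs k). Qed.

Lemma msmooth_comp p q n (U' : set 'rV[R]_n) (F : 'rV[R]_m -> 'rV[R]_n)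
    (f : 'rV[R]_n -> 'M[R]_(p, q)) :
  msmooth U F -> (forall y, U y -> U' (F y)) -> msmooth U' f ->
  msmooth U (fun y => f (F y)).
Proof. by move=> Fs FU fs i j; exact: (smooth_comp Fs FU (fs i j)). Qed.

Lemma smooth_det n (A : 'rV[R]_m -> 'M[R]_n) :
  msmooth U A -> smooth U (fun y => \det (A y)).
Proof.
move=> As k; apply: Ck_sum => // s _; apply: CkM => //; first exact: Ck_cst.
by apply: Ck_prod => // i _; exact: As.
Qed.

(** Cramer's rule: determinant and cofactors are polynomials in the entries. *)
Lemma msmooth_invmx n (A : 'rV[R]_m -> 'M[R]_n) :
  (forall y, U y -> A y \in unitmx) -> msmooth U A -> msmooth U (fun y => invmx (A y)).
Proof.
move=> Au As i j k.
have dets : Ck k U (fun y => (\det (A y))^-1).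
  by apply: CkV => //; [move=> x /Au; rewrite unitmxE unitfE|exact: smooth_det].
have adjs : Ck k U (fun y => (\adj (A y)) i j).
  have : Ck k U (fun y => cofactor (A y) j i).
    apply: CkM => //; first exact: Ck_cst.
    apply: smooth_det => a b l; apply: (eq_Ck oU _ (As (lift j a) (lift i b) l)) => y _.
    by rewrite !mxE.
  by apply: (eq_Ck oU) => y _; rewrite mxE.
apply: (eq_Ck oU _ (CkM oU dets adjs)) => y Uy.
by rewrite /invmx (Au _ Uy) [RHS]mxE.
Qed.

Lemma smooth_entry p q (F : 'rV[R]_m -> 'M[R]_(p, q)) i j :
  msmooth U F -> smooth U (fun y => F y i j).
Proof. exact. Qed.

Section pointwise.
Variables (x : 'rV[R]_m).
Hypothesis Ux : U x.

Lemma derive_mulmx p q r v (A : 'rV[R]_m -> 'M[R]_(p, q)) (B : 'rV[R]_m -> 'M[R]_(q, r)) :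
  msmooth U A -> msmooth U B ->
  'D_v (fun y => A y *m B y) x = 'D_v A x *m B x + A x *m 'D_v B x.
Proof.
move=> As Bs; apply/matrixP => i j.
rewrite derive_entry; last exact: msmooth_derivable (msmooth_mulmx As Bs) Ux.
have -> : (fun y => (A y *m B y) i j) =
    \sum_(a < q) ((fun y => A y i a) * (fun y => B y a j)).
  by apply/funext => y; rewrite mxE fct_sumE.
have dA a : derivable (fun y => A y i a) x v.
  by apply: diff_derivable; exact: smooth_diff (As i a) Ux.
have dB a : derivable (fun y => B y a j) x v.
  by apply: diff_derivable; exact: smooth_diff (Bs a j) Ux.
rewrite derive_sum => [|a]; last exact: derivableM.
rewrite !mxE -big_split; apply: eq_bigr => a _ /=.
rewrite deriveM // !derive_entry; [|exact: msmooth_derivable..].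
by rewrite addrC; congr (_ + _); exact: mulrC.
Qed.

Lemma derive_trmx p q v (A : 'rV[R]_m -> 'M[R]_(p, q)) :
  msmooth U A -> 'D_v (fun y => (A y)^T) x = ('D_v A x)^T.
Proof.
move=> As; apply/matrixP => i j.
rewrite derive_entry; last exact: msmooth_derivable (msmooth_trmx As) Ux.
rewrite mxE derive_entry; last exact: msmooth_derivable.
by congr ('D_v _ x); apply/funext => y; rewrite mxE.
Qed.

Lemma msmooth_deriveP p q k (F : 'rV[R]_m -> 'M[R]_(p, q)) u v :
  msmooth U F ->
  'D_(k *: u + v) F x = k *: 'D_u F x + 'D_v F x.
Proof.
move=> Fs; apply/matrixP => i j; rewrite !mxE.
have E w : 'D_w F x i j = 'd (fun y => F y i j) x w.
  rewrite derive_entry; last exact: msmooth_derivable.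
  by rewrite deriveE //; exact: smooth_diff (Fs i j) Ux.
exact: (etrans (E (k *: u + v)) (etrans (linearP _ _ _ _) (esym (congr2 (fun a b => k * a + b) (E u) (E v))))).
Qed.

Lemma msmooth_schwarz p q (F : 'rV[R]_m -> 'M[R]_(p, q)) u v :
  msmooth U F -> 'D_u ('D_v F) x = 'D_v ('D_u F) x.
Proof.
move=> Fs; apply/matrixP => i j.
have E a b : 'D_a ('D_b F) x i j = 'D_a ('D_b (fun y => F y i j)) x.
  rewrite derive_entry; last by apply: msmooth_derivable => //; exact: msmooth_derive.
  apply: (eq_derive_open oU) => // y Uy; apply: derive_entry; exact: msmooth_derivable.
exact: (etrans (E u v) (etrans (smooth_schwarz u v oU Ux (Fs i j)) (esym (E v u)))).
Qed.

Lemma msmooth_derive_comp p q n (U' : set 'rV[R]_n) v (F : 'rV[R]_m -> 'rV[R]_n)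
    (f : 'rV[R]_n -> 'M[R]_(p, q)) :
  msmooth U F -> (forall y, U y -> U' (F y)) -> msmooth U' f ->
  'D_v (fun y => f (F y)) x = 'D_('D_v F x) f (F x).
Proof.
move=> Fs FU fs; apply/matrixP => i j.
rewrite (derive_entry _ _ (msmooth_derivable (msmooth_comp Fs FU fs) Ux)).
have dfx : derivable f (F x) ('D_v F x).
  apply/derivable_mxP => a b; apply: diff_derivable.
  exact: (smooth_diff (fs a b) (FU _ Ux)).
rewrite (derive_mx dfx) [RHS]mxE.
exact: (@derive_comp n R F (fun z => f z i j) x v (msmooth_diff Fs Ux)
    (smooth_diff (fs i j) (FU _ Ux))).
Qed.

End pointwise.
End open_domain.
End smooth_matrices.

(** * Coordinate Riemannian geometry *)

Section inner_algebra.
Context {R : realType} {n : nat}.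
Implicit Types (G : 'M[R]_n) (u v w : 'rV[R]_n).

Lemma innerDl G u v w : inner G (u + v) w = inner G u w + inner G v w.
Proof. by rewrite /inner !mulmxDl mxE. Qed.

Lemma innerZl G k u w : inner G (k *: u) w = k * inner G u w.
Proof. by rewrite /inner -!scalemxAl mxE. Qed.

Lemma innerDr G u v w : inner G w (u + v) = inner G w u + inner G w v.
Proof. by rewrite /inner linearD mulmxDr mxE. Qed.

Lemma innerZr G k u w : inner G w (k *: u) = k * inner G w u.
Proof. by rewrite /inner linearZ -scalemxAr mxE. Qed.

Lemma innerNl G u w : inner G (- u) w = - inner G u w.
Proof. by rewrite -scaleN1r innerZl mulN1r. Qed.

Lemma innerNr G u w : inner G w (- u) = - inner G w u.
Proof. by rewrite -scaleN1r innerZr mulN1r. Qed.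

Lemma innerBl G u v w : inner G (u - v) w = inner G u w - inner G v w.
Proof. by rewrite innerDl innerNl. Qed.

Lemma innerBr G u v w : inner G w (u - v) = inner G w u - inner G w v.
Proof. by rewrite innerDr innerNr. Qed.

Lemma inner0l G w : inner G 0 w = 0.
Proof. by rewrite -(scale0r (0 : 'rV_n)) innerZl mul0r. Qed.

Lemma inner0r G w : inner G w 0 = 0.
Proof. by rewrite -(scale0r (0 : 'rV_n)) innerZr mul0r. Qed.

Lemma inner_suml (I : Type) (r : seq I) (P : pred I) (F : I -> 'rV[R]_n) G w :
  inner G (\sum_(i <- r | P i) F i) w = \sum_(i <- r | P i) inner G (F i) w.
Proof. by elim/big_rec2: _ => [|i y1 y2 _ <-]; rewrite ?inner0l ?innerDl. Qed.

Lemma inner_sumr (I : Type) (r : seq I) (P : pred I) (F : I -> 'rV[R]_n) G w :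
  inner G w (\sum_(i <- r | P i) F i) = \sum_(i <- r | P i) inner G w (F i).
Proof. by elim/big_rec2: _ => [|i y1 y2 _ <-]; rewrite ?inner0r ?innerDr. Qed.

Lemma innerDm G G' u v : inner (G + G') u v = inner G u v + inner G' u v.
Proof. by rewrite /inner mulmxDr mulmxDl mxE. Qed.

Lemma innerZm G k u v : inner (k *: G) u v = k * inner G u v.
Proof. by rewrite /inner -scalemxAr -scalemxAl mxE. Qed.

Lemma innerBm G G' u v : inner (G - G') u v = inner G u v - inner G' u v.
Proof. by rewrite innerDm -scaleN1r innerZm mulN1r. Qed.

Lemma innerC G u v : symmetric_matrix G -> inner G u v = inner G v u.
Proof.
move=> sG; rewrite /inner -[in LHS](trmxK (u *m G *m v^T)) mxE.
by rewrite !trmx_mul trmxK sG mulmxA.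
Qed.

Lemma inner_delta G i j : inner G (delta_mx 0 i) (delta_mx 0 j) = G i j.
Proof. by rewrite /inner -rowE trmx_delta -colE !mxE. Qed.

Lemma innerE G u v : inner G u v = \sum_i \sum_j u ord0 i * v ord0 j * G i j.
Proof.
rewrite {1}(row_sum_delta u) inner_suml; apply: eq_bigr => i _.
rewrite {1}(row_sum_delta v) inner_sumr; apply: eq_bigr => j _.
by rewrite innerZl innerZr inner_delta mulrA.
Qed.

Lemma positive_definite_unit G : positive_definite G -> G \in unitmx.
Proof.
move=> Gp; rewrite -row_free_unit -kermx_eq0; apply/eqP/row_matrixP => i.
rewrite row0; apply/eqP; apply: contraT => /Gp.
by rewrite /inner -row_mul mulmx_ker row0 mul0mx mxE ltxx.
Qed.

Lemma positive_definite_ge0 G u : positive_definite G -> 0 <= inner G u u.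
Proof.
move=> Gp; have [->|/Gp/ltW //] := eqVneq u 0; by rewrite inner0l.
Qed.

Lemma positive_definite_eq0 G u : positive_definite G -> inner G u u = 0 -> u = 0.
Proof.
by move=> Gp u0; apply/eqP; apply: contraT => /Gp; rewrite u0 ltxx.
Qed.

Lemma null_vector_exists G : (forall u, 0 <= inner G u u) -> ~ positive_definite G ->
  exists2 w, w != 0 & inner G w w = 0.
Proof.
move=> G0 npos; apply: contrapT => nex; apply: npos => u u0.
rewrite lt_neqAle G0 andbT eq_sym; apply/eqP => Gu; apply: nex; by exists u.
Qed.

Lemma delta_neq0 (i : 'I_n) : delta_mx 0 i != 0 :> 'rV[R]_n.
Proof. by apply/eqP => /rowP/(_ i)/eqP; rewrite !mxE !eqxx oner_eq0. Qed.

Lemma inner_injl G u v : G \in unitmx -> (forall w, inner G u w = inner G v w) -> u = v.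
Proof.
move=> Gu uv; apply: (can_inj (mulmxK Gu)).
by apply/rowP => i; have := uv (delta_mx 0 i); rewrite /inner trmx_delta -!colE !mxE.
Qed.

Lemma inner_invmx G (a : 'rV[R]_n) w : G \in unitmx ->
  inner G (a *m invmx G) w = (a *m w^T) ord0 ord0.
Proof. by move=> Gu; rewrite /inner mulmxKV. Qed.

End inner_algebra.

Section derive_inner.
Context {R : realType} {m : nat}.
Variable U : set 'rV[R]_m.
Hypothesis oU : open U.

Section families.
Variables (n : nat) (B : 'rV[R]_m -> 'M[R]_n) (X Y : 'rV[R]_m -> 'rV[R]_n).
Hypotheses (Bs : msmooth U B) (Xs : msmooth U X) (Ys : msmooth U Y).

Lemma smooth_inner : smooth U (fun y => inner (B y) (X y) (Y y)).
Proof.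
apply: (smooth_entry (F := fun y => X y *m B y *m (Y y)^T)).
by apply: msmooth_mulmx => //; [exact: msmooth_mulmx|exact: msmooth_trmx].
Qed.

Lemma derive_inner v x : U x ->
  'D_v (fun y => inner (B y) (X y) (Y y)) x =
  inner ('D_v B x) (X x) (Y x) + inner (B x) ('D_v X x) (Y x)
  + inner (B x) (X x) ('D_v Y x).
Proof.
move=> Ux; have Ms : msmooth U (fun y => X y *m B y *m (Y y)^T).
  by apply: msmooth_mulmx => //; [exact: msmooth_mulmx|exact: msmooth_trmx].
rewrite /inner -(derive_entry _ _ (msmooth_derivable Ms Ux)).
rewrite (derive_mulmx oU Ux); [|exact: msmooth_mulmx|exact: msmooth_trmx].
rewrite (derive_mulmx oU Ux) // (derive_trmx oU Ux) // mulmxDl !mxE.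
by rewrite -!addrA addrCA addrA [X in X + _]addrC -!addrA.
Qed.

End families.
End derive_inner.

(* Sealed synonyms: unification is otherwise tempted to compare unequal
   directional derivatives by unfolding their limits. *)
HB.lock Definition dmx (R : realType) m p q (F : 'rV[R]_m -> 'M[R]_(p, q))
  (v x : 'rV[R]_m) : 'M[R]_(p, q) := 'D_v F x.
HB.lock Definition dscal (R : realType) m (f : 'rV[R]_m -> R) (v x : 'rV[R]_m) : R :=
  'D_v f x.
HB.lock Definition gamma (R : realType) n (H : 'rV[R]_n -> 'M[R]_n) (x u v : 'rV[R]_n)
  : 'rV[R]_n := christoffel H x u v.

Section unsealing.
Context {R : realType} {m : nat}.
Implicit Types (x u v w : 'rV[R]_m) (U : set 'rV[R]_m).

Lemma dmxE p q (F : 'rV[R]_m -> 'M[R]_(p, q)) v x : dmx F v x = 'D_v F x.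
Proof. by rewrite dmx.unlock. Qed.

Lemma dmx_funE p q (F : 'rV[R]_m -> 'M[R]_(p, q)) v : dmx F v = 'D_v F.
Proof. by apply/funext => x; rewrite dmxE. Qed.

Lemma dscalE (f : 'rV[R]_m -> R) v x : dscal f v x = 'D_v f x.
Proof. by rewrite dscal.unlock. Qed.

Lemma dscal_funE (f : 'rV[R]_m -> R) v : dscal f v = 'D_v f.
Proof. by apply/funext => x; rewrite dscalE. Qed.

Lemma gammaE (H : 'rV[R]_m -> 'M[R]_m) x u v : gamma H x u v = christoffel H x u v.
Proof. by rewrite gamma.unlock. Qed.

End unsealing.

Section sealed_derivatives.
Context {R : realType} {m : nat}.
Implicit Types (x u v w : 'rV[R]_m) (U : set 'rV[R]_m).

Variable U : set 'rV[R]_m.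
Hypothesis oU : open U.

Lemma msmooth_dmx p q (F : 'rV[R]_m -> 'M[R]_(p, q)) v :
  msmooth U F -> msmooth U (dmx F v).
Proof. by move=> Fs; rewrite dmx_funE; exact: msmooth_derive. Qed.

Lemma smooth_dscal (f : 'rV[R]_m -> R) v : smooth U f -> smooth U (dscal f v).
Proof. by move=> fs; rewrite dscal_funE; exact: smooth_derive. Qed.

Section at_point.
Variable x : 'rV[R]_m.
Hypothesis Ux : U x.

Lemma eq_dmx p q (F F' : 'rV[R]_m -> 'M[R]_(p, q)) v :
  (forall y, U y -> F y = F' y) -> dmx F v x = dmx F' v x.
Proof. by move=> FF; rewrite dmxE dmxE; exact: eq_derive_open FF Ux. Qed.

Lemma eq_dscal (f f' : 'rV[R]_m -> R) v :
  (forall y, U y -> f y = f' y) -> dscal f v x = dscal f' v x.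
Proof. by move=> ff; rewrite dscalE dscalE; exact: eq_derive_open ff Ux. Qed.

Lemma dmx_entry p q (F : 'rV[R]_m -> 'M[R]_(p, q)) v i j : msmooth U F ->
  dmx F v x i j = dscal (fun y => F y i j) v x.
Proof.
by move=> Fs; rewrite dmxE dscalE (derive_entry _ _ (msmooth_derivable Fs Ux)).
Qed.

Lemma dmx_cst p q (A : 'M[R]_(p, q)) v : dmx (fun=> A) v x = 0.
Proof. by rewrite dmxE; exact: derive_cst. Qed.

Lemma dscal_cst (a : R) v : dscal (fun=> a) v x = 0.
Proof. by rewrite dscalE; exact: derive_cst. Qed.

Lemma dmxD p q (F G : 'rV[R]_m -> 'M[R]_(p, q)) v : msmooth U F -> msmooth U G ->
  dmx (fun y => F y + G y) v x = dmx F v x + dmx G v x.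
Proof.
move=> Fs Gs; rewrite dmxE dmxE dmxE.
exact: deriveD (msmooth_derivable Fs Ux) (msmooth_derivable Gs Ux).
Qed.

Lemma dscalD (f g : 'rV[R]_m -> R) v : smooth U f -> smooth U g ->
  dscal (fun y => f y + g y) v x = dscal f v x + dscal g v x.
Proof.
move=> fs gs; rewrite dscalE dscalE dscalE; apply: deriveD; apply: diff_derivable.
  exact: smooth_diff fs Ux.
exact: smooth_diff gs Ux.
Qed.

Lemma dscalM (f g : 'rV[R]_m -> R) v : smooth U f -> smooth U g ->
  dscal (fun y => f y * g y) v x = dscal f v x * g x + f x * dscal g v x.
Proof.
move=> fs gs; rewrite dscalE dscalE dscalE.
have df := diff_derivable (v := v) (smooth_diff fs Ux).
have dg := diff_derivable (v := v) (smooth_diff gs Ux).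
by apply: etrans (deriveM df dg) _; rewrite addrC; congr (_ + _); first exact: mulrC.
Qed.

Lemma dmx_dirP p q (F : 'rV[R]_m -> 'M[R]_(p, q)) k u v : msmooth U F ->
  dmx F (k *: u + v) x = k *: dmx F u x + dmx F v x.
Proof. by move=> Fs; rewrite dmxE dmxE dmxE; exact: (msmooth_deriveP Ux). Qed.

Lemma dscal_dirP (f : 'rV[R]_m -> R) k u v : smooth U f ->
  dscal f (k *: u + v) x = k * dscal f u x + dscal f v x.
Proof.
move=> fs; rewrite dscalE dscalE dscalE.
have df := smooth_diff fs Ux.
by rewrite (@deriveE _ _ _ f x _ df) (@deriveE _ _ _ f x u df) (@deriveE _ _ _ f x v df) linearP.
Qed.

Lemma dmx_schwarz p q (F : 'rV[R]_m -> 'M[R]_(p, q)) u v : msmooth U F ->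
  dmx (dmx F v) u x = dmx (dmx F u) v x.
Proof.
by move=> Fs; rewrite (dmx_funE F v) (dmx_funE F u) dmxE dmxE; exact: (msmooth_schwarz oU Ux u v Fs).
Qed.

Lemma dscal_inner n (B : 'rV[R]_m -> 'M[R]_n) (X Y : 'rV[R]_m -> 'rV[R]_n) v :
  msmooth U B -> msmooth U X -> msmooth U Y ->
  dscal (fun y => inner (B y) (X y) (Y y)) v x =
  inner (dmx B v x) (X x) (Y x) + inner (B x) (dmx X v x) (Y x)
  + inner (B x) (X x) (dmx Y v x).
Proof.
by move=> Bs Xs Ys; rewrite dscalE dmxE dmxE dmxE; exact: (derive_inner oU Bs Xs Ys v Ux).
Qed.

Lemma dmx_comp p q n (U' : set 'rV[R]_n) v (F : 'rV[R]_m -> 'rV[R]_n)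
    (f : 'rV[R]_n -> 'M[R]_(p, q)) :
  msmooth U F -> (forall y, U y -> U' (F y)) -> msmooth U' f ->
  dmx (fun y => f (F y)) v x = dmx f (dmx F v x) (F x).
Proof.
by move=> Fs FU fs; rewrite dmxE dmxE dmxE; exact: (msmooth_derive_comp oU Ux v Fs FU fs).
Qed.

Lemma dmx_id v : dmx id v x = v.
Proof. by rewrite dmxE; exact: derive_id. Qed.

Lemma dmxZr p q k (F : 'rV[R]_m -> 'M[R]_(p, q)) u : msmooth U F ->
  dmx F (k *: u) x = k *: dmx F u x.
Proof.
move=> Fs; have E0 : dmx F 0 x = 0.
  by have := dmx_dirP (-1) 0 0 Fs; rewrite scaler0 addr0 scaleN1r addNr.
by rewrite -[k *: u]addr0 dmx_dirP // E0 addr0.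
Qed.

End at_point.
End sealed_derivatives.

Definition metric_on (R : realType) n (U : set 'rV[R]_n) (H : 'rV[R]_n -> 'M[R]_n) : Prop :=
  [/\ open U, msmooth U H, forall z, U z -> symmetric_matrix (H z)
    & forall z, U z -> positive_definite (H z)].

Section christoffel_symbols.
Context {R : realType} {n : nat}.
Variables (U : set 'rV[R]_n) (H : 'rV[R]_n -> 'M[R]_n).
Hypothesis HU : metric_on U H.
Implicit Types (u v w z : 'rV[R]_n).

Let oU : open U. Proof. by case: HU. Qed.
Let Hs : msmooth U H. Proof. by case: HU. Qed.
Let Hsym z : U z -> symmetric_matrix (H z). Proof. by case: HU => _ _ + _; exact. Qed.
Let Hpos z : U z -> positive_definite (H z). Proof. by case: HU => _ _ _; exact. Qed.

Definition koszul z u v w : R := 2^-1 * (inner (dmx H u z) v w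
  + inner (dmx H v z) u w - inner (dmx H w z) u v).

Lemma dscal_metric z u v w : U z ->
  dscal (fun y => inner (H y) v w) u z = inner (dmx H u z) v w.
Proof.
move=> Uz; rewrite (dscal_inner oU Uz _ Hs (msmooth_cst oU v) (msmooth_cst oU w)).
by rewrite !dmx_cst inner0l inner0r !addr0.
Qed.

Lemma dmx_metricC z u v w : U z -> inner (dmx H u z) v w = inner (dmx H u z) w v.
Proof.
move=> Uz; apply: innerC; rewrite /symmetric_matrix dmxE -(derive_trmx oU Uz) //.
by apply: (eq_derive_open oU) => // y Uy; exact: Hsym.
Qed.

Lemma dmx_metric_dirP z k u u' v w : U z ->
  inner (dmx H (k *: u + u') z) v w = k * inner (dmx H u z) v w + inner (dmx H u' z) v w.
Proof. by move=> Uz; rewrite (dmx_dirP Uz) // innerDm innerZm. Qed.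

Lemma koszul_sum z u v w : U z ->
  \sum_l w ord0 l * koszul z u v (delta_mx 0 l) = koszul z u v w.
Proof.
move=> Uz; pose L w := koszul z u v w.
have LP k a b : L (k *: a + b) = k * L a + L b.
  by rewrite /L /koszul dmx_metric_dirP // !innerDr !innerZr; ring.
rewrite {2}(row_sum_delta w) -/(L _).
elim/big_rec2: _ => [|l y1 y2 _ ->].
  have := LP (-1) 0 0; rewrite scaler0 addr0 mulN1r => h; lra.
by rewrite LP.
Qed.

Lemma gamma_inner z u v w : U z -> inner (H z) (gamma H z u v) w = koszul z u v w.
Proof.
move=> Uz; rewrite gammaE /christoffel inner_invmx; last exact: positive_definite_unit (Hpos Uz).
rewrite -koszul_sum // mxE; apply: eq_bigr => l _; rewrite !mxE mulrC.
by rewrite /koszul -!dscal_metric // !dscalE.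
Qed.

Lemma gammaC z u v : U z -> gamma H z u v = gamma H z v u.
Proof.
move=> Uz; apply: (inner_injl (positive_definite_unit (Hpos Uz))) => w.
rewrite !gamma_inner // /koszul [inner (dmx H w z) u v]dmx_metricC //.
by rewrite [X in X - _]addrC.
Qed.

Lemma gammaPl z k u u' v : U z ->
  gamma H z (k *: u + u') v = k *: gamma H z u v + gamma H z u' v.
Proof.
move=> Uz; apply: (inner_injl (positive_definite_unit (Hpos Uz))) => w.
rewrite innerDl innerZl !gamma_inner // /koszul (dmx_metric_dirP k u u') //.
by rewrite !innerDl !innerZl; ring.
Qed.

Lemma gammaPr z k u u' v : U z ->
  gamma H z v (k *: u + u') = k *: gamma H z v u + gamma H z v u'.
Proof. by move=> Uz; rewrite gammaC // gammaPl // ![gamma H z _ v]gammaC. Qed.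

(** Adding the Koszul expressions for (w, u, v) and (w, v, u) leaves only the derivative of the
    metric along [w]. *)
Lemma gamma_compat z w u v : U z ->
  inner (dmx H w z) u v =
  inner (H z) (gamma H z w u) v + inner (H z) u (gamma H z w v).
Proof.
move=> Uz; rewrite [inner (H z) u _]innerC; last exact: Hsym.
rewrite !gamma_inner // /koszul.
by rewrite [inner (dmx H w z) v u]dmx_metricC //; field.
Qed.

Lemma msmooth_gamma u v : msmooth U (fun z => gamma H z u v).
Proof.
have Hi : msmooth U (fun z => invmx (H z)).
  by apply: (msmooth_invmx oU) => // z Uz; exact: positive_definite_unit (Hpos Uz).
apply: (eq_msmooth oU (fun y _ => esym (gammaE H y u v))).
apply: (msmooth_mulmx oU _ Hi) => i l.
have Es a b c : smooth U (fun z => inner (dmx H a z) b c).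
  apply: (smooth_inner oU) => //; [|exact: msmooth_cst..].
  exact: (msmooth_dmx oU _ Hs).
have Ks : smooth U (fun z => koszul z u v (delta_mx 0 l)).
  move=> k; apply: (CkM oU); first exact: (Ck_cst oU).
  apply: (CkD oU (CkD oU (Es _ _ _ k) (Es _ _ _ k)) (CkN oU (Es _ _ _ k))).
by apply: (eq_smooth oU _ Ks) => z Uz; rewrite mxE /koszul -!dscal_metric // !dscalE.
Qed.

(** One component of the symbols as a field of bilinear forms, so that the derivative rule for
    [inner] covers [gamma] with all three arguments varying. *)
Definition gamma_coord k z : 'M[R]_n :=
  \matrix_(i, j) gamma H z (delta_mx 0 i) (delta_mx 0 j) ord0 k.

Lemma gamma0l z v : U z -> gamma H z 0 v = 0.
Proof.
move=> Uz; have := gammaPl (-1) 0 0 v Uz.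
by rewrite scaler0 addr0 scaleN1r addNr.
Qed.

Lemma gamma0r z v : U z -> gamma H z v 0 = 0.
Proof. by move=> Uz; rewrite gammaC // gamma0l. Qed.

Lemma gammaZl z k u v : U z ->
  gamma H z (k *: u) v = k *: gamma H z u v.
Proof.
by move=> Uz; rewrite -[k *: u]addr0 gammaPl // gamma0l // addr0.
Qed.

Lemma gammaZr z k u v : U z ->
  gamma H z v (k *: u) = k *: gamma H z v u.
Proof. by move=> Uz; rewrite gammaC // gammaZl // gammaC. Qed.

Lemma gammaDr z u u' v : U z ->
  gamma H z v (u + u') = gamma H z v u + gamma H z v u'.
Proof. by move=> Uz; rewrite -[u in u + u']scale1r gammaPr // scale1r. Qed.

Lemma gamma_coordE k z u v : U z ->
  inner (gamma_coord k z) u v = gamma H z u v ord0 k.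
Proof.
move=> Uz; rewrite innerE [in RHS](row_sum_delta u).
have E1 (r : seq 'I_n) (a : 'I_n -> R) (F : 'I_n -> 'rV[R]_n) w :
    gamma H z (\sum_(i <- r) a i *: F i) w = \sum_(i <- r) a i *: gamma H z (F i) w.
  elim: r => [|i r IH]; first by rewrite !big_nil gamma0l.
  by rewrite !big_cons gammaPl // IH.
rewrite E1 summxE; apply: eq_bigr => i _; rewrite mxE.
rewrite {2}(row_sum_delta v) gammaC // E1 summxE mulr_sumr.
by apply: eq_bigr => j _; rewrite !mxE [gamma H z (delta_mx 0 j) _]gammaC // mulrA.
Qed.

Lemma msmooth_gamma_coord k : msmooth U (gamma_coord k).
Proof.
move=> i j; apply: (eq_smooth oU _ (msmooth_gamma (delta_mx 0 i) (delta_mx 0 j) ord0 k)).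
by move=> z _; rewrite mxE.
Qed.

Section along_map.
Variables (m : nat) (D : set 'rV[R]_m) (psi X Y : 'rV[R]_m -> 'rV[R]_n).
Hypotheses (oD : open D) (psis : msmooth D psi) (psiU : forall y, D y -> U (psi y)).
Hypotheses (Xs : msmooth D X) (Ys : msmooth D Y).

Let Cs k : msmooth D (fun y => gamma_coord k (psi y)).
Proof. exact: (msmooth_comp oD psis psiU (msmooth_gamma_coord k)). Qed.

Lemma msmooth_gamma_along : msmooth D (fun y => gamma H (psi y) (X y) (Y y)).
Proof.
move=> i k; rewrite ord1.
apply: (eq_smooth oD _ (smooth_inner oD (Cs k) Xs Ys)) => y Dy.
by rewrite gamma_coordE //; exact: psiU.
Qed.

Lemma dmx_gamma_along x (v : 'rV[R]_m) : D x ->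
  dmx (fun y => gamma H (psi y) (X y) (Y y)) v x =
  dmx (fun z => gamma H z (X x) (Y x)) (dmx psi v x) (psi x)
  + gamma H (psi x) (dmx X v x) (Y x) + gamma H (psi x) (X x) (dmx Y v x).
Proof.
move=> Dx; have Ux := psiU Dx; apply/rowP => k.
rewrite (dmx_entry Dx _ _ _ msmooth_gamma_along).
have -> : dscal (fun y => gamma H (psi y) (X y) (Y y) ord0 k) v x =
    dscal (fun y => inner (gamma_coord k (psi y)) (X y) (Y y)) v x.
  by apply: (eq_dscal oD Dx) => y Dy; rewrite gamma_coordE //; exact: psiU.
rewrite (dscal_inner oD Dx _ (Cs k) Xs Ys) !gamma_coordE // [RHS]mxE [X in _ = X + _]mxE.
congr (_ + _ + _).
rewrite (dmx_comp oD Dx _ psis psiU (msmooth_gamma_coord k)).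
rewrite (dmx_entry Ux _ _ _ (msmooth_gamma _ _)).
have -> : dscal (fun z => gamma H z (X x) (Y x) ord0 k) (dmx psi v x) (psi x) =
    dscal (fun z => inner (gamma_coord k z) (X x) (Y x)) (dmx psi v x) (psi x).
  by apply: (eq_dscal oU Ux) => z Uz; rewrite gamma_coordE.
rewrite (dscal_inner oU Ux _ (msmooth_gamma_coord k) (msmooth_cst oU _) (msmooth_cst oU _)).
by rewrite !dmx_cst inner0l inner0r !addr0.
Qed.

End along_map.
End christoffel_symbols.

HB.lock Definition riemann (R : realType) n (H : 'rV[R]_n -> 'M[R]_n) (z a b w : 'rV[R]_n)
  : 'rV[R]_n := curvature H z a b w.

(** The pulled-back connection on fields along [psi]; taking [psi = id] gives the usual Levi-Civita
    connection. *)
HB.lock Definition cov (R : realType) m n (H : 'rV[R]_n -> 'M[R]_n)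
    (psi X : 'rV[R]_m -> 'rV[R]_n) (u y : 'rV[R]_m) : 'rV[R]_n :=
  dmx X u y + gamma H (psi y) (dmx psi u y) (X y).

HB.lock Definition sff (R : realType) m n (G : 'rV[R]_m -> 'M[R]_m)
    (H : 'rV[R]_n -> 'M[R]_n) (psi : 'rV[R]_m -> 'rV[R]_n) (x u v : 'rV[R]_m)
  : 'rV[R]_n := second_fundamental G H psi x u v.

Section covariant_derivative.
Context {R : realType} {m n : nat}.
Variables (U : set 'rV[R]_n) (H : 'rV[R]_n -> 'M[R]_n).
Hypothesis HU : metric_on U H.
Variables (D : set 'rV[R]_m) (psi : 'rV[R]_m -> 'rV[R]_n).
Hypotheses (oD : open D) (psis : msmooth D psi) (psiU : forall y, D y -> U (psi y)).
Implicit Types (X Y : 'rV[R]_m -> 'rV[R]_n) (x y u v w : 'rV[R]_m).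

Let oU : open U. Proof. by case: HU. Qed.
Let Hs : msmooth U H. Proof. by case: HU. Qed.

Lemma covE X u y : cov H psi X u y = dmx X u y + gamma H (psi y) (dmx psi u y) (X y).
Proof. by rewrite cov.unlock. Qed.

Lemma msmooth_metric_along : msmooth D (fun y => H (psi y)).
Proof. exact: (msmooth_comp oD psis psiU Hs). Qed.

Lemma msmooth_cov X u : msmooth D X -> msmooth D (cov H psi X u).
Proof.
move=> Xs; apply: (eq_msmooth oD (fun y _ => esym (covE X u y))).
apply: (msmoothD oD); first exact: msmooth_dmx.
exact: (msmooth_gamma_along HU oD psis psiU (msmooth_dmx oD u psis) Xs).
Qed.

Lemma cov_compat X Y u x : D x -> msmooth D X -> msmooth D Y ->
  dscal (fun y => inner (H (psi y)) (X y) (Y y)) u x =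
  inner (H (psi x)) (cov H psi X u x) (Y x) + inner (H (psi x)) (X x) (cov H psi Y u x).
Proof.
move=> Dx Xs Ys; rewrite (dscal_inner oD Dx u msmooth_metric_along Xs Ys).
rewrite (dmx_comp oD Dx u psis psiU Hs) (gamma_compat HU); last exact: psiU.
by rewrite (covE X) (covE Y) innerDl innerDr; ring.
Qed.

(** Zero torsion: second derivatives commute and the symbols are symmetric. *)
Lemma cov_sym u v x : D x -> cov H psi (dmx psi v) u x = cov H psi (dmx psi u) v x.
Proof.
move=> Dx; rewrite (covE (dmx psi v)) (covE (dmx psi u)) (dmx_schwarz oD Dx u v psis).
by rewrite (gammaC HU _ _ (psiU Dx)).
Qed.

Lemma covD X Y u x : D x -> msmooth D X -> msmooth D Y ->
  cov H psi (fun y => X y + Y y) u x = cov H psi X u x + cov H psi Y u x.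
Proof.
move=> Dx Xs Ys; rewrite (covE X) (covE Y) covE (dmxD Dx u Xs Ys).
rewrite (gammaDr HU _ _ _ (psiU Dx)); exact: addrACA.
Qed.

Lemma eq_cov X Y u x : D x -> (forall y, D y -> X y = Y y) ->
  cov H psi X u x = cov H psi Y u x.
Proof.
by move=> Dx XY; rewrite (covE X) (covE Y) (eq_dmx oD Dx u XY) XY.
Qed.

Lemma cov_dirP X k u v x : D x -> msmooth D X ->
  cov H psi X (k *: u + v) x = k *: cov H psi X u x + cov H psi X v x.
Proof.
move=> Dx Xs; rewrite (covE X (k *: u + v)) (covE X u) (covE X v).
rewrite (dmx_dirP Dx k u v Xs) (dmx_dirP Dx k u v psis) (gammaPl HU _ _ _ _ (psiU Dx)).
by rewrite scalerDr addrACA.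
Qed.

Lemma riemannE z a b (w : 'rV[R]_n) : U z -> riemann H z a b w =
  dmx (fun p => gamma H p b w) a z + gamma H z a (gamma H z b w)
  - (dmx (fun p => gamma H p a w) b z + gamma H z b (gamma H z a w)).
Proof.
move=> Uz; rewrite riemann.unlock /curvature.
have E c : levi_civita H c (cst w) = fun p => gamma H p c w.
  by apply/funext => y; rewrite /levi_civita derive_cst add0r gammaE.
rewrite (E b) (E a) /levi_civita.
by rewrite (dmxE (fun p => gamma H p b w)) (dmxE (fun p => gamma H p a w)) -!gammaE.
Qed.

(** The curvature of the pulled-back connection is the pull-back of the curvature; all other terms
    of the second derivative cancel by symmetry in [u] and [w]. *)
Lemma cov_comm X u w x : D x -> msmooth D X ->
  cov H psi (cov H psi X w) u x - cov H psi (cov H psi X u) w x =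
  riemann H (psi x) (dmx psi u x) (dmx psi w x) (X x).
Proof.
move=> Dx Xs; have Ux := psiU Dx; rewrite riemannE //.
have E a b : cov H psi (cov H psi X b) a x = dmx (dmx X b) a x
    + (dmx (fun z => gamma H z (dmx psi b x) (X x)) (dmx psi a x) (psi x)
       + gamma H (psi x) (dmx (dmx psi b) a x) (X x)
       + gamma H (psi x) (dmx psi b x) (dmx X a x))
    + (gamma H (psi x) (dmx psi a x) (dmx X b x)
       + gamma H (psi x) (dmx psi a x) (gamma H (psi x) (dmx psi b x) (X x))).
  have ps := msmooth_dmx oD b psis.
  rewrite covE; congr (_ + _); last by rewrite covE (gammaDr HU).
  rewrite (eq_dmx oD Dx a (fun y _ => covE X b y)) (dmxD Dx a (msmooth_dmx oD b Xs)).
    by rewrite (dmx_gamma_along HU oD psis psiU ps Xs).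
  exact: (msmooth_gamma_along HU oD psis psiU ps Xs).
rewrite (E u w) (E w u) (dmx_schwarz oD Dx u w Xs) (dmx_schwarz oD Dx u w psis).
set a1 := dmx (dmx X u) w x; set a2 := gamma _ _ _ _; set a3 := gamma _ _ _ _.
set a4 := dmx _ _ _; set a5 := gamma _ _ _ _.
set a6 := gamma _ _ _ _; set a7 := dmx _ _ _; set a8 := gamma _ _ _ _.
by apply/rowP => k; rewrite !mxE; ring.
Qed.

(** The Koszul formula for the pulled-back form, valid even where that form degenerates. Added up
    over the two factors of the graph it yields the normality of A. *)
Lemma cov_koszul u v w x : D x ->
  let P := fun a b y => inner (H (psi y)) (dmx psi a y) (dmx psi b y) in
  inner (H (psi x)) (cov H psi (dmx psi v) u x) (dmx psi w x) =
  2^-1 * (dscal (P v w) u x + dscal (P u w) v x - dscal (P u v) w x).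
Proof.
move=> Dx P; have ps a := msmooth_dmx oD a psis.
rewrite /P !cov_compat // (cov_sym v u Dx) (cov_sym w u Dx) (cov_sym w v Dx).
have Hsym a b : inner (H (psi x)) a b = inner (H (psi x)) b a.
  by apply: innerC; case: HU => _ _ + _; apply; exact: psiU.
by rewrite (Hsym (dmx psi u x)) [inner _ (dmx psi v x) _]Hsym; field.
Qed.

End covariant_derivative.

Section curvature_symmetries.
Context {R : realType} {n : nat}.
Variables (U : set 'rV[R]_n) (H : 'rV[R]_n -> 'M[R]_n).
Hypothesis HU : metric_on U H.
Implicit Types (z a b v w : 'rV[R]_n).

Let oU : open U. Proof. by case: HU. Qed.
Let Hs : msmooth U H. Proof. by case: HU. Qed.

Lemma riemannN z a b w : U z -> riemann H z a b w = - riemann H z b a w.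
Proof. by move=> Uz; rewrite !(riemannE _ _ _ _ Uz) opprB. Qed.

Lemma riemannZ z k a b w : U z -> riemann H z (k *: a) b w = k *: riemann H z a b w.
Proof.
move=> Uz; rewrite !(riemannE _ _ _ _ Uz) (gammaZl HU) //.
rewrite (dmxZr Uz _ _ (msmooth_gamma HU _ _)).
have -> : dmx (fun y => gamma H y (k *: a) w) b z = k *: dmx (fun y => gamma H y a w) b z.
  rewrite (eq_dmx oU Uz b (fun y Uy => gammaZl HU k a w Uy)).
  rewrite dmxE dmxE; exact: (deriveZ _ (msmooth_derivable (msmooth_gamma HU a w) Uz)).
by rewrite (gammaZl HU) // (gammaZr HU) // scalerBr !scalerDr.
Qed.

(** Second derivatives of [inner (H y) v w] commute; expanding both orders by metric compatibility
    leaves exactly the two curvature terms. *)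
Lemma riemann_skew z a b v w : U z ->
  inner (H z) (riemann H z a b v) w = - inner (H z) v (riemann H z a b w).
Proof.
move=> Uz; have ids := @msmooth_id R n U oU; have cs c := @msmooth_cst R n U oU 1 n c.
have idU y : U y -> U (id y) by [].
pose f y := inner (H y) v w.
have fs : smooth U f by exact: (smooth_inner oU Hs (cs v) (cs w)).
have Ef c y : U y -> dscal f c y = inner (H y) (cov H id (fun=> v) c y) w
    + inner (H y) v (cov H id (fun=> w) c y).
  by move=> Uy; exact: (cov_compat HU oU ids idU c Uy (cs v) (cs w)).
have cvs c d : msmooth U (cov H id (fun=> c) d) by exact: (msmooth_cov HU oU ids idU d (cs c)).
have E c d : dscal (dscal f d) c z =
    inner (H z) (cov H id (cov H id (fun=> v) d) c z) w
    + inner (H z) (cov H id (fun=> v) d z) (cov H id (fun=> w) c z)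
    + (inner (H z) (cov H id (fun=> v) c z) (cov H id (fun=> w) d z)
       + inner (H z) v (cov H id (cov H id (fun=> w) d) c z)).
  rewrite (eq_dscal oU Uz c (Ef d)) (dscalD Uz).
  - rewrite (cov_compat HU oU ids idU c Uz (cvs v d) (cs w)).
    by rewrite (cov_compat HU oU ids idU c Uz (cs v) (cvs w d)).
  - exact: (smooth_inner oU Hs (cvs v d) (cs w)).
  - exact: (smooth_inner oU Hs (cs v) (cvs w d)).
have S : dscal (dscal f b) a z = dscal (dscal f a) b z.
  by rewrite (dscal_funE f b) (dscal_funE f a) dscalE dscalE; exact: (smooth_schwarz a b oU Uz fs).
have := cov_comm HU oU ids idU a b Uz (cs v); have := cov_comm HU oU ids idU a b Uz (cs w).
rewrite !dmx_id /= => <- <-; move: S; rewrite (E a b) (E b a) innerBl innerBr; lra.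
Qed.

End curvature_symmetries.

Section linear_functions.
Context {R : realType} {V W : lmodType R}.
Variable f : V -> W.
Hypothesis lf : linear f.

Let L : {linear V -> W} := HB.pack f (GRing.isLinear.Build _ _ _ _ _ lf).

Lemma linear_fun_sum (I : Type) (r : seq I) (P : pred I) (F : I -> V) :
  f (\sum_(i <- r | P i) F i) = \sum_(i <- r | P i) f (F i).
Proof. exact: (linear_sum L). Qed.

Lemma linear_funN u : f (- u) = - f u.
Proof. exact: (linearN L). Qed.

Lemma linear_funZ k u : f (k *: u) = k *: f u.
Proof. exact: (linearZZ L). Qed.

Lemma linear_funD u v : f (u + v) = f u + f v.
Proof. exact: (linearD L). Qed.

End linear_functions.

(** * Orthonormal frames at a point, and traces *)

Section orthonormal_frames.
Context {R : realType} {m : nat}.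
Variables (g : 'M[R]_m) (e : 'I_m -> 'rV[R]_m).
Hypothesis eo : orthonormal_frame g e.

Definition frame_mx : 'M[R]_m := \matrix_k e k.

Lemma frame_mxP : frame_mx *m g *m frame_mx^T = 1%:M.
Proof.
apply/matrixP => k l; rewrite [RHS]mxE -(eo k l) /inner.
have -> : e k = row k frame_mx by rewrite rowK.
have -> : e l = row l frame_mx by rewrite rowK.
by rewrite -row_mul !mxE; apply: eq_bigr => i _; rewrite !mxE.
Qed.

Lemma frame_mx_inv : g \in unitmx /\ invmx g = frame_mx^T *m frame_mx.
Proof.
have E : g *m (frame_mx^T *m frame_mx) = 1%:M.
  have := frame_mxP; rewrite -mulmxA => /mulmx1C; by rewrite mulmxA.
have gu : g \in unitmx by have [] := mulmx1_unit E.
by split=> //; rewrite -[RHS]mul1mx -(mulVmx gu) -mulmxA E mulmx1.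
Qed.

Lemma frame_expansion w : w = \sum_k inner g w (e k) *: e k.
Proof.
have [gu E] := frame_mx_inv.
have : w = w *m g *m (frame_mx^T *m frame_mx) by rewrite -E mulmxK.
rewrite mulmxA mulmx_sum_row => {1}->; apply: eq_bigr => k _; rewrite rowK; congr (_ *: _).
rewrite /inner; have -> : e k = row k frame_mx by rewrite rowK.
by rewrite !mxE; apply: eq_bigr => i _; rewrite !mxE.
Qed.

Lemma frame_parseval u w : inner g u w = \sum_k inner g u (e k) * inner g (e k) w.
Proof.
rewrite {1}(frame_expansion u) inner_suml; apply: eq_bigr => k _.
by rewrite innerZl.
Qed.

(** The right-hand side involves only the inverse metric, so a trace is independent of the frame and
    can be differentiated in the base point without a smooth choice of frames. *)
Lemma frame_trace_bilinear (V : lmodType R) (b : 'rV[R]_m -> 'rV[R]_m -> V) :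
  (forall w, linear (b w)) -> (forall w, linear (b ^~ w)) ->
  \sum_k b (e k) (e k) =
  \sum_i \sum_j (invmx g) i j *: b (delta_mx 0 i) (delta_mx 0 j).
Proof.
move=> lr ll; have [_ ->] := frame_mx_inv.
have -> : \sum_k b (e k) (e k) = \sum_k \sum_i \sum_j
    (e k ord0 i * e k ord0 j) *: b (delta_mx 0 i) (delta_mx 0 j).
  apply: eq_bigr => k _; rewrite {1}(row_sum_delta (e k)).
  rewrite (linear_fun_sum (ll _)); apply: eq_bigr => i _.
  rewrite (linear_funZ (ll _)) {2}(row_sum_delta (e k)) (linear_fun_sum (lr _)) scaler_sumr.
  by apply: eq_bigr => j _; rewrite (linear_funZ (lr _)) scalerA.
rewrite exchange_big; apply: eq_bigr => i _; rewrite exchange_big; apply: eq_bigr => j _.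
rewrite -scaler_suml mxE; congr (_ *: _); apply: eq_bigr => k _.
by rewrite !mxE.
Qed.

End orthonormal_frames.

(** * The second fundamental form of a map, and harmonicity *)

Section second_fundamental_form.
Context {R : realType} {m n : nat}.
Variables (U : set 'rV[R]_n) (H : 'rV[R]_n -> 'M[R]_n).
Hypothesis HU : metric_on U H.
Variables (D : set 'rV[R]_m) (g : 'rV[R]_m -> 'M[R]_m) (psi : 'rV[R]_m -> 'rV[R]_n).
Hypotheses (gD : metric_on D g) (psis : msmooth D psi).
Hypothesis (psiU : forall y, D y -> U (psi y)).
Implicit Types (x y u v w : 'rV[R]_m).

Let oD : open D. Proof. by case: gD. Qed.
Let gs : msmooth D g. Proof. by case: gD. Qed.
Let gu y : D y -> g y \in unitmx.
Proof. by case: gD => _ _ _ gp Dy; exact: positive_definite_unit (gp y Dy). Qed.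
Let ps v : msmooth D (dmx psi v). Proof. exact: msmooth_dmx. Qed.

Lemma dmx_linear p q (F : 'rV[R]_m -> 'M[R]_(p, q)) x : D x -> msmooth D F ->
  linear (fun u => dmx F u x).
Proof. by move=> Dx Fs k u v; exact: (dmx_dirP Dx k u v Fs). Qed.

Lemma cov_linear X x : D x -> msmooth D X -> linear (fun u => cov H psi X u x).
Proof. by move=> Dx Xs k u v; exact: (cov_dirP HU psis psiU). Qed.

Lemma gamma_linearl x u : D x -> linear ((gamma g x)^~ u).
Proof. by move=> Dx k v w; exact: (gammaPl gD). Qed.

Lemma covZ (a : 'rV[R]_m -> R) (X : 'rV[R]_m -> 'rV[R]_n) u x :
  D x -> smooth D a -> msmooth D X ->
  cov H psi (fun y => a y *: X y) u x = dscal a u x *: X x + a x *: cov H psi X u x.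
Proof.
move=> Dx sa Xs; rewrite (covE _ _ (fun y => a y *: X y)) (covE _ _ X).
have -> : dmx (fun y => a y *: X y) u x = dscal a u x *: X x + a x *: dmx X u x.
  apply/rowP => k; rewrite (dmx_entry Dx _ _ _ (msmoothZ oD sa Xs)).
  rewrite mxE [X in _ = X + _]mxE [X in _ = _ + X]mxE (dmx_entry Dx _ _ _ Xs).
  rewrite -(dscalM Dx _ sa (Xs ord0 k)); apply: (eq_dscal oD Dx) => y _.
  by rewrite mxE.
by rewrite (gammaZr HU _ _ _ (psiU Dx)) scalerDr addrA.
Qed.

Lemma cov_cst0 u x : D x -> cov H psi (fun=> 0) u x = 0.
Proof.
by move=> Dx; rewrite covE (dmx_cst x (0 : 'rV_n)) add0r (gamma0r HU _ (psiU Dx)).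
Qed.

Lemma cov_sum (I : Type) (r : seq I) (F : I -> 'rV[R]_m -> 'rV[R]_n) u x :
  D x -> (forall i, msmooth D (F i)) ->
  cov H psi (fun y => \sum_(i <- r) F i y) u x = \sum_(i <- r) cov H psi (F i) u x.
Proof.
move=> Dx Fs; elim: r => [|i r IH].
  rewrite [RHS]big_nil; apply: etrans (cov_cst0 u Dx).
  by apply: (eq_cov H psi oD _ Dx) => y _; rewrite big_nil.
rewrite big_cons -IH -(covD HU psiU u Dx (Fs i)).
  by apply: (eq_cov H psi oD _ Dx) => y _; rewrite big_cons.
by apply: (msmooth_sum oD) => j _; exact: Fs.
Qed.

(** [W] is expanded in constant fields, to which the Leibniz rule applies; symmetry of the second
    covariant derivative then reassembles the sum at [x]. *)
Lemma cov_dmx_field (W : 'rV[R]_m -> 'rV[R]_m) v x : D x -> msmooth D W ->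
  cov H psi (fun y => dmx psi (W y) y) v x =
  dmx psi (dmx W v x) x + cov H psi (dmx psi (W x)) v x.
Proof.
move=> Dx Ws.
have E y : D y -> dmx psi (W y) y = \sum_i W y ord0 i *: dmx psi (delta_mx 0 i) y.
  move=> Dy; rewrite {1}(row_sum_delta (W y)) (linear_fun_sum (dmx_linear Dy psis)).
  by apply: eq_bigr => i _; rewrite (linear_funZ (dmx_linear Dy psis)).
rewrite (eq_cov H psi oD v Dx E) cov_sum //; last by move=> i; apply: (msmoothZ oD).
under eq_bigr => i _ do rewrite (covZ v Dx (Ws ord0 i) (ps _)).
rewrite big_split /=; congr (_ + _).
  rewrite [in RHS](row_sum_delta (dmx W v x)) (linear_fun_sum (dmx_linear Dx psis)).
  apply: eq_bigr => i _; rewrite (linear_funZ (dmx_linear Dx psis)).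
  by rewrite (dmx_entry Dx _ _ _ Ws).
rewrite (cov_sym HU oD psis psiU _ _ Dx) [in RHS](row_sum_delta (W x)).
rewrite (linear_fun_sum (cov_linear Dx (ps v))).
apply: eq_bigr => i _; rewrite (linear_funZ (cov_linear Dx (ps v))).
by rewrite (cov_sym HU oD psis psiU _ _ Dx).
Qed.

Lemma sffE x u v : D x ->
  sff g H psi x u v = cov H psi (dmx psi v) u x - dmx psi (gamma g x u v) x.
Proof.
move=> Dx; rewrite sff.unlock /second_fundamental /levi_civita derive_cst add0r.
rewrite covE (dmx_funE psi v) dmxE dmxE (dmxE psi (gamma _ _ _ _)) -!gammaE.
by [].
Qed.

Lemma sffC x u v : D x -> sff g H psi x u v = sff g H psi x v u.
Proof.
move=> Dx; rewrite (sffE u v Dx) (sffE v u Dx).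
by rewrite (cov_sym HU oD psis psiU u v Dx) (gammaC gD u v Dx).
Qed.

Lemma sff_linearr x u : D x -> linear (sff g H psi x u).
Proof.
move=> Dx; have ll : linear ((sff g H psi x)^~ u).
  move=> k v w; rewrite !(sffE _ _ Dx) (cov_linear Dx (ps u)) (gamma_linearl u Dx).
  by rewrite (dmx_linear Dx psis) scalerBr addrACA opprD.
by move=> k v w; rewrite !(sffC u _ Dx); exact: ll.
Qed.

Lemma sff_linearl x u : D x -> linear ((sff g H psi x)^~ u).
Proof. by move=> Dx k v w; rewrite !(sffC _ u Dx); exact: sff_linearr. Qed.

Lemma msmooth_sff u v : msmooth D (fun y => sff g H psi y u v).
Proof.
have Ws := msmooth_gamma gD u v.
apply: (eq_msmooth oD (fun y Dy => esym (sffE u v Dy))); apply: (msmoothD oD).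
  exact: (msmooth_cov HU oD psis psiU u (ps v)).
apply: (msmoothN oD).
apply: (eq_msmooth oD (F := fun y =>
   \sum_i gamma g y u v ord0 i *: dmx psi (delta_mx 0 i) y)).
  move=> y Dy; rewrite [in RHS](row_sum_delta (gamma g y u v)).
  rewrite (linear_fun_sum (dmx_linear Dy psis)).
  by apply: eq_bigr => i _; rewrite (linear_funZ (dmx_linear Dy psis)).
by apply: (msmooth_sum oD) => i _; apply: (msmoothZ oD).
Qed.

Lemma cov_sff u w v x : D x -> cov H psi (fun y => sff g H psi y u w) v x =
  cov H psi (cov H psi (dmx psi w) u) v x
  - (dmx psi (dmx (fun y => gamma g y u w) v x) x + cov H psi (dmx psi (gamma g x u w)) v x).
Proof.
move=> Dx; have Ws := msmooth_gamma gD u w.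
rewrite -(cov_dmx_field v Dx Ws).
have E y : D y -> cov H psi (dmx psi w) u y =
    sff g H psi y u w + dmx psi (gamma g y u w) y.
  by move=> Dy; rewrite sffE // subrK.
have Wf : msmooth D (fun y => dmx psi (gamma g y u w) y).
  apply: (eq_msmooth oD (F := fun y => cov H psi (dmx psi w) u y - sff g H psi y u w)).
    by move=> y Dy; rewrite E // addrAC subrr add0r.
  apply: (msmoothD oD); first exact: (msmooth_cov HU oD psis psiU u (ps w)).
  exact: (msmoothN oD (msmooth_sff u w)).
by rewrite (eq_cov H psi oD v Dx E) (covD HU psiU v Dx (msmooth_sff u w) Wf) addrK.
Qed.

(** Vanishing of the tension field of [psi] from (D, g) to (U, H), in the frame-free form that can
    be differentiated. *)
Definition harmonic : Prop := forall y, D y ->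
  \sum_i \sum_j invmx (g y) i j *: sff g H psi y (delta_mx 0 i) (delta_mx 0 j) = 0.

Hypothesis harm : harmonic.

Lemma dmx_invmx v x : D x ->
  dmx (fun y => invmx (g y)) v x = - (invmx (g x) *m dmx g v x *m invmx (g x)).
Proof.
move=> Dx; have ivs := msmooth_invmx oD gu gs.
have : dmx (fun y => g y *m invmx (g y)) v x = 0.
  rewrite -(dmx_cst x (1%:M : 'M[R]_m) v); apply: (eq_dmx oD Dx) => y Dy.
  by rewrite mulmxV // gu.
rewrite dmxE (derive_mulmx oD Dx _ gs ivs) -!dmxE => /eqP; rewrite addrC addr_eq0 => /eqP E.
by rewrite -[LHS](mulKmx (gu Dx)) E mulmxN mulmxA.
Qed.

Section at_frame.
Variables (x v : 'rV[R]_m) (e : 'I_m -> 'rV[R]_m).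
Hypotheses (Dx : D x) (eo : orthonormal_frame (g x) e).

(** Differentiating the trace also differentiates the inverse metric. By compatibility that
    derivative splits into two [gamma] sums, which agree because [sff] is symmetric: hence the
    factor 2. *)
Lemma harmonic_derivative :
  \sum_k cov H psi (fun y => sff g H psi y (e k) (e k)) v x =
  2 *: \sum_k sff g H psi x (e k) (gamma g x v (e k)).
Proof.
pose S i j y := sff g H psi y (delta_mx 0 i) (delta_mx 0 j).
have ivs := msmooth_invmx oD gu gs.
have : cov H psi (fun y => \sum_i \sum_j invmx (g y) i j *: S i j y) v x = 0.
  by apply: etrans (cov_cst0 v Dx); apply: (eq_cov H psi oD v Dx); exact: harm.
have Ss i j : msmooth D (S i j) by exact: msmooth_sff.
have Zs i j : msmooth D (fun y => invmx (g y) i j *: S i j y).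
  by apply: (msmoothZ oD) => //; exact: ivs.
rewrite cov_sum //; last by move=> i; apply: (msmooth_sum oD).
under eq_bigr => i _ do rewrite cov_sum //.
under eq_bigr => i _ do under eq_bigr => j _ do
  rewrite (covZ v Dx (ivs i j) (Ss i j)).
under eq_bigr => i _ do rewrite big_split /=.
rewrite big_split /= addrC => /eqP; rewrite addr_eq0 => /eqP E.
pose cS a b := cov H psi (fun y => sff g H psi y a b) v x.
have cSr a : linear (cS a).
  move=> k b c; rewrite /cS.
  rewrite (eq_cov H psi oD v Dx (fun y Dy => sff_linearr a Dy k b c)).
  have Zb : msmooth D (fun y => k *: sff g H psi y a b).
    by apply: (msmoothZ oD (a := fun=> k)); [move=> d; exact: (Ck_cst oD)|exact: msmooth_sff].
  rewrite (covD HU psiU v Dx Zb (msmooth_sff a c)); congr (_ + _).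
  rewrite (covZ (a := fun=> k) v Dx _ (msmooth_sff a b)); last by move=> d; exact: (Ck_cst oD).
  by rewrite dscal_cst scale0r add0r.
have cSC a b : cS a b = cS b a.
  by apply: (eq_cov H psi oD v Dx) => y Dy; exact: sffC.
have cSl a : linear (cS^~ a).
  by move=> k b c; rewrite !(cSC _ a); exact: cSr.
rewrite (frame_trace_bilinear eo cSr cSl) [LHS]E.
under eq_bigr => i _ do under eq_bigr => j _ do
  rewrite -(dmx_entry Dx v i j ivs) (dmx_invmx v Dx).
have gC a b : inner (g x) a b = inner (g x) b a.
  by apply: innerC; case: gD => _ _ + _; apply.
have [_ Einv] := frame_mx_inv eo.
(* The derivative of the metric in the frame, from which minus the derivative of the inverse metric
   is rebuilt by writing each inverse as a product of frame matrices. *)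
pose K k l := inner (dmx g v x) (e k) (e l).
have EK : invmx (g x) *m dmx g v x *m invmx (g x) =
    \matrix_(i, j) \sum_k \sum_l K k l * (e k ord0 i * e l ord0 j).
  have E1 : frame_mx e *m dmx g v x *m (frame_mx e)^T = \matrix_(k, l) K k l.
    apply/matrixP => k l; rewrite [RHS]mxE /K /inner.
    have -> : e k = row k (frame_mx e) by rewrite rowK.
    have -> : e l = row l (frame_mx e) by rewrite rowK.
    by rewrite -row_mul !mxE; apply: eq_bigr => i _; rewrite !mxE.
  rewrite Einv !mulmxA -(mulmxA _ (dmx g v x)) -(mulmxA _ (_ *m _)) -(mulmxA (frame_mx e)^T).
  rewrite !mulmxA -(mulmxA _ (frame_mx e)) -(mulmxA _ (_ *m _) (_^T)) E1.
  apply/matrixP => i j; rewrite [RHS]mxE mxE.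
  under eq_bigr => l _ do rewrite mxE mulr_suml.
  rewrite exchange_big; apply: eq_bigr => k _; apply: eq_bigr => l _.
  by rewrite !mxE; ring.
rewrite EK.
have bil a b : sff g H psi x a b = \sum_i \sum_j (a ord0 i * b ord0 j) *: S i j x.
  rewrite {1}(row_sum_delta a) (linear_fun_sum (sff_linearl b Dx)).
  apply: eq_bigr => i _; rewrite (linear_funZ (sff_linearl b Dx)) {1}(row_sum_delta b).
  rewrite (linear_fun_sum (sff_linearr _ Dx)) scaler_sumr.
  by apply: eq_bigr => j _; rewrite (linear_funZ (sff_linearr _ Dx)) scalerA.
transitivity (\sum_k \sum_l K k l *: sff g H psi x (e k) (e l)).
  pose T (i j k l : 'I_m) := (K k l * (e k ord0 i * e l ord0 j)) *: S i j x.
  transitivity (\sum_i \sum_j \sum_k \sum_l T i j k l).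
    rewrite -sumrN; apply: eq_bigr => i _; rewrite -sumrN; apply: eq_bigr => j _.
    rewrite mxE scaleNr opprK mxE scaler_suml; apply: eq_bigr => k _.
    by rewrite scaler_suml.
  transitivity (\sum_k \sum_l \sum_i \sum_j T i j k l).
    under eq_bigr => i _ do rewrite exchange_big /=.
    rewrite exchange_big /=; apply: eq_bigr => k _.
    under eq_bigr => i _ do rewrite exchange_big /=.
    by rewrite exchange_big.
  apply: eq_bigr => k _; apply: eq_bigr => l _; rewrite bil scaler_sumr.
  by apply: eq_bigr => i _; rewrite scaler_sumr; apply: eq_bigr => j _; rewrite scalerA.
have -> : \sum_k \sum_l K k l *: sff g H psi x (e k) (e l) =
    \sum_k (\sum_l inner (g x) (gamma g x v (e k)) (e l) *: sff g H psi x (e k) (e l)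
     + \sum_l inner (g x) (e k) (gamma g x v (e l)) *: sff g H psi x (e k) (e l)).
  apply: eq_bigr => k _; rewrite -big_split; apply: eq_bigr => l _ /=.
  by rewrite /K (gamma_compat gD _ _ _ Dx) scalerDl.
rewrite big_split /= scaler_nat mulr2n; congr (_ + _).
  apply: eq_bigr => k _; rewrite [in RHS](frame_expansion eo (gamma g x v (e k))).
  rewrite (linear_fun_sum (sff_linearr _ Dx)); apply: eq_bigr => l _.
  by rewrite (linear_funZ (sff_linearr _ Dx)).
rewrite exchange_big; apply: eq_bigr => k _.
rewrite [in RHS](frame_expansion eo (gamma g x v (e k))).
rewrite (linear_fun_sum (sff_linearr _ Dx)); apply: eq_bigr => l _.
by rewrite (linear_funZ (sff_linearr _ Dx)) gC (sffC (e l) _ Dx).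
Qed.

End at_frame.
End second_fundamental_form.

(** * The maximum principle for the least eigenvalue of s *)

Section bochner.
Context {R : realType} {m n : nat}.
Variables (U : set 'rV[R]_n) (H : 'rV[R]_n -> 'M[R]_n).
Hypothesis HU : metric_on U H.
Variables (D : set 'rV[R]_m) (g : 'rV[R]_m -> 'M[R]_m) (psi : 'rV[R]_m -> 'rV[R]_n).
Hypotheses (gD : metric_on D g) (psis : msmooth D psi).
Hypothesis (psiU : forall y, D y -> U (psi y)).

Definition pull (a b y : 'rV[R]_m) : R := inner (H (psi y)) (dmx psi a y) (dmx psi b y).

Let oD : open D. Proof. by case: gD. Qed.
Let ps v : msmooth D (dmx psi v). Proof. exact: msmooth_dmx. Qed.
Let Hsym y a b : D y -> inner (H (psi y)) a b = inner (H (psi y)) b a.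
Proof. by move=> Dy; apply: innerC; case: HU => _ _ + _; apply; exact: psiU. Qed.

Lemma smooth_pull a b : smooth D (pull a b).
Proof. exact: (smooth_inner oD (msmooth_metric_along HU oD psis psiU)). Qed.

Lemma dscal_pull a b u y : D y -> dscal (pull a b) u y =
  inner (H (psi y)) (cov H psi (dmx psi a) u y) (dmx psi b y)
  + inner (H (psi y)) (dmx psi a y) (cov H psi (dmx psi b) u y).
Proof. by move=> Dy; exact: (cov_compat HU oD psis psiU u Dy (ps a) (ps b)). Qed.

Lemma dscal2_pull v u y : D y -> dscal (dscal (pull v v) u) u y =
  2 * inner (H (psi y)) (cov H psi (cov H psi (dmx psi v) u) u y) (dmx psi v y)
  + 2 * inner (H (psi y)) (cov H psi (dmx psi v) u y) (cov H psi (dmx psi v) u y).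
Proof.
move=> Dy; have cs := msmooth_cov HU oD psis psiU u (ps v).
have Hs := msmooth_metric_along HU oD psis psiU.
have E z : D z -> dscal (pull v v) u z =
    inner (H (psi z)) (cov H psi (dmx psi v) u z) (dmx psi v z)
    + inner (H (psi z)) (cov H psi (dmx psi v) u z) (dmx psi v z).
  by move=> Dz; rewrite dscal_pull // [X in _ + X]Hsym.
rewrite (eq_dscal oD Dy u E) (dscalD Dy).
- rewrite (cov_compat HU oD psis psiU u Dy cs (ps v)); ring.
- exact: (smooth_inner oD Hs cs (ps v)).
- exact: (smooth_inner oD Hs cs (ps v)).
Qed.

Section at_frame.
Variables (x v : 'rV[R]_m) (e : 'I_m -> 'rV[R]_m).
Hypotheses (Dx : D x) (eo : orthonormal_frame (g x) e).
Hypothesis harm : harmonic H D g psi.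

Local Notation l k := (- gamma g x (e k) v).
Local Notation "<< a , b >>" := (inner (H (psi x)) a b).
Let c := \sum_k gamma g x (e k) (e k).

(** Gathers the terms without a sign. It depends on [g], [v] and the frame but not on [psi], so id
    and f share it, and pairing it with the null vector [v] makes it disappear from the weighted
    difference. *)
Definition bochner_remainder : 'rV[R]_m :=
  \sum_k (dmx (fun y => gamma g y (e k) (e k)) v x + 2 *: gamma g x (e k) (l k)).

(** The left-hand side is the second derivative at [x] along [e k] of the squared length of the
    image of [v + tau *: l k], with [tau] affine, zero at [x] and of slope 1 along [e k]. On the
    right the third derivative of [psi] is traded for curvature and a derivative of [sff] along
    [v]. *)
Lemma bochner_term k :
  dscal (dscal (pull v v) (e k)) (e k) x + 4 * dscal (pull v (l k)) (e k) x
    + 2 * pull (l k) (l k) x =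
  2 * << sff g H psi x (e k) v, sff g H psi x (e k) v >>
  + 2 * << riemann H (psi x) (dmx psi (e k) x) (dmx psi v x) (dmx psi (e k) x), dmx psi v x >>
  + 2 * << cov H psi (fun y => sff g H psi y (e k) (e k)) v x, dmx psi v x >>
  + 2 * << dmx psi (dmx (fun y => gamma g y (e k) (e k)) v x) x, dmx psi v x >>
  + 2 * << cov H psi (dmx psi v) (gamma g x (e k) (e k)) x, dmx psi v x >>
  + 4 * << sff g H psi x (e k) (l k), dmx psi v x >>
  + 4 * << dmx psi (gamma g x (e k) (l k)) x, dmx psi v x >>.
Proof.
rewrite dscal2_pull // dscal_pull //.
have -> : cov H psi (cov H psi (dmx psi v) (e k)) (e k) x =
    cov H psi (cov H psi (dmx psi (e k)) (e k)) v x
    + riemann H (psi x) (dmx psi (e k) x) (dmx psi v x) (dmx psi (e k) x).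
  rewrite -(cov_comm HU oD psis psiU _ _ Dx (ps (e k))) addrC subrK.
  by apply: (eq_cov H psi oD _ Dx) => y Dy; exact: (cov_sym HU oD psis psiU).
have -> : cov H psi (cov H psi (dmx psi (e k)) (e k)) v x =
    cov H psi (fun y => sff g H psi y (e k) (e k)) v x
    + (dmx psi (dmx (fun y => gamma g y (e k) (e k)) v x) x
       + cov H psi (dmx psi v) (gamma g x (e k) (e k)) x).
  rewrite (cov_sff HU gD psis psiU _ _ _ Dx) (cov_sym HU oD psis psiU v _ Dx).
  by rewrite subrK.
have -> : cov H psi (dmx psi (l k)) (e k) x =
    sff g H psi x (e k) (l k) + dmx psi (gamma g x (e k) (l k)) x.
  by rewrite (sffE _ _ _ _ _ Dx) subrK.
have -> : cov H psi (dmx psi v) (e k) x =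
    sff g H psi x (e k) v - dmx psi (l k) x.
  by rewrite (sffE _ _ _ _ _ Dx) (linear_funN (dmx_linear Dx psis)) opprK subrK.
rewrite /pull !innerDl !innerDr !innerNl !innerNr.
set L := dmx psi (l k) x; set S := sff g H psi x (e k) v; set V := dmx psi v x.
rewrite (Hsym V (sff _ _ _ _ _ _) Dx) (Hsym V (dmx _ _ _) Dx) (Hsym L S Dx); ring.
Qed.

(** By [harmonic_derivative] the trace of the derivative of [sff] cancels against the cross terms in
    [l k], which is minus [gamma g x (e k) v]. The first order part of the Laplacian absorbs the
    derivative along [c]. *)
Lemma bochner_sum :
  \sum_k (dscal (dscal (pull v v) (e k)) (e k) x + 4 * dscal (pull v (l k)) (e k) x
    + 2 * pull (l k) (l k) x) - dscal (pull v v) c x =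
  2 * \sum_k << sff g H psi x (e k) v, sff g H psi x (e k) v >>
  + 2 * \sum_k << riemann H (psi x) (dmx psi (e k) x) (dmx psi v x) (dmx psi (e k) x),
                  dmx psi v x >>
  + 2 * << dmx psi bochner_remainder x, dmx psi v x >>.
Proof.
under eq_bigr => k _ do rewrite bochner_term.
rewrite !big_split /= -!mulr_sumr -!inner_suml.
rewrite (harmonic_derivative HU gD psis psiU harm v Dx eo).
have -> : \sum_k sff g H psi x (e k) (l k) = - \sum_k sff g H psi x (e k) (gamma g x v (e k)).
  rewrite -sumrN; apply: eq_bigr => k _.
  by rewrite (linear_funN (sff_linearr HU gD psis psiU _ Dx)) (gammaC gD _ _ Dx).
rewrite -(linear_fun_sum (cov_linear HU psis psiU Dx (ps v))) -/c.
rewrite -!(linear_fun_sum (dmx_linear Dx psis)).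
rewrite dscal_pull // (Hsym (dmx psi v x) _ Dx) /bochner_remainder big_split /=.
rewrite -scaler_sumr (linear_funD (dmx_linear Dx psis)) (linear_funZ (dmx_linear Dx psis)).
rewrite innerDl !innerZl innerNl; ring.
Qed.

End at_frame.
End bochner.

(** * First and second order conditions at an interior minimum *)

Section second_order_conditions.
Context {R : realType} {m : nat}.
Variable D : set 'rV[R]_m.
Hypothesis oD : open D.
Implicit Types (f : 'rV[R]_m -> R) (x u : 'rV[R]_m).

Lemma line_near x u : D x ->
  exists2 d : R, 0 < d & forall t : R, `|t| < d -> D (t *: u + x).
Proof.
move=> Dx; have := open_near oD Dx (fun y Dy => Dy).
rewrite (near_shift 0) /= subr0 => /nbhs_norm0P[d d0 dP].
exists (d / (`|u| + 1)); first by rewrite divr_gt0 // ltr_wpDl.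
move=> t td; apply: dP => /=; rewrite normrZ.
apply: (@le_lt_trans _ _ (`|t| * (`|u| + 1))).
  by apply: ler_wpM2l => //; rewrite lerDl.
by rewrite -ltr_pdivlMr // ltr_wpDl.
Qed.

Lemma dscal_is_derive f u x (t : R) : smooth D f -> D (t *: u + x) ->
  is_derive t 1 (fun s : R => f (s *: u + x)) (dscal f u (t *: u + x)).
Proof.
move=> fs Dt; rewrite dscalE; apply: line_is_derive; apply: diff_derivable.
exact: smooth_diff fs Dt.
Qed.

Lemma first_order_min f u x : smooth D f -> D x ->
  (forall y, D y -> f x <= f y) -> dscal f u x = 0.
Proof.
move=> fs Dx fmin; have [d d0 dP] := line_near u Dx.
have inD t : t \in `]- d, d[%R -> D (t *: u + x).
  by rewrite in_itv /= => td; apply: dP; rewrite ltr_norml.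
have x0 : 0 *: u + x = x by rewrite scale0r add0r.
have c0 : (0 : R) \in `]- d, d[%R by rewrite in_itv /= oppr_lt0 d0.
have [||||_ E] := @derive1_at_min R (fun s : R => f (s *: u + x)) (- d) d 0.
- by rewrite -subr_ge0 opprK addr_ge0 // ltW.
- by move=> t /inD Dt; have [] := dscal_is_derive fs Dt.
- exact: c0.
- by move=> t /inD Dt; rewrite x0; exact: fmin.
have Dx0 : D (0 *: u + x) by rewrite x0.
by have [_] := dscal_is_derive fs Dx0; rewrite E x0.
Qed.

(** A negative second derivative at [x] would persist nearby. Two applications of the mean value
    theorem, the second to a first derivative that vanishes at [x], would then produce a value below
    [f x]. *)
Lemma second_order_min f u x : smooth D f -> D x ->
  (forall y, D y -> f x <= f y) -> 0 <= dscal (dscal f u) u x.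
Proof.
move=> fs Dx fmin; have f1 := first_order_min u fs Dx fmin.
rewrite leNgt; apply/negP => neg.
have f2s := smooth_dscal u (smooth_dscal u fs).
have [d d0 dP] : exists2 d : R, 0 < d & forall t : R, `|t| < d ->
    D (t *: u + x) /\ dscal (dscal f u) u (t *: u + x) < 0.
  have [d d0 dP] := line_near u Dx.
  pose F (t : R) := dscal (dscal f u) u (t *: u + x).
  have cF : {for (0 : R), continuous F}.
    apply: differentiable_continuous; apply/derivable1_diffP.
    have D0 : D (0 *: u + x) by rewrite scale0r add0r.
    by have [] := dscal_is_derive f2s D0.
  have F0 : F 0 < 0 by rewrite /F scale0r add0r.
  have nF : \forall t \near (0 : R), F t < 0 by exact: (cvgr_lt _ cF _ F0).
  have [d' d'0 d'P] := nbhs_norm0P.1 nF.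
  exists (Num.min d d') => [|t]; first by rewrite lt_min d0.
  by rewrite lt_min => /andP[td td']; split; [exact: dP|exact: d'P].
have x0 : 0 *: u + x = x by rewrite scale0r add0r.
have mvt (h : 'rV[R]_m -> R) t : smooth D h -> 0 < t -> t < d ->
    exists2 s : R, 0 < s < t & h (t *: u + x) - h x = dscal h u (s *: u + x) * t.
  move=> hs t0 td.
  have small s : 0 <= s -> s <= t -> D (s *: u + x).
    by move=> s0 st; have [|] := dP s; rewrite ?ger0_norm //; exact: le_lt_trans st td.
  have [||s] := @MVT R (fun s => h (s *: u + x)) (fun s => dscal h u (s *: u + x)) 0 t t0.
  - move=> s; rewrite in_itv /= => /andP[s0 st]; apply: dscal_is_derive => //.
    by apply: small; exact: ltW.
  - apply: continuous_in_subspaceT => s; rewrite inE /= in_itv /= => /andP[s0 st].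
    apply: differentiable_continuous; apply/derivable1_diffP.
    by have [] := dscal_is_derive hs (small s s0 st).
  by rewrite in_itv /= x0 subr0 => s0t E; exists s.
have d20 : 0 < d / 2 by rewrite divr_gt0.
have d2 : d / 2 < d by rewrite ltr_pdivrMr // ltr_pMr // ltr1n.
have [s /andP[s0 st] E] := mvt f _ fs d20 d2.
have [r /andP[r0 rs] E'] := mvt _ s (smooth_dscal u fs) s0 (lt_trans st d2).
move: E'; rewrite f1 subr0 => E'.
have [|Dr neg'] := dP r; first by rewrite gtr0_norm // (lt_trans rs) // (lt_trans st).
have [|Dd _] := dP (d / 2); first by rewrite gtr0_norm.
have := fmin _ Dd; rewrite -subr_ge0 E E' leNgt => /negP; apply.
by rewrite nmulr_rlt0 // nmulr_rlt0.
Qed.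

Lemma dscal2D f h u x : D x -> smooth D f -> smooth D h ->
  dscal (dscal (fun y => f y + h y) u) u x = dscal (dscal f u) u x + dscal (dscal h u) u x.
Proof.
move=> Dx fs hs.
rewrite (eq_dscal oD Dx u (fun y Dy => dscalD Dy u fs hs)).
by rewrite (dscalD Dx u (smooth_dscal u fs) (smooth_dscal u hs)).
Qed.

Lemma smoothM f h : smooth D f -> smooth D h -> smooth D (fun y => f y * h y).
Proof. by move=> fs hs k; exact: (CkM oD (fs k) (hs k)). Qed.

Lemma smoothD f h : smooth D f -> smooth D h -> smooth D (fun y => f y + h y).
Proof. by move=> fs hs k; exact: (CkD oD (fs k) (hs k)). Qed.

Lemma smooth_cst (a : R) : smooth D (fun=> a).
Proof. by move=> k; exact: (Ck_cst oD). Qed.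

Lemma dscal2M f h u x : D x -> smooth D f -> smooth D h ->
  dscal (dscal (fun y => f y * h y) u) u x = dscal (dscal f u) u x * h x
    + 2 * (dscal f u x * dscal h u x) + f x * dscal (dscal h u) u x.
Proof.
move=> Dx fs hs; have f's := smooth_dscal u fs; have h's := smooth_dscal u hs.
rewrite (eq_dscal oD Dx u (fun y Dy => dscalM Dy u fs hs)).
rewrite (dscalD Dx u (smoothM f's hs) (smoothM fs h's)).
rewrite (dscalM Dx u f's hs) (dscalM Dx u fs h's); ring.
Qed.

Lemma dscal_quadratic (p q r tau : 'rV[R]_m -> R) u x : D x ->
  smooth D p -> smooth D q -> smooth D r -> smooth D tau ->
  tau x = 0 -> (forall y, D y -> dscal tau u y = 1) ->
  let f y := p y + (2 * tau y * q y + tau y * tau y * r y) in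
  dscal f u x = dscal p u x + 2 * q x
  /\ dscal (dscal f u) u x = dscal (dscal p u) u x + 4 * dscal q u x + 2 * r x.
Proof.
move=> Dx psm qs rs ts tx t1 f.
have c2 := smooth_cst 2; have ts2 := smoothM c2 ts; have tts := smoothM ts ts.
have ds2 y : D y -> dscal (fun y => 2 * tau y) u y = 2.
  by move=> Dy; rewrite (dscalM Dy u c2 ts) dscal_cst t1 // mul0r add0r mulr1.
have dts2 y : D y -> dscal (fun y => tau y * tau y) u y = 2 * tau y.
  by move=> Dy; rewrite (dscalM Dy u ts ts) t1 // mul1r mulr1 mulr_natl mulr2n.
have A := smoothM ts2 qs; have B := smoothM tts rs.
rewrite /f (dscalD Dx u psm (smoothD A B)) (dscalD Dx u A B).
rewrite (dscalM Dx u ts2 qs) (dscalM Dx u tts rs) ds2 // dts2 // tx.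
rewrite (dscal2D _ Dx psm (smoothD A B)) (dscal2D _ Dx A B).
rewrite (dscal2M _ Dx ts2 qs) (dscal2M _ Dx tts rs) ds2 // dts2 //.
rewrite (eq_dscal oD Dx u ds2) dscal_cst (eq_dscal oD Dx u dts2) ds2 // tx.
by split; ring.
Qed.

Lemma shifted_coordinate (A : 'M[R]_m) x w :
  let tau y := inner A (y + - x) w in
  [/\ smooth D tau, tau x = 0 & forall u y, D y -> dscal tau u y = inner A u w].
Proof.
move=> tau; have ids := msmoothD oD (@msmooth_id R m D oD) (@msmooth_cst R m D oD 1 m (- x)).
have As := @msmooth_cst R m D oD m m A; have ws := @msmooth_cst R m D oD 1 m w.
split; first exact: (smooth_inner oD As ids ws).
  by rewrite /tau subrr inner0l.
move=> u y Dy; rewrite (dscal_inner oD Dy u As ids ws) !dmx_cst inner0r.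
rewrite (dmxD Dy u (@msmooth_id R m D oD) (@msmooth_cst R m D oD 1 m (- x))).
by rewrite dmx_id dmx_cst !addr0 {1}/inner mulmx0 mul0mx mxE add0r.
Qed.

End second_order_conditions.

Section semidefinite_forms.
Context {R : realType} {m : nat}.
Implicit Types (T : 'M[R]_m) (v w : 'rV[R]_m).

Lemma semidefinite_null T v w : symmetric_matrix T ->
  (forall w, 0 <= inner T w w) -> inner T v v = 0 -> inner T w v = 0.
Proof.
move=> sT T0 Tv; apply/eqP; apply: contraT => wv0.
pose b := inner T w v; pose a := inner T w w.
have H t : 0 <= a + 2 * t * b.
  have := T0 (w + t *: v).
  rewrite !innerDl !innerDr !innerZl !innerZr Tv (innerC v w sT) -/a -/b.
  by move=> h; lra.
(* At this point the affine function bounded below by 0 in [H] takes the value -1. *)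
have := H (- (a + 1) / (2 * b)).
have -> : a + 2 * (- (a + 1) / (2 * b)) * b = -1 by field.
by rewrite lerNr oppr0 ler10.
Qed.

Lemma cauchy_schwarz T v w : symmetric_matrix T -> positive_definite T ->
  inner T v w ^+ 2 <= inner T v v * inner T w w.
Proof.
move=> sT Tp; have [->|w0] := eqVneq w 0; first by rewrite !inner0r expr0n mulr0.
have ww := Tp _ w0; set t := inner T v w / inner T w w.
have := positive_definite_ge0 (v - t *: w) Tp.
rewrite !innerBl !innerBr !innerZl !innerZr (innerC w v sT).
have -> : inner T v v - t * inner T v w - (t * inner T v w - t * (t * inner T w w)) =
    inner T v v - inner T v w ^+ 2 / inner T w w by rewrite /t; field; rewrite gt_eqF.
by rewrite subr_ge0 ler_pdivrMr.
Qed.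

End semidefinite_forms.

Section maximum_principle.
Context {R : realType} {m n : nat}.
Variables (D : set 'rV[R]_m) (U : set 'rV[R]_n).
Variables (G g : 'rV[R]_m -> 'M[R]_m) (H : 'rV[R]_n -> 'M[R]_n).
Variable phi : 'rV[R]_m -> 'rV[R]_n.
Hypotheses (GD : metric_on D G) (gD : metric_on D g) (HU : metric_on U H).
Hypotheses (phis : msmooth D phi) (phiU : forall y, D y -> U (phi y)).
Hypothesis gE : forall y, D y -> forall a b,
  inner (g y) a b = inner (G y) a b + pull H phi a b y.
Hypotheses (harm1 : harmonic G D g id) (harm2 : harmonic H D g phi).

Let oD : open D. Proof. by case: gD. Qed.
Let ids : msmooth D (@id 'rV[R]_m). Proof. exact: msmooth_id. Qed.
Let idD y : D y -> D (id y). Proof. by []. Qed.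
Let gsym y a b : D y -> inner (g y) a b = inner (g y) b a.
Proof. by move=> Dy; apply: innerC; case: gD => _ _ + _; apply. Qed.
Let Gsym y a b : D y -> inner (G y) a b = inner (G y) b a.
Proof. by move=> Dy; apply: innerC; case: GD => _ _ + _; apply. Qed.
Let Hsym y a b : D y -> inner (H (phi y)) a b = inner (H (phi y)) b a.
Proof. by move=> Dy; apply: innerC; case: HU => _ _ + _; apply; exact: phiU. Qed.

Lemma pull_id a b y : pull G id a b y = inner (G y) a b.
Proof. by rewrite /pull !dmx_id. Qed.

Lemma pullC a b y : D y -> pull H phi a b y = pull H phi b a y.
Proof. by move=> Dy; exact: Hsym. Qed.

Lemma pullPl k a a' b y : D y ->
  pull H phi (k *: a + a') b y = k * pull H phi a b y + pull H phi a' b y.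
Proof. by move=> Dy; rewrite /pull (dmx_dirP Dy _ _ _ phis) innerDl innerZl. Qed.

(** Both factors of the graph obey [cov_koszul], and the sum of the two right-hand sides is the
    Koszul formula of [g], because [g] is the sum of the two pulled-back forms. *)
Lemma graph_normal u v w x : D x ->
  inner (G x) (sff g G id x u v) w + inner (H (phi x)) (sff g H phi x u v) (dmx phi w x) = 0.
Proof.
move=> Dx; have k1 := cov_koszul GD oD ids idD u v w Dx.
have k2 := cov_koszul HU oD phis phiU u v w Dx.
rewrite !(sffE _ _ _ _ _ Dx) !innerBl dmx_id.
move: k1 k2; rewrite /= {1}dmx_id => -> ->.
have sp1 := smooth_pull GD gD ids idD; have sp2 := smooth_pull HU gD phis phiU.
have E a b d : inner (dmx g d x) a b = dscal (pull G id a b) d x + dscal (pull H phi a b) d x.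
  rewrite -(dscal_metric gD _ _ _ Dx) -(dscalD Dx d (sp1 a b) (sp2 a b)).
  by apply: (eq_dscal oD Dx) => y Dy; rewrite gE // pull_id.
have := gamma_inner gD u v w Dx; rewrite gE // /koszul !E /pull => K.
rewrite -/(pull H phi (gamma g x u v) w x).
move: K; rewrite -/(pull H phi (gamma g x u v) w x) => K; lra.
Qed.

Section at_minimum.
Variables (c : 'rV[R]_m -> R) (x v : 'rV[R]_m).
Hypotheses (cs : smooth D c) (Dx : D x).

(** With s = G - P and g = G + P, where P is the form pulled back by [phi], this is s - c g. *)
Definition weighted_form a b y : R :=
  (1 - c y) * pull G id a b y - (1 + c y) * pull H phi a b y.

Hypothesis form_ge0 : forall y w, D y -> 0 <= weighted_form w w y.
Hypotheses (null : weighted_form v v x = 0) (unit_v : inner (g x) v v = 1).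

Let sp1 a b : smooth D (pull G id a b). Proof. exact: (smooth_pull GD gD ids idD). Qed.
Let sp2 a b : smooth D (pull H phi a b). Proof. exact: (smooth_pull HU gD phis phiU). Qed.
Let as1 : smooth D (fun y => 1 + - c y).
Proof.
apply: (smoothD oD); first exact: smooth_cst.
by move=> k; exact: (CkN oD (cs k)).
Qed.
Let as2 : smooth D (fun y => - (1 + c y)).
Proof. by move=> k; apply: (CkN oD); exact: (smoothD oD (smooth_cst oD 1) cs). Qed.

(** A null vector of a semidefinite form lies in its kernel. *)
Lemma null_vector w : (1 - c x) * inner (G x) w v = (1 + c x) * pull H phi w v x.
Proof.
pose T := (1 - c x) *: G x - (1 + c x) *: (g x - G x).
have TE a b : inner T a b = weighted_form a b x.
  rewrite /T /weighted_form !innerBm !innerZm innerBm gE // pull_id; ring.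
have sT : symmetric_matrix T.
  rewrite /symmetric_matrix /T linearB !linearZ /= linearB /=.
  by case: GD => _ _ -> // _; case: gD => _ _ -> // _.
have : inner T w v = 0.
  apply: semidefinite_null; rewrite ?TE //.
  by move=> a; rewrite TE; exact: form_ge0.
by rewrite TE /weighted_form pull_id => /eqP; rewrite subr_eq0 => /eqP.
Qed.

Section at_frame.
Variable e : 'I_m -> 'rV[R]_m.
Hypothesis eo : orthonormal_frame (g x) e.

(** The Laplace-Beltrami operator of [g] at [x]: the frame is constant in coordinates, so the trace
    of the Hessian needs the Christoffel correction. *)
Definition laplacian_at (f : 'rV[R]_m -> R) : R :=
  \sum_k dscal (dscal f (e k)) (e k) x - dscal f (\sum_k gamma g x (e k) (e k)) x.

Local Notation B1 k := (sff g G id x (e k) v).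
Local Notation B2 k := (sff g H phi x (e k) v).
Local Notation R1 k := (inner (G x) (riemann G x (e k) v (e k)) v).
Local Notation R2 k := (inner (H (phi x)) (riemann H (phi x) (dmx phi (e k) x)
  (dmx phi v x) (dmx phi (e k) x)) (dmx phi v x)).

Lemma dscal_opp (f : 'rV[R]_m -> R) u y : D y -> smooth D f ->
  dscal (fun z => - f z) u y = - dscal f u y.
Proof.
move=> Dy fs; rewrite dscalE dscalE; apply: deriveN; apply: diff_derivable.
exact: smooth_diff fs Dy.
Qed.

Lemma dscal_N1c u y : D y -> dscal (fun y => - (1 + c y)) u y = - dscal c u y.
Proof.
move=> Dy; have s1 := smooth_cst oD (1 : R); rewrite (dscal_opp u Dy (smoothD oD s1 cs)).
by rewrite (dscalD Dy u s1 cs) dscal_cst add0r.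
Qed.

Lemma dscal_1Nc u y : D y -> dscal (fun y => 1 + - c y) u y = - dscal c u y.
Proof.
move=> Dy; have Ns : smooth D (fun y => - c y) by move=> k; exact: (CkN oD (cs k)).
by rewrite (dscalD Dy u (smooth_cst oD 1) Ns) dscal_cst add0r dscal_opp.
Qed.

Lemma dscal_pull_sum u :
  dscal (pull G id v v) u x + dscal (pull H phi v v) u x =
  2 * inner (g x) (gamma g x u v) v.
Proof.
rewrite -(dscalD Dx u (sp1 v v) (sp2 v v)).
have -> : dscal (fun y => pull G id v v y + pull H phi v v y) u x =
    dscal (fun y => inner (g y) v v) u x.
  by apply: (eq_dscal oD Dx) => y Dy; rewrite gE // pull_id.
rewrite (dscal_metric gD _ _ _ Dx) (gamma_compat gD _ _ _ Dx) (gsym v _ Dx); ring.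
Qed.

(* The second order condition at x for the field v - tau Gamma(e_k, v), which is
   g-parallel at x in the direction e_k when tau is a coordinate along e_k
   vanishing at x. *)
Lemma minimum_term k :
  0 <= (1 - c x) * (dscal (dscal (pull G id v v) (e k)) (e k) x
           + 4 * dscal (pull G id v (- gamma g x (e k) v)) (e k) x
           + 2 * pull G id (- gamma g x (e k) v) (- gamma g x (e k) v) x)
     - (1 + c x) * (dscal (dscal (pull H phi v v) (e k)) (e k) x
           + 4 * dscal (pull H phi v (- gamma g x (e k) v)) (e k) x
           + 2 * pull H phi (- gamma g x (e k) v) (- gamma g x (e k) v) x)
     - dscal (dscal c (e k)) (e k) x.
Proof.
set l := - gamma g x (e k) v.
have [tau [taus tau0 tau1]] : exists tau : 'rV[R]_m -> R,
    [/\ smooth D tau, tau x = 0 & forall y, D y -> dscal tau (e k) y = 1].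
  have [s0 s1 s2] := shifted_coordinate oD (g x) x (e k).
  exists (fun y => inner (g x) (y + - x) (e k)); split=> // y Dy.
  by rewrite s2 // eo eqxx.
pose Q (P : 'rV[R]_m -> 'rV[R]_m -> 'rV[R]_m -> R) y :=
  P v v y + (2 * tau y * P v l y + tau y * tau y * P l l y).
have Qs P : (forall a b, smooth D (P a b)) -> smooth D (Q P).
  move=> Ps; have s2 := smooth_cst oD (2 : R).
  apply: (smoothD oD (Ps v v)); apply: (smoothD oD).
    by apply: (smoothM oD) => //; exact: smoothM.
  by apply: (smoothM oD) => //; exact: smoothM.
pose F y := (1 + - c y) * Q (pull G id) y + (- (1 + c y)) * Q (pull H phi) y.
have FE y : D y -> F y = weighted_form (v + tau y *: l) (v + tau y *: l) y.
  move=> Dy; rewrite /F /Q /weighted_form.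
  have -> : pull H phi (v + tau y *: l) (v + tau y *: l) y =
      pull H phi v v y + 2 * tau y * pull H phi v l y + tau y * tau y * pull H phi l l y.
    rewrite [v + _]addrC pullPl // (pullC l) // (pullC v) // !pullPl // (pullC l v) //; ring.
  rewrite !pull_id !innerDl !innerDr !innerZl !innerZr (Gsym v l Dy); ring.
have Fs : smooth D F.
  by apply: (smoothD oD); apply: (smoothM oD) => //; exact: Qs.
have F0 : F x = 0 by rewrite FE // tau0 scale0r addr0.
have Fge y : D y -> F x <= F y.
  by move=> Dy; rewrite F0 FE //; exact: form_ge0.
have := second_order_min oD (e k) Fs Dx Fge.
have [Q1a Q1b] := dscal_quadratic oD Dx (sp1 v v) (sp1 v l) (sp1 l l) taus tau0 tau1.
have [Q2a Q2b] := dscal_quadratic oD Dx (sp2 v v) (sp2 v l) (sp2 l l) taus tau0 tau1.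
have A1 := smoothM oD as1 (Qs _ sp1); have A2 := smoothM oD as2 (Qs _ sp2).
rewrite /F (dscal2D oD _ Dx A1 A2).
rewrite (dscal2M oD _ Dx as1 (Qs _ sp1)) (dscal2M oD _ Dx as2 (Qs _ sp2)).
rewrite -/(Q (pull G id)) -/(Q (pull H phi)) in Q1a Q1b Q2a Q2b.
rewrite Q1a Q1b Q2a Q2b.
have c1 y : D y -> dscal (fun y => 1 + - c y) (e k) y = - dscal c (e k) y.
  exact: dscal_1Nc.
have c2 y : D y -> dscal (fun y => - (1 + c y)) (e k) y = - dscal c (e k) y.
  exact: dscal_N1c.
rewrite (eq_dscal oD Dx (e k) c1) (eq_dscal oD Dx (e k) c2) (c1 _ Dx) (c2 _ Dx).
rewrite (dscal_opp _ Dx (smooth_dscal (e k) cs)).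
have QQ : Q (pull G id) x + Q (pull H phi) x = 1.
  by rewrite /Q tau0 -unit_v gE // pull_id; ring.
have Z : dscal (pull G id v v) (e k) x + 2 * pull G id v l x
    + (dscal (pull H phi v v) (e k) x + 2 * pull H phi v l x) = 0.
  have gl := gE Dx v l; have := dscal_pull_sum (e k).
  rewrite pull_id; move: gl; rewrite /l innerNr (gsym v _ Dx) => gl; lra.
move: QQ Z.
set q1 := Q _ x; set q2 := Q _ x.
set z1 := dscal (pull G id v v) (e k) x + _; set z2 := dscal (pull H phi v v) (e k) x + _.
set w1 := _ + 2 * pull G id l l x; set w2 := _ + 2 * pull H phi l l x.
set c' := dscal c (e k) x; set c'' := dscal (dscal c _) _ _.
move=> QQ Z h.
have E : - c'' * q1 + 2 * (- c' * z1) + (1 + - c x) * w1 +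
    (- c'' * q2 + 2 * (- c' * z2) + - (1 + c x) * w2) =
    (1 - c x) * w1 - (1 + c x) * w2 - c'' * (q1 + q2) - 2 * c' * (z1 + z2) by ring.
by move: h; rewrite E QQ Z mulr1 mulr0 subr0.
Qed.

(** The inequalities [minimum_term] are summed over the frame and the Bochner sums of both maps
    inserted; [null_vector] removes their common remainder. *)
Lemma laplacian_le : laplacian_at c <=
  2 * ((1 - c x) * \sum_k inner (G x) (B1 k) (B1 k)
       - (1 + c x) * \sum_k inner (H (phi x)) (B2 k) (B2 k))
  + 2 * ((1 - c x) * \sum_k R1 k - (1 + c x) * \sum_k R2 k).
Proof.
have S : 0 <= \sum_k ((1 - c x) * (dscal (dscal (pull G id v v) (e k)) (e k) x
           + 4 * dscal (pull G id v (- gamma g x (e k) v)) (e k) x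
           + 2 * pull G id (- gamma g x (e k) v) (- gamma g x (e k) v) x)
     - (1 + c x) * (dscal (dscal (pull H phi v v) (e k)) (e k) x
           + 4 * dscal (pull H phi v (- gamma g x (e k) v)) (e k) x
           + 2 * pull H phi (- gamma g x (e k) v) (- gamma g x (e k) v) x)
     - dscal (dscal c (e k)) (e k) x).
  by apply: sumr_ge0 => k _; exact: minimum_term.
move: S; rewrite sumrB sumrB -!mulr_sumr.
have b1 := bochner_sum GD gD ids idD v Dx eo harm1.
have b2 := bochner_sum HU gD phis phiU v Dx eo harm2.
set w := \sum_k gamma g x (e k) (e k) in b1 b2 *.
set r := bochner_remainder g x v e in b1 b2.
move/eqP: b1; rewrite subr_eq => /eqP ->; move/eqP: b2; rewrite subr_eq => /eqP ->.
have -> : \sum_k inner (G x) (riemann G x (dmx id (e k) x) (dmx id v x) (dmx id (e k) x))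
    (dmx id v x) = \sum_k R1 k.
  by apply: eq_bigr => k _; rewrite !dmx_id.
rewrite (dmx_id x r) (dmx_id x v) -/w.
(* The form evaluated on the constant field [v] is minimal at [x], so its derivative vanishes. The
   derivative of [c] enters with the coefficient [inner (g x) v v], which is 1, and completes the
   Laplacian. *)
have first : (1 - c x) * dscal (pull G id v v) w x - (1 + c x) * dscal (pull H phi v v) w x
    = dscal c w x.
  have A1 := smoothM oD as1 (sp1 v v); have A2 := smoothM oD as2 (sp2 v v).
  have := @first_order_min _ _ _ oD (fun y => (1 + - c y) * pull G id v v y
     + - (1 + c y) * pull H phi v v y) w x (smoothD oD A1 A2) Dx.
  rewrite (dscalD Dx w A1 A2) (dscalM Dx w as1 (sp1 v v)) (dscalM Dx w as2 (sp2 v v)).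
  rewrite dscal_1Nc // dscal_N1c // => E.
  have Wy y : D y -> (1 + - c y) * pull G id v v y + - (1 + c y) * pull H phi v v y =
      weighted_form v v y by move=> _; rewrite /weighted_form mulNr.
  have {}E : - dscal c w x * pull G id v v x + (1 + - c x) * dscal (pull G id v v) w x
      + (- dscal c w x * pull H phi v v x + - (1 + c x) * dscal (pull H phi v v) w x) = 0.
    by apply: E => y Dy; rewrite (Wy _ Dx) (Wy _ Dy) null; exact: form_ge0.
  have := unit_v; rewrite gE // -pull_id => gvv.
  have -> : dscal c w x = dscal c w x * (pull G id v v x + pull H phi v v x).
    by rewrite gvv mulr1.
  by apply/eqP; rewrite -subr_eq0 -E; apply/eqP; ring.
have nr := null_vector r; rewrite /pull in nr.
rewrite /laplacian_at -/w -first; move: nr.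
set N1 := inner (G x) r v; set N2 := inner (H (phi x)) (dmx phi r x) (dmx phi v x) => nr.
set s1 := \sum_k inner (G x) _ _; set s2 := \sum_k R1 k.
set t1 := \sum_k inner (H (phi x)) (B2 k) _; set t2 := \sum_k R2 k.
set d1 := dscal (pull G id v v) w x; set d2 := dscal (pull H phi v v) w x.
set cc := \sum_k dscal (dscal c _) _ _ => h.
rewrite -subr_ge0; apply: le_trans h _.
rewrite -subr_ge0 le_eqVlt; apply/orP; left; apply/eqP.
transitivity (- 2 * ((1 - c x) * N1 - (1 + c x) * N2)); last by ring.
by rewrite nr subrr mulr0.
Qed.

(* (B1, B2) is normal to the graph, so Cauchy-Schwarz bounds |B1|^2 by |B2| |dphi B1|. *)
Lemma tension_norm_le k :
  (1 - c x) * inner (G x) (B1 k) (B1 k) - (1 + c x) * inner (H (phi x)) (B2 k) (B2 k) <=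
  - 2 * c x * (inner (G x) (B1 k) (B1 k) + inner (H (phi x)) (B2 k) (B2 k)).
Proof.
set b := B1 k; set b' := B2 k; set a := inner (G x) b b; set a' := inner (H (phi x)) b' b'.
have Hp : positive_definite (H (phi x)) by case: HU => _ _ _; apply; exact: phiU.
have Hs : symmetric_matrix (H (phi x)) by case: HU => _ _ + _; apply; exact: phiU.
have a'0 : 0 <= a' by exact: positive_definite_ge0.
have Gp : positive_definite (G x) by case: GD => _ _ _; apply.
have a0 : 0 <= a by exact: positive_definite_ge0.
have c1 : 0 <= 1 - c x /\ 0 <= 1 + c x.
  have := null_vector v; have := gE Dx v v; rewrite unit_v.
  have : 0 <= inner (G x) v v by exact: positive_definite_ge0.
  have : 0 <= pull H phi v v x by exact: positive_definite_ge0.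
  set p := inner _ _ _; set q := pull _ _ _ _ _ => q0 p0 pq E.
  have qE : q = 1 - p by lra.
  rewrite qE in E q0; have pE : p * 2 = 1 + c x by lra.
  by split; lra.
have [c1' c2'] := c1.
have main : (1 + c x) * a <= (1 - c x) * a'.
  have nrm := graph_normal (e k) v b Dx; rewrite -/b -/b' -/a in nrm.
  have cs2 := cauchy_schwarz b' (dmx phi b x) Hs Hp.
  have psd := form_ge0 b Dx; rewrite /weighted_form pull_id -/a in psd.
  have [a_eq0|a_neq0] := eqVneq a 0; first by rewrite a_eq0 mulr0 mulr_ge0.
  have a_gt0 : 0 < a by rewrite lt_neqAle eq_sym a_neq0.
  rewrite -(ler_pM2r a_gt0).
  have E : inner (H (phi x)) b' (dmx phi b x) = - a by lra.
  rewrite E sqrrN in cs2; rewrite -/a' -/(pull H phi b b x) in cs2.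
  apply: (@le_trans _ _ ((1 + c x) * (a' * pull H phi b b x))).
    by rewrite -mulrA -expr2; apply: ler_wpM2l.
  rewrite mulrCA [leRHS]mulrAC mulrC; apply: ler_wpM2r => //.
  by rewrite -subr_ge0.
lra.
Qed.

(** [v] is a simultaneous eigenvector: relative to [g], the form G has eigenvalue (1 + c) / 2 on it
    and the pulled-back form has (1 - c) / 2. *)
Lemma null_vector_frame k :
  2 * inner (G x) (e k) v = (1 + c x) * inner (g x) (e k) v /\
  2 * pull H phi (e k) v x = (1 - c x) * inner (g x) (e k) v.
Proof. by have := null_vector (e k); rewrite gE // => E; split; lra. Qed.

Variable sigma : R.
Hypothesis sigma_ge0 : 0 <= sigma.
Hypothesis secM : forall a b, inner (G x) (riemann G x a b a) b <=
  - sigma * (inner (G x) a a * inner (G x) b b - inner (G x) a b ^+ 2).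
Hypothesis secN : forall a b, - sigma * (inner (H (phi x)) a a * inner (H (phi x)) b b
   - inner (H (phi x)) a b ^+ 2) <= inner (H (phi x)) (riemann H (phi x) a b a) b.

(** Once these eigenvalues replace every product with [v], both curvature bounds carry the factor 1
    - c^2, and the two squares differ by a multiple of [c]. *)
Lemma curvature_term_le k : (1 - c x) * R1 k - (1 + c x) * R2 k <=
  - sigma * ((1 - c x ^+ 2) / 2 * (inner (G x) (e k) (e k) - pull H phi (e k) (e k) x
     - c x * inner (g x) (e k) v ^+ 2)).
Proof.
have [nv1 nv2] : 2 * inner (G x) v v = 1 + c x /\ 2 * pull H phi v v x = 1 - c x.
  have E := null_vector v; have E1 := gE Dx v v; rewrite unit_v in E1.
  have qE : pull H phi v v x = 1 - inner (G x) v v by lra.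
  by rewrite qE in E; rewrite qE; split; lra.
have Gv0 : 0 <= 1 + c x.
  have : 0 <= inner (G x) v v by apply: positive_definite_ge0; case: GD => _ _ _; apply.
  lra.
have Pv0 : 0 <= 1 - c x.
  have : 0 <= pull H phi v v x.
    by apply: positive_definite_ge0; case: HU => _ _ _; apply; exact: phiU.
  lra.
have := ler_wpM2l Pv0 (secM (e k) v).
have := ler_wpM2l Gv0 (secN (dmx phi (e k) x) (dmx phi v x)).
rewrite -/(pull H phi (e k) (e k) x) -/(pull H phi v v x) -/(pull H phi (e k) v x).
have [] := null_vector_frame k.
set s := inner (g x) (e k) v; set r1 := inner (G x) (riemann _ _ _ _ _) _.
set r2 := inner (H _) (riemann _ _ _ _ _) _.
set p := inner (G x) (e k) v; set q := pull H phi (e k) v x => pE qE.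
have -> : p = (1 + c x) * s / 2 by rewrite -pE; field.
have -> : q = (1 - c x) * s / 2 by rewrite -qE; field.
have -> : inner (G x) v v = (1 + c x) / 2 by rewrite -nv1; field.
have -> : pull H phi v v x = (1 - c x) / 2 by rewrite -nv2; field.
move=> h2 h1; apply: le_trans (lerB h1 h2) _.
by rewrite le_eqVlt; apply/orP; left; apply/eqP; field.
Qed.

(** This is tr(s), for an orthonormal frame [e]. *)
Definition trace_difference : R :=
  \sum_k (inner (G x) (e k) (e k) - pull H phi (e k) (e k) x).

Lemma laplacian_estimate : laplacian_at c <=
  - 4 * c x * \sum_k (inner (G x) (B1 k) (B1 k) + inner (H (phi x)) (B2 k) (B2 k))
  - sigma * ((1 - c x ^+ 2) * (trace_difference - c x)).
Proof.
apply: le_trans laplacian_le _; apply: lerD.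
  rewrite !mulr_sumr -sumrB mulr_sumr; apply: ler_sum => k _.
  by have := tension_norm_le k; lra.
rewrite !mulr_sumr -sumrB.
have h : \sum_k ((1 - c x) * R1 k - (1 + c x) * R2 k) <= \sum_k (- sigma *
   ((1 - c x ^+ 2) / 2 * (inner (G x) (e k) (e k) - pull H phi (e k) (e k) x
     - c x * inner (g x) (e k) v ^+ 2))).
  by apply: ler_sum => k _; exact: curvature_term_le.
apply: le_trans (ler_wpM2l _ h) _ => //.
rewrite -!mulr_sumr sumrB -mulr_sumr -/trace_difference.
have -> : \sum_k inner (g x) (e k) v ^+ 2 = 1.
  rewrite -unit_v (frame_parseval eo); apply: eq_bigr => k _.
  by rewrite expr2 (gsym v _ Dx).
by rewrite le_eqVlt; apply/orP; left; apply/eqP; field.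
Qed.

End at_frame.
End at_minimum.
End maximum_principle.

(** * Frames extending a unit vector, openness of definiteness, and thresholds on compact sets *)

Section frames.
Context {R : realType} {m : nat}.
Variable g : 'M[R]_m.
Hypotheses (gsym : symmetric_matrix g) (gpos : positive_definite g).

Lemma normalize u : u != 0 -> exists2 k : R, 0 < k & inner g (k *: u) (k *: u) = 1.
Proof.
move=> u0; have uu := gpos u0; exists (Num.sqrt (inner g u u))^-1.
  by rewrite invr_gt0 sqrtr_gt0.
rewrite innerZl innerZr mulrA -expr2 exprVn sqr_sqrtr ?ltW //.
by rewrite mulVf // gt_eqF.
Qed.

(** Orthogonality amounts to [k] linear equations in more than [k] unknowns. *)
Lemma orthogonal_vector k (E : nat -> 'rV[R]_m) : (k < m)%N ->
  exists2 u : 'rV[R]_m, inner g u u = 1 & forall i, (i < k)%N -> inner g u (E i) = 0.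
Proof.
move=> km; pose A := g *m (\matrix_(i < k) E i)^T.
have : kermx A != 0.
  rewrite -mxrank_eq0 mxrank_ker subn_eq0 -ltnNge.
  exact: leq_ltn_trans (rank_leq_col A) km.
move=> /rowV0Pn[u /sub_kermxP uA u0]; have [t t0 ut] := normalize u0.
exists (t *: u) => // i ik; rewrite innerZl /inner.
suff -> : (u *m g *m (E i)^T) ord0 ord0 = 0 by rewrite mulr0.
have := congr1 (fun B : 'M[R]_(1, k) => B ord0 (Ordinal ik)) uA.
rewrite /A mulmxA [in RHS]mxE => <-; rewrite mxE [RHS]mxE.
by apply: eq_bigr => j _; congr (_ * _); rewrite !mxE.
Qed.

Lemma orthonormal_family k (v : 'rV[R]_m) : inner g v v = 1 -> (k < m)%N ->
  exists2 E : nat -> 'rV[R]_m, E 0%N = v &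
    forall i j, (i <= k)%N -> (j <= k)%N -> inner g (E i) (E j) = (i == j)%:R.
Proof.
move=> vv; elim: k => [|k IH] km.
  by exists (fun=> v) => // i j; rewrite !leqn0 => /eqP -> /eqP ->.
have [E E0 EP] := IH (ltnW km); have [u uu uE] := orthogonal_vector E km.
have eqS i : (i <= k.+1)%N -> (k < i)%N -> i = k.+1.
  by move=> ik ki; apply/eqP; rewrite eqn_leq ik.
exists (fun i => if (i <= k)%N then E i else u) => //= i j ik jk.
have [hi|/(eqS _ ik) ->] := leqP i k; have [hj|/(eqS _ jk) ->] := leqP j k.
- exact: EP.
- by rewrite innerC // uE // ltn_eqF.
- by rewrite uE // gtn_eqF.
- by rewrite uu eqxx.
Qed.

Lemma orthonormal_frame_exists (v : 'rV[R]_m) (i0 : 'I_m) :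
  inner g v v = 1 -> nat_of_ord i0 = 0%N ->
  exists2 e : 'I_m -> 'rV[R]_m, orthonormal_frame g e & e i0 = v.
Proof.
move=> vv i00; have m0 : (0 < m)%N by exact: leq_ltn_trans (ltn_ord i0).
have mk : (m.-1 < m)%N by rewrite prednK.
have [E E0 EP] := orthonormal_family vv mk.
exists (fun i => E i) => [i j|]; last by rewrite i00.
by rewrite EP // -ltnS prednK.
Qed.

End frames.

Section continuity_of_definiteness.
Context {R : realType} {m : nat}.

Lemma sphere_compact : compact [set u : 'rV[R]_m | `|u| = 1].
Proof.
apply: bounded_closed_compact.
  exists 1; split=> // M M1 u /= ->; exact: ltW.
have -> : [set u : 'rV[R]_m | `|u| = 1] = (fun u : 'rV[R]_m => `|u|) @^-1` [set 1].
  by apply/seteqP; split.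
apply: closed_comp; last exact: closed_eq.
by move=> u _; exact: norm_continuous.
Qed.

Lemma inner_le_entries (A : 'M[R]_m) u (e : R) : `|u| = 1 ->
  (forall i j, `|A i j| <= e) -> `|inner A u u| <= (m * m)%:R * e.
Proof.
move=> u1 Ae; rewrite innerE.
apply: le_trans (ler_norm_sum _ _ _) _.
have : \sum_(i < m) `|\sum_(j < m) u ord0 i * u ord0 j * A i j| <= \sum_(i < m) (m%:R * e).
  apply: ler_sum => i _; apply: le_trans (ler_norm_sum _ _ _) _.
  rewrite -[m in m%:R]card_ord mulr_natl -sumr_const; apply: ler_sum => j _.
  rewrite !normrM -[leRHS]mul1r; apply: ler_pM => //.
  rewrite -[leRHS]mulr1; apply: ler_pM => //; rewrite -u1; exact: ler_coord_norm.
by rewrite sumr_const card_ord natrM -mulrA [m%:R * (m%:R * e)]mulr_natl.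
Qed.

(** The minimum on the unit sphere is positive and absorbs a small enough perturbation of the
    entries. The parameter space is arbitrary because it will also consist of pairs of a point and a
    level. *)
Lemma posdef_near (T : topologicalType) (A : T -> 'M[R]_m) (x : T) :
  (forall i j, {for x, continuous (fun y => A y i j)}) ->
  positive_definite (A x) -> \forall y \near x, positive_definite (A y).
Proof.
move=> cA Ax.
pose S := [set u : 'rV[R]_m | `|u| = 1].
have normS u : u != 0 -> S (`|u|^-1 *: u).
  by move=> u0; rewrite /S /= normrZ normfV normr_id mulVf // normr_eq0.
have [S0|] := pselect (S !=set0); last first.
  (* Without unit vectors there are no nonzero vectors either; this covers [m = 0]. *)
  move=> S0; near=> y => u /normS Su; case: S0; exists (`|u|^-1 *: u); exact: Su.
have cI : continuous (fun u : 'rV[R]_m => inner (A x) u u).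
  move=> u; apply: differentiable_continuous.
  apply: (smooth_diff (U := setT) _ I).
  have ids := @msmooth_id R m setT openT.
  exact: (smooth_inner openT (msmooth_cst openT (A x)) ids ids).
have [u0 u0S umin] := compact_EVT_min S0 sphere_compact (continuous_subspaceT cI).
move: u0S; rewrite inE => u0S.
have mu0 : 0 < inner (A x) u0 u0.
  by apply: Ax; rewrite -normr_eq0 u0S oner_eq0.
set mu := inner (A x) u0 u0 in mu0.
pose e := mu / ((m * m)%:R + 1).
have e0 : 0 < e by rewrite divr_gt0 // ltr_wpDl.
have near_entries : \forall y \near x, forall ij : 'I_m * 'I_m,
    `|(A x - A y) ij.1 ij.2| <= e.
  apply: filter_forall => -[i j] /=.
  have /cvgrPdist_le/(_ _ e0) := cA i j.
  by apply: filterS => y; rewrite !mxE.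
apply: filterS near_entries => y Ey u un0.
have Su := normS u un0.
have nu : 0 < `|u| by rewrite normr_gt0.
have small : `|inner (A x - A y) (`|u|^-1 *: u) (`|u|^-1 *: u)| <= (m * m)%:R * e.
  by apply: inner_le_entries => // i j; exact: (Ey (i, j)).
have big : mu <= inner (A x) (`|u|^-1 *: u) (`|u|^-1 *: u) by apply: umin; rewrite inE.
have lt : (m * m)%:R * e < mu.
  have em : e * ((m * m)%:R + 1) = mu by rewrite /e divfK // gt_eqF // ltr_wpDl.
  lra.
have : 0 < inner (A y) (`|u|^-1 *: u) (`|u|^-1 *: u).
  move: small; rewrite innerBm ler_norml => /andP[_ s]; lra.
rewrite innerZl innerZr mulrA pmulr_rgt0 // mulr_gt0 // invr_gt0 //.
Unshelve. all: by end_near. Qed.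

End continuity_of_definiteness.

(** In the applications [O c] is the set where the least eigenvalue exceeds [c], and the supremum
    found is its minimum over [K]. If [K] were still contained in [O] at the supremum, the local
    gain in level and compactness would push the inclusion beyond it. *)
Lemma compact_threshold (R : realType) (T : topologicalType) (K : set T) (O : R -> set T)
    (c0 c1 : R) : compact K ->
  (forall c x, K x -> O c x -> exists2 c', c < c' & \forall y \near x, O c' y) ->
  (forall c c', c <= c' -> O c' `<=` O c) ->
  K `<=` O c0 -> ~ K `<=` O c1 ->
  exists c, [/\ c0 <= c, forall c', c' < c -> K `<=` O c' & exists2 x, K x & ~ O c x].
Proof.
move=> cK Oopen Omono K0 K1.
pose S := [set c | K `<=` O c].
have supS : has_sup S.
  split; first by exists c0.
  exists c1 => c Sc; rewrite leNgt; apply/negP => cc1; apply: K1.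
  exact: subset_trans Sc (Omono _ _ (ltW cc1)).
have below c' : c' < sup S -> K `<=` O c'.
  move=> c'S; have [c Sc cc'] : exists2 c, S c & c' < c.
    have e0 : 0 < sup S - c' by rewrite subr_gt0.
    by have [c Sc] := sup_adherent e0 supS; rewrite opprB addrC subrK => ?; exists c.
  exact: subset_trans Sc (Omono _ _ (ltW cc')).
exists (sup S); split=> //; first exact: ub_le_sup supS.2 _ K0.
apply: contrapT => nex.
have KS : K `<=` O (sup S).
  by move=> x Kx; apply: contrapT => nO; apply: nex; exists x.
have : \forall c \near (sup S)^'+, K `<=` O c.
  have /compact_near_coveringP := cK; apply => x Kx.
  have [c' sc' nO] := Oopen _ _ Kx (KS _ Kx).
  exists ([set y | O c' y], [set c | c <= c']).
    by split => //=; exact: nbhs_right_le.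
  by move=> [y c] /= [Oy cc']; exact: Omono cc' _ Oy.
move=> nS; have [c [Sc cS]] : exists c, S c /\ sup S < c.
  near (sup S)^'+ => c; exists c; split; first by near: c.
  by near: c; exact: nbhs_right_gt.
by have := ub_le_sup supS.2 Sc; rewrite leNgt cS.
Unshelve. all: by end_near. Qed.

Section definiteness_threshold.
Context {R : realType} {m : nat}.

Lemma posdef_near2 (T : topologicalType) (A B : T -> 'M[R]_m) (x : T) (c : R) :
  (forall i j, {for x, continuous (fun y => A y i j)}) ->
  (forall i j, {for x, continuous (fun y => B y i j)}) ->
  positive_definite (A x - c *: B x) ->
  \forall y \near x & c' \near c, positive_definite (A y - c' *: B y).
Proof.
move=> cA cB pos.
have := @posdef_near R m (T * R)%type (fun p => A p.1 - p.2 *: B p.1) (x, c) _ pos; apply.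
move=> i j.
have -> : (fun p : T * R => (A p.1 - p.2 *: B p.1) i j) =
    (fun p : T * R => A p.1 i j - p.2 * B p.1 i j) by apply/funext => p; rewrite !mxE.
have c1 (f : T -> R) : {for x, continuous f} ->
    {for (x, c), continuous (fun p : T * R => f p.1)}.
  move=> cf; apply: (@continuous_comp _ _ _ fst f (x, c)) => //.
  exact: cvg_fst.
apply: continuousB; first exact: (c1 (fun y => A y i j)).
apply: continuousM; first exact: cvg_snd.
exact: (c1 (fun y => B y i j)).
Qed.

Lemma posdef_near_right (T : topologicalType) (A B : T -> 'M[R]_m) (x : T) (c : R) :
  (forall i j, {for x, continuous (fun y => A y i j)}) ->
  (forall i j, {for x, continuous (fun y => B y i j)}) ->
  positive_definite (A x - c *: B x) ->
  exists2 c', c < c' & \forall y \near x, positive_definite (A y - c' *: B y).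
Proof.
move=> cA cB pos; have [[P Q] /= [nP nQ] PQ] := posdef_near2 cA cB pos.
have [c' [cc' Qc']] : exists c', c < c' /\ Q c'.
  near c^'+ => c'; exists c'; split; first by near: c'; exact: nbhs_right_gt.
  by near: c'; exact: nbhs_right_ltW nQ || exact: (cvg_within _ nQ).
exists c' => //; apply: filterS nP => y Py.
exact: (PQ (y, c')).
Unshelve. all: by end_near. Qed.

End definiteness_threshold.

(** All that the local analysis uses about a pair of charts. The two harmonicity fields express
    minimality of the graph, and the curvature bounds are multiplied by the Gram determinant so as
    to hold for dependent vectors as well. *)
Record minimal_graph_data (R : realType) m n (D : set 'rV[R]_m) (U : set 'rV[R]_n)
    (G g : 'rV[R]_m -> 'M[R]_m) (H : 'rV[R]_n -> 'M[R]_n)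
    (phi : 'rV[R]_m -> 'rV[R]_n) (sigma : R) : Prop := MinimalGraphData {
  mgd_G : metric_on D G;
  mgd_g : metric_on D g;
  mgd_H : metric_on U H;
  mgd_smooth : msmooth D phi;
  mgd_map : forall y, D y -> U (phi y);
  mgd_gE : forall y, D y -> forall a b,
    inner (g y) a b = inner (G y) a b + pull H phi a b y;
  mgd_harm1 : harmonic G D g id;
  mgd_harm2 : harmonic H D g phi;
  mgd_sigma : 0 < sigma;
  mgd_secM : forall y, D y -> forall a b, inner (G y) (riemann G y a b a) b <=
    - sigma * (inner (G y) a a * inner (G y) b b - inner (G y) a b ^+ 2);
  mgd_secN : forall y, D y -> forall a b,
    - sigma * (inner (H (phi y)) a a * inner (H (phi y)) b b
      - inner (H (phi y)) a b ^+ 2) <= inner (H (phi y)) (riemann H (phi y) a b a) b }.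

Section minimal_graph_theory.
Context {R : realType} {m n : nat}.
Variables (U : set 'rV[R]_n).
Variables (G g : 'rV[R]_m -> 'M[R]_m) (H : 'rV[R]_n -> 'M[R]_n).
Variables (phi : 'rV[R]_m -> 'rV[R]_n) (sigma : R).

Lemma metric_on_subset (D D' : set 'rV[R]_m) (A : 'rV[R]_m -> 'M[R]_m) :
  open D' -> D' `<=` D -> metric_on D A -> metric_on D' A.
Proof.
move=> oD' sD [_ As Asym Apos]; split=> //.
- by move=> i j; exact: smooth_subset sD (As i j).
- by move=> z /sD; exact: Asym.
- by move=> z /sD; exact: Apos.
Qed.

Lemma minimal_graph_subset (D D' : set 'rV[R]_m) : open D' -> D' `<=` D ->
  minimal_graph_data D U G g H phi sigma -> minimal_graph_data D' U G g H phi sigma.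
Proof.
move=> oD' sD [h1 h2 h3 h4 h5 h6 h7 h8 h9 h10 h11].
have sub y : D' y -> D y by exact: sD.
split=> //.
- exact: metric_on_subset h1.
- exact: metric_on_subset h2.
- by move=> i j; exact: smooth_subset sD (h4 i j).
- by move=> y /sub; exact: h5.
- by move=> y /sub; exact: h6.
- by move=> y /sub; exact: h7.
- by move=> y /sub; exact: h8.
- by move=> y /sub; exact: h10.
- by move=> y /sub; exact: h11.
Qed.

Variable D : set 'rV[R]_m.
Hypothesis L : minimal_graph_data D U G g H phi sigma.

Let oD : open D. Proof. by case: (mgd_g L). Qed.
Let gs : msmooth D g. Proof. by case: (mgd_g L). Qed.
Let Gs : msmooth D G. Proof. by case: (mgd_G L). Qed.
Let gsym y : D y -> symmetric_matrix (g y). Proof. by case: (mgd_g L) => _ _ + _; apply. Qed.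
Let gpos y : D y -> positive_definite (g y). Proof. by case: (mgd_g L) => _ _ _; apply. Qed.
Let Gsym y : D y -> symmetric_matrix (G y). Proof. by case: (mgd_G L) => _ _ + _; apply. Qed.
Let Gpos y : D y -> positive_definite (G y). Proof. by case: (mgd_G L) => _ _ _; apply. Qed.

(* In terms of the induced metric g = G + P, the tensor s = G - P is 2 G - g. *)
Definition s_mx y : 'M[R]_m := 2 *: G y - g y.

Lemma s_mxE y a b : D y -> inner (s_mx y) a b = inner (G y) a b - pull H phi a b y.
Proof.
by move=> Dy; rewrite /s_mx innerBm innerZm (mgd_gE L Dy); ring.
Qed.

Lemma weighted_formE (c : 'rV[R]_m -> R) a b y : D y ->
  weighted_form G H phi c a b y = inner (s_mx y - c y *: g y) a b.
Proof.
move=> Dy; rewrite innerBm innerZm s_mxE // (mgd_gE L Dy) /weighted_form pull_id; ring.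
Qed.

Lemma s_mx_sym y : D y -> symmetric_matrix (s_mx y).
Proof.
by move=> Dy; rewrite /symmetric_matrix /s_mx linearB linearZ /= (gsym Dy) (Gsym Dy).
Qed.

Lemma pull_ge0 w y : D y -> 0 <= pull H phi w w y.
Proof.
move=> Dy; apply: positive_definite_ge0; case: (mgd_H L) => _ _ _; apply.
exact: mgd_map L _ Dy.
Qed.

Lemma eigenvalue_bounds (c : R) v y : D y -> inner (g y) v v = 1 ->
  inner (s_mx y) v v = c -> -1 <= c <= 1.
Proof.
move=> Dy; rewrite (mgd_gE L Dy) s_mxE // => E1 E2.
have := pull_ge0 v Dy; have := positive_definite_ge0 v (Gpos Dy).
by move=> h1 h2; apply/andP; split; lra.
Qed.

Section laplacian.
Variable f : 'rV[R]_m -> R.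
Hypothesis fs : smooth D f.

(** The frame-free counterpart of [laplacian_at]: being continuous in [y], it stays positive near a
    point where it is positive. *)
Definition laplacian y : R := \sum_i \sum_j invmx (g y) i j *
  (dscal (dscal f (delta_mx 0 j)) (delta_mx 0 i) y
   - dscal f (gamma g y (delta_mx 0 i) (delta_mx 0 j)) y).

Lemma dscal_linear y : D y -> linear (fun u => dscal f u y : R^o).
Proof. by move=> Dy k u w; exact: (dscal_dirP Dy k u w fs). Qed.

Lemma laplacian_atE y e : D y -> orthonormal_frame (g y) e ->
  laplacian_at g y e f = laplacian y.
Proof.
move=> Dy eo.
pose b u w : R^o := dscal (dscal f w) u y - dscal f (gamma g y u w) y.
have bl w : linear (b^~ w).
  move=> k u u'; rewrite /b (dscal_dirP Dy k u u' (smooth_dscal w fs)).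
  rewrite (gammaPl (mgd_g L) _ _ _ _ Dy) (dscal_dirP Dy _ _ _ fs) scalerBr.
  by rewrite opprD addrACA.
have bC u w : b u w = b w u.
  rewrite /b (gammaC (mgd_g L) _ _ Dy); congr (_ - _).
  rewrite (dscal_funE f w) (dscal_funE f u) dscalE dscalE.
  exact: (smooth_schwarz u w oD Dy fs).
have br w : linear (b w) by move=> k u u'; rewrite !(bC w); exact: bl.
have := frame_trace_bilinear eo br bl.
rewrite /laplacian_at (linear_fun_sum (dscal_linear Dy)) -sumrB => ->.
by [].
Qed.

Lemma smooth_laplacian : smooth D laplacian.
Proof.
move=> k; apply: (Ck_sum oD) => i _; apply: (Ck_sum oD) => j _.
apply: (CkM oD).
  apply: (msmooth_invmx oD _ gs i j) => y Dy; exact: positive_definite_unit (gpos Dy).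
apply: (CkD oD); first exact: (smooth_dscal _ (smooth_dscal _ fs)).
apply: (CkN oD).
apply: (eq_Ck oD (f := fun y => \sum_l gamma g y (delta_mx 0 i) (delta_mx 0 j) ord0 l
   * dscal f (delta_mx 0 l) y)).
  move=> y Dy; rewrite [in RHS](row_sum_delta (gamma _ _ _ _)).
  rewrite (linear_fun_sum (dscal_linear Dy)).
  by apply: eq_bigr => l _; rewrite (linear_funZ (dscal_linear Dy)).
apply: (Ck_sum oD) => l _; apply: (CkM oD).
  exact: (msmooth_gamma (mgd_g L)).
exact: smooth_dscal.
Qed.

Lemma laplacian_at_affine (a b : R) y e : D y ->
  laplacian_at g y e (fun z => a * f z + b) = a * laplacian_at g y e f.
Proof.
move=> Dy; have cs := smooth_cst oD a; have bs := smooth_cst oD b.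
have E u z : D z -> dscal (fun z => a * f z + b) u z = a * dscal f u z.
  move=> Dz; rewrite (dscalD Dz u (smoothM oD cs fs) bs) (dscalM Dz u cs fs).
  by rewrite !dscal_cst mul0r add0r addr0.
rewrite /laplacian_at E // mulrBr mulr_sumr; congr (_ - _); apply: eq_bigr => k _.
rewrite (eq_dscal oD Dy _ (E (e k))) (dscalM Dy _ cs (smooth_dscal (e k) fs)).
by rewrite dscal_cst mul0r add0r.
Qed.

End laplacian.

Lemma laplacian_at_cst (b : R) y e : laplacian_at g y e (fun=> b) = 0.
Proof.
rewrite /laplacian_at dscal_cst subr0 big1 // => k _.
have -> : dscal (fun=> b) (e k) = fun=> 0 by apply/funext => z; rewrite dscal_cst.
by rewrite dscal_cst.
Qed.

Lemma trace_difference_ge y e (i0 : 'I_m) : D y -> orthonormal_frame (g y) e ->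
  (forall w, 0 <= inner (s_mx y) w w) ->
  inner (s_mx y) (e i0) (e i0) <= trace_difference G H phi y e.
Proof.
move=> Dy eo s0; rewrite /trace_difference (bigD1 i0) //= s_mxE // lerDl.
by apply: sumr_ge0 => k _; rewrite -s_mxE.
Qed.

(** [c] only has to touch the least eigenvalue from below at [y]. It is applied to constants and to
    constants plus a multiple of the barrier. *)
Lemma eigenvalue_estimate (c : 'rV[R]_m -> R) y v e : smooth D c -> D y ->
  (forall z w, D z -> 0 <= inner (s_mx z - c z *: g z) w w) ->
  inner (s_mx y) v v = c y -> inner (g y) v v = 1 -> orthonormal_frame (g y) e ->
  laplacian_at g y e c <= - 4 * c y *
    \sum_k (inner (G y) (sff g G id y (e k) v) (sff g G id y (e k) v)
      + inner (H (phi y)) (sff g H phi y (e k) v) (sff g H phi y (e k) v))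
  - sigma * ((1 - c y ^+ 2) * (trace_difference G H phi y e - c y)).
Proof.
move=> cs Dy c0 cv gv eo.
apply: (laplacian_estimate (mgd_G L) (mgd_g L) (mgd_H L) (mgd_smooth L) (mgd_map L)
  (mgd_gE L) (mgd_harm1 L) (mgd_harm2 L) cs Dy _ _ gv eo (mgd_secM L Dy) (mgd_secN L Dy)).
- by move=> z w Dz; rewrite weighted_formE //; exact: c0.
- by rewrite weighted_formE // innerBm innerZm cv gv mulr1 subrr.
Qed.

(** The estimate for the constant 0 reads tr s <= 0, and a nonnegative form of nonpositive trace
    vanishes. *)
Lemma degenerate_vanishes y w : D y -> (forall z a, D z -> 0 <= inner (s_mx z) a a) ->
  w != 0 -> inner (s_mx y) w w = 0 -> forall a b, inner (s_mx y) a b = 0.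
Proof.
move=> Dy s0 w0 sw.
have m0 : (0 < m)%N.
  by case: posnP => // m0; case/eqP: w0; apply/rowP => -[j jm]; exfalso; rewrite m0 in jm.
have [k k0 ku] := normalize (gpos Dy) w0.
have [e eo ei] := orthonormal_frame_exists (gsym Dy) (gpos Dy) (i0 := Ordinal m0) ku erefl.
have sv : inner (s_mx y) (k *: w) (k *: w) = 0 by rewrite innerZl innerZr sw !mulr0.
have := eigenvalue_estimate (smooth_cst oD 0) Dy _ sv ku eo.
rewrite laplacian_at_cst mulr0 mul0r add0r expr0n /= !subr0 mul1r oppr_ge0.
rewrite pmulr_rle0 ?(mgd_sigma L) // => tr.
have {}tr : \sum_k inner (s_mx y) (e k) (e k) <= 0.
  have -> : \sum_k inner (s_mx y) (e k) (e k) = trace_difference G H phi y e.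
    by apply: eq_bigr => i _; rewrite s_mxE.
  by apply: tr => z a Dz; rewrite scale0r subr0; exact: s0.
have se i : inner (s_mx y) (e i) (e i) = 0.
  apply: (psumr_eq0P (P := predT) (F := fun i => inner (s_mx y) (e i) (e i))) => // [j _|].
    exact: s0.
  by apply/eqP; rewrite eq_le tr sumr_ge0 // => j _; exact: s0.
move=> a b; rewrite (frame_expansion eo b) inner_sumr big1 // => i _.
rewrite innerZr (semidefinite_null _ (s_mx_sym Dy) _ (se i)) ?mulr0 //.
by move=> z; exact: s0.
Qed.

Lemma s_mx_continuous y i j : D y -> {for y, continuous (fun z => s_mx z i j)}.
Proof.
move=> Dy; have ss : msmooth D s_mx.
  apply: (msmoothD oD); last exact: msmoothN.
  by apply: (msmoothZ oD (a := fun=> 2)) => //; exact: smooth_cst.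
exact: smooth_continuous (ss i j) Dy.
Qed.

End minimal_graph_theory.

(** * Openness of the degenerate set *)

Section euclidean_norm.
Context {R : realType} {m : nat}.
Implicit Types u v w x y : 'rV[R]_m.

(** Row vectors carry the sup norm, whose balls have corners; a smooth barrier and the parallelogram
    law require the Euclidean length. *)
Definition esq u : R := inner 1%:M u u.

Lemma esqE u : esq u = \sum_i u ord0 i ^+ 2.
Proof.
by rewrite /esq /inner mulmx1 mxE; apply: eq_bigr => i _; rewrite !mxE expr2.
Qed.

Lemma id_sym : symmetric_matrix (1%:M : 'M[R]_m).
Proof. exact: trmx1. Qed.

Lemma id_posdef : positive_definite (1%:M : 'M[R]_m).
Proof.
move=> u u0; rewrite -/(esq u) esqE lt_neqAle sumr_ge0 ?andbT => [|i _]; last exact: sqr_ge0.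
apply: contra u0 => /eqP /esym/psumr_eq0P => h; apply/eqP/rowP => i; rewrite mxE.
by apply/eqP; rewrite -sqrf_eq0; apply/eqP; apply: h => // j _; exact: sqr_ge0.
Qed.

Lemma norm_le_esq u (r : R) : 0 <= r -> esq u <= r ^+ 2 -> `|u| <= r.
Proof.
move=> r0 ur; apply: norm_row_le => // i.
rewrite -(ler_pXn2r (n := 2)) // ?nnegrE // real_normK ?num_real //.
apply: le_trans ur; rewrite esqE (bigD1 i) //= lerDl.
by apply: sumr_ge0 => j _; exact: sqr_ge0.
Qed.

Lemma esq_continuous v : continuous (fun u => esq (u + - v)).
Proof.
move=> u; apply: differentiable_continuous; apply: (smooth_diff (U := setT) _ I).
have ids := msmoothD openT (@msmooth_id R m setT openT) (@msmooth_cst R m setT openT 1 m (- v)).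
exact: (smooth_inner openT (@msmooth_cst R m setT openT m m 1%:M) ids ids).
Qed.

Lemma parallelogram u v : esq (u + v) + esq (u - v) = 2 * esq u + 2 * esq v.
Proof.
by rewrite /esq !innerDl !innerDr !innerNl !innerNr; ring.
Qed.

End euclidean_norm.

Lemma dist_continuous (R : realType) m (z : 'rV[R]_m) : continuous (fun y : 'rV[R]_m => `|y - z|).
Proof.
move=> y; apply: (@continuous_comp _ _ _ (fun y : 'rV[R]_m => y - z) (fun u : 'rV[R]_m => `|u|)).
  by apply: differentiable_continuous; exact: differentiableB.
exact: norm_continuous.
Qed.

(** [A] is a set of radii, so that closed balls and spheres are one case. *)
Lemma closed_dist_compact (R : realType) m (z : 'rV[R]_m) (rho : R) (A : set R) :
  closed A -> (forall t, A t -> t <= rho) -> compact [set y : 'rV[R]_m | A `|y - z|].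
Proof.
move=> cA Ar; apply: bounded_closed_compact.
  exists (rho + `|z|); split; first exact: num_real.
  move=> M rM y /= Ay; apply: ltW; apply: le_lt_trans rM.
  rewrite -{1}(subrK z y); apply: le_trans (ler_normD _ _) _.
  by rewrite lerD2r; exact: Ar.
apply: (@closed_comp _ _ (fun y : 'rV[R]_m => `|y - z|) A) => //.
by move=> y _; exact: dist_continuous.
Qed.

Section hopf.
Context {R : realType} {m n : nat}.
Variables (D : set 'rV[R]_m) (U : set 'rV[R]_n).
Variables (G g : 'rV[R]_m -> 'M[R]_m) (H : 'rV[R]_n -> 'M[R]_n).
Variables (phi : 'rV[R]_m -> 'rV[R]_n) (sigma : R).
Hypothesis L : minimal_graph_data D U G g H phi sigma.
Hypothesis s0 : forall z a, D z -> 0 <= inner (s_mx G g z) a a.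
Hypothesis m0 : (0 < m)%N.

Let oD : open D. Proof. by case: (mgd_g L). Qed.
Let gs : msmooth D g. Proof. by case: (mgd_g L). Qed.
Let gsym y : D y -> symmetric_matrix (g y). Proof. by case: (mgd_g L) => _ _ + _; apply. Qed.
Let gpos y : D y -> positive_definite (g y). Proof. by case: (mgd_g L) => _ _ _; apply. Qed.
Let i0 : 'I_m := Ordinal m0.

(** By [degenerate_vanishes] nothing lies between definite and zero. *)
Lemma vanishingP y : D y ->
  (~ positive_definite (s_mx G g y)) <-> (forall a b, inner (s_mx G g y) a b = 0).
Proof.
move=> Dy; split=> [np|s00].
  have [w w0 sw] := null_vector_exists (fun a => s0 a Dy) np.
  exact: (degenerate_vanishes L Dy s0 w0 sw).
by move=> pos; have := pos _ (delta_neq0 i0); rewrite s00 ltxx.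
Qed.

Section touching_ball.
(* A ball of squared radius r around q, touching the degenerate set only at z. *)
Variables (z q : 'rV[R]_m) (r : R).
Hypotheses (Dz : D z) (r0 : 0 < r) (qz : esq (z - q) = r).
Hypothesis sz : forall a b, inner (s_mx G g z) a b = 0.
Hypothesis ball_pos : forall y, D y -> y != z -> esq (y - q) <= r ->
  positive_definite (s_mx G g y).

(** Positive inside the touching ball, zero on its boundary and negative outside. *)
Definition depth y : R := r + -1 * inner 1%:M (y + - q) (y + - q).

Lemma smooth_depth : smooth D depth.
Proof.
have ids := msmoothD oD (@msmooth_id R m D oD) (@msmooth_cst R m D oD 1 m (- q)).
apply: (smoothD oD (smooth_cst oD r)); apply: (smoothM oD (smooth_cst oD (-1))).
exact: (smooth_inner oD (@msmooth_cst R m D oD m m 1%:M) ids ids).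
Qed.

Lemma depth_center : depth z = 0.
Proof. by rewrite /depth -/(esq (z - q)) qz mulN1r subrr. Qed.

Lemma dscal_depth u : dscal depth u z = - 2 * inner 1%:M (z - q) u.
Proof.
have cs := @msmooth_cst R m D oD 1 m (- q); have id' := @msmooth_id R m D oD.
have ids := msmoothD oD id' cs; have ms := @msmooth_cst R m D oD m m 1%:M.
have es := smooth_inner oD ms ids ids.
rewrite /depth (dscalD Dz u (smooth_cst oD r) (smoothM oD (smooth_cst oD (-1)) es)).
rewrite (dscalM Dz u (smooth_cst oD (-1)) es) !dscal_cst mul0r !add0r.
rewrite (dscal_inner oD Dz u ms ids ids) (dmxD Dz u id' cs) dmx_id !dmx_cst addr0.
rewrite {1}/inner mulmx0 mul0mx mxE add0r (innerC u _ id_sym); ring.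
Qed.

(** Where the depth vanishes, the quadratic term adds 2 k times its squared gradient to the
    Laplacian. Near [z] the barrier keeps the sign of the depth, since 1 + k depth is positive
    there. *)
Definition barrier (k : R) y : R := depth y + k * (depth y * depth y).

Lemma smooth_barrier k : smooth D (barrier k).
Proof.
have ds := smooth_depth.
exact: (smoothD oD ds (smoothM oD (smooth_cst oD k) (smoothM oD ds ds))).
Qed.

Lemma barrierE k y : barrier k y = depth y * (1 + k * depth y).
Proof. by rewrite /barrier; ring. Qed.

Lemma barrier_laplacian_gt0 : exists2 k : R, 0 <= k & 0 < laplacian g (barrier k) z.
Proof.
have ds := smooth_depth; have dds := smoothM oD ds ds.
have zq : z - q != 0 by apply/eqP => zq0; move: r0; rewrite -qz zq0 /esq inner0l ltxx.
(* A frame starting along the radius exhibits one nonzero derivative of the depth, so the squared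
   gradient [A] is positive. *)
have [t t0 tu] := normalize (gpos Dz) zq.
have [e eo ei] := orthonormal_frame_exists (gsym Dz) (gpos Dz) (i0 := i0) tu erefl.
pose A := \sum_k dscal depth (e k) z ^+ 2.
have A0 : 0 < A.
  rewrite /A (bigD1 i0) //=; apply: ltr_pwDl; last by apply: sumr_ge0 => j _; exact: sqr_ge0.
  rewrite lt_neqAle sqr_ge0 andbT eq_sym sqrf_eq0 dscal_depth ei innerZr.
  rewrite -/(esq (z - q)) qz; apply: mulf_neq0; first by rewrite oppr_eq0 pnatr_eq0.
  by rewrite mulf_neq0 ?gt_eqF.
pose B := laplacian_at g z e depth.
have E k : laplacian g (barrier k) z = B + k * (2 * A).
  rewrite -(laplacian_atE L (smooth_barrier k) Dz eo) /B /laplacian_at /barrier.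
  have ks := smooth_cst oD k; have kds := smoothM oD ks dds.
  rewrite (dscalD Dz _ ds kds) (dscalM Dz _ ks dds) dscal_cst (dscalM Dz _ ds ds).
  rewrite depth_center !(mulr0, mul0r, addr0) [RHS]addrAC; congr (_ - _).
  rewrite /A mulr_sumr mulr_sumr -big_split; apply: eq_bigr => i _ /=.
  rewrite (dscal2D oD _ Dz ds kds) (dscal2M oD _ Dz ks dds) (dscal2M oD _ Dz ds ds).
  rewrite depth_center dscal_cst.
  have -> : dscal (dscal (fun=> k) (e i)) (e i) z = 0.
    have -> : dscal (fun=> k) (e i) = fun=> 0 by apply/funext => y; rewrite dscal_cst.
    by rewrite dscal_cst.
  ring.
(* Chosen so that the quadratic contribution [|B| + 1] outweighs the Laplacian [B] of the depth. *)
exists ((`|B| + 1) / (2 * A)); first by rewrite divr_ge0 ?addr_ge0 // mulr_ge0 // ltW.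
rewrite E divfK ?mulf_neq0 ?gt_eqF //; have := ler_norm (- B); rewrite normrN; lra.
Qed.

(* Hopf: near z a barrier that is negative outside the touching ball lifts the least
   eigenvalue on a small sphere, so that the least eigenvalue of s - delta v g is
   attained in the interior, where the maximum principle contradicts Delta v > 0. *)
Lemma no_touching_ball : False.
Proof.
have [k k0 lap0] := barrier_laplacian_gt0.
set v := barrier k; have vs : smooth D v := smooth_barrier k.
have near_z : \forall y \near z, [/\ D y, 0 < laplacian g v y & 0 < 1 + k * depth y].
  have n1 := open_near oD Dz (fun y Dy => Dy).
  have c2 := smooth_continuous (smooth_laplacian L vs) Dz.
  have n2 := cvgr_gt _ c2 _ lap0.
  have ds := smoothD oD (smooth_cst oD 1) (smoothM oD (smooth_cst oD k) smooth_depth).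
  have c3 := smooth_continuous ds Dz.
  have p3 : 0 < 1 + k * depth z by rewrite depth_center mulr0 addr0.
  have n3 := cvgr_gt _ c3 _ p3.
  near=> y; split; [near: y; exact: n1|near: y; exact: n2|near: y; exact: n3].
have [d d0 dP] : exists2 d : R, 0 < d & forall y : 'rV[R]_m, `|y - z| < d ->
    [/\ D y, 0 < laplacian g v y & 0 < 1 + k * depth y].
  move: near_z; rewrite (near_shift 0) /= subr0 => /nbhs_norm0P[d d0 dP].
  by exists d => // y yd; have := dP (y - z) yd; rewrite /= subrK.
pose rho := d / 2; have rho0 : 0 < rho by rewrite divr_gt0.
have rhod : rho < d by rewrite ltr_pdivrMr // ltr_pMr // ltr1n.
pose K := [set y : 'rV[R]_m | [set t : R | t <= rho] `|y - z|].
pose S := [set y : 'rV[R]_m | [set rho] `|y - z|].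
have KP y : K y -> [/\ D y, 0 < laplacian g v y & 0 < 1 + k * depth y].
  by move=> Ky; apply: dP; exact: le_lt_trans Ky rhod.
have KD y : K y -> D y by move=> /KP[].
have cK : compact K by apply: (@closed_dist_compact _ _ z rho) => //; exact: closed_le.
have cS : compact S.
  by apply: (@closed_dist_compact _ _ z rho) => [|t ->//]; exact: closed_eq.
have SK : S `<=` K by move=> y; rewrite /S /K /= => ->.
have Kz : K z by rewrite /K /= subrr normr0 ltW.
have vgs : msmooth D (fun y => v y *: g y) by exact: msmoothZ.
have v_neg y : K y -> depth y < 0 -> v y < 0.
  by move=> /KP[_ _ p] dy; rewrite /v barrierE nmulr_rlt0.
have gc y i j : K y -> {for y, continuous (fun w => g w i j)}.
  by move=> /KD Dy; exact: smooth_continuous (gs i j) Dy.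
(* On the part of the small sphere inside the closed touching ball s is definite and tolerates a
   small [delta]. On the rest the barrier is negative, so every positive [delta] works. Compactness
   of the sphere makes the choice uniform. *)
have [delta delta0 deltaP] : exists2 delta : R, 0 < delta &
    forall y, S y -> positive_definite (s_mx G g y - delta *: (v y *: g y)).
  have : \forall delta \near (0 : R)^'+,
      S `<=` (fun y => positive_definite (s_mx G g y - delta *: (v y *: g y))).
    have /compact_near_coveringP := cS; apply => y Sy.
    have Ky := SK _ Sy; have Dy := KD _ Ky.
    have [dy|dy] := leP 0 (depth y).
      have py : positive_definite (s_mx G g y - 0 *: (v y *: g y)).
        rewrite scale0r subr0; apply: ball_pos => //.
          by apply/eqP => yz; move: Sy rho0; rewrite /S yz /= subrr normr0 => <-; rewrite ltxx.
        by move: dy; rewrite /depth mulN1r subr_ge0.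
      have [[P Q] /= [nP nQ] PQ] := posdef_near2 (fun i j => s_mx_continuous L Dy)
        (fun i j => smooth_continuous (vgs i j) Dy) py.
      by exists (P, Q) => //; split => //=; exact: (cvg_within _ nQ).
    exists ([set y' | D y' /\ v y' < 0], [set e | 0 < e]); first split => /=.
    - have n1 := open_near oD Dy (fun y Dy => Dy).
      have n2 := cvgr_lt _ (smooth_continuous vs Dy) _ (v_neg _ Ky dy).
      by near=> y'; split; [near: y'; exact: n1|near: y'; exact: n2].
    - exact: nbhs_right_gt.
    - move=> [y' e] /= [[Dy' vy'] e0] u u0.
      rewrite innerBm !innerZm subr_gt0; apply: lt_le_trans (s0 _ Dy').
      by rewrite pmulr_rlt0 // nmulr_rlt0 //; exact: gpos.
  move=> nS; near (0 : R)^'+ => delta; exists delta.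
    by near: delta; exact: nbhs_right_gt.
  by move=> y Sy; have h : S `<=` _ := near nS delta _; exact: h.
pose A y := s_mx G g y - delta *: (v y *: g y).
pose O (c : R) := [set y | D y /\ positive_definite (A y - c *: g y)].
have AE y u c : inner (A y - c *: g y) u u =
    inner (s_mx G g y) u u - (delta * v y + c) * inner (g y) u u.
  by rewrite !innerBm !innerZm; ring.
have [M MP] : exists M, forall y, K y -> v y <= M.
  have cv : {within K, continuous v}.
    apply: continuous_in_subspaceT => y; rewrite inE => /KD Dy.
    exact: smooth_continuous vs Dy.
  have K0 : K !=set0 by exists z.
  have [y _ ymax] := compact_EVT_max K0 cK cv.
  by exists (v y) => y' Ky'; apply: ymax; rewrite inE.
have v0 : v z = 0 by rewrite /v barrierE depth_center mul0r.
have Ac y i j : K y -> {for y, continuous (fun w => A w i j)}.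
  move=> /KD Dy; have as' : msmooth D A.
    apply: (msmoothD oD).
      apply: (msmoothD oD); last exact: msmoothN.
      apply: (msmoothZ oD (a := fun=> 2)); first exact: smooth_cst.
      by case: (mgd_G L).
    apply: (msmoothN oD).
    by apply: (msmoothZ oD (a := fun=> delta)) => //; exact: smooth_cst.
  exact: smooth_continuous (as' i j) Dy.
(* With [M] an upper bound of the barrier, the starting level leaves at least s + g, which is
   definite. Level 0 fails at [z], where both s and the barrier vanish. *)
have [||||c [_ cbelow [y0 Ky0 nO]]] :=
  @compact_threshold R _ K O (- (delta * M + 1)) 0 cK.
- move=> c y Ky [Dy py].
  have [c' cc' nc'] := posdef_near_right (fun i j => Ac y i j Ky) (fun i j => gc y i j Ky) py.
  exists c' => //; have n1 := open_near oD Dy (fun y Dy => Dy).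
  by near=> y'; split; [near: y'; exact: n1|near: y'; exact: nc'].
- move=> c c' cc' y [Dy py]; split=> // u u0.
  apply: lt_le_trans (py u u0) _; rewrite !AE lerD2l lerN2.
  by apply: ler_wpM2r; [apply/ltW/gpos|rewrite lerD2l].
- move=> y Ky; have Dy := KD _ Ky; split=> // u u0; rewrite AE subr_gt0.
  apply: lt_le_trans (s0 _ Dy); rewrite nmulr_rlt0 ?gpos //.
  have := ler_wpM2l (ltW delta0) (MP _ Ky); lra.
- move=> h; have [_ pz] := h _ Kz.
  by have := pz _ (delta_neq0 i0); rewrite AE sz v0 mulr0 addr0 mul0r subr0 ltxx.
have c_le0 : c <= 0.
  rewrite leNgt; apply/negP => c0; have [_ pz] := cbelow _ c0 _ Kz.
  by have := pz _ (delta_neq0 i0); rewrite AE sz v0 mulr0 addr0 mul0r subr0 ltxx.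
have Dy0 := KD _ Ky0.
(* On the boundary sphere the form is definite at level 0, hence at the level [c <= 0], so
   definiteness can fail only inside. *)
have y0_int : `|y0 - z| < rho.
  rewrite lt_neqAle [X in _ && X]Ky0 andbT; apply/eqP => Sy0.
  apply: nO; split=> // u u0; have := deltaP _ Sy0 _ u0.
  rewrite AE innerBm !innerZm => h; apply: lt_le_trans h _.
  by have := mulr_le0_ge0 c_le0 (ltW (gpos Dy0 u0)); lra.
pose D' := [set y : 'rV[R]_m | `|y - z| < rho].
have oD' : open D'.
  apply: (@open_comp _ _ (fun y : 'rV[R]_m => `|y - z|) [set t | t < rho]).
    by move=> y _; exact: dist_continuous.
  exact: open_lt.
have D'K y : D' y -> K y by exact: ltW.
have D'D : D' `<=` D by move=> y /D'K /KD.
have L' := minimal_graph_subset oD' D'D L.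
(* A smooth function below the least eigenvalue of s on the open ball, touching it at [y0]. *)
pose cc y := delta * v y + c.
have ccs : smooth D' cc.
  apply: smooth_subset D'D _.
  exact: (smoothD oD (smoothM oD (smooth_cst oD delta) vs) (smooth_cst oD c)).
have AcE y u : inner (s_mx G g y - cc y *: g y) u u = inner (A y - c *: g y) u u.
  by rewrite AE innerBm innerZm.
have psd y w : D' y -> 0 <= inner (s_mx G g y - cc y *: g y) w w.
  move=> D'y; rewrite AcE; have Ky := D'K _ D'y; have Dy := KD _ Ky.
  have [->|w0] := eqVneq w 0; first by rewrite inner0l.
  have Y0 := gpos Dy w0; rewrite AE mulrDl opprD addrA.
  set X := _ - delta * v y * _; set Y := inner (g y) w w in Y0 X *.
  rewrite leNgt; apply/negP => neg.
  have XY : X / Y < c by rewrite ltr_pdivrMr // -subr_lt0.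
  have lt2 : (X / Y + c) / 2 < c by lra.
  have [_ /(_ w w0)] := cbelow _ lt2 _ Ky.
  rewrite AE mulrDl opprD addrA -/Y -/X => p.
  have E : X = (X / Y) * Y by rewrite divfK // gt_eqF.
  have : (X / Y) * Y < (X / Y + c) / 2 * Y by rewrite ltr_pM2r //; lra.
  by rewrite -E; lra.
have [w w0 sw] : exists2 w, w != 0 & inner (s_mx G g y0 - cc y0 *: g y0) w w = 0.
  apply: null_vector_exists => [u|pos]; first exact: psd.
  by apply: nO; split=> // u u0; rewrite -AcE; exact: pos.
have [t t0 tu] := normalize (gpos Dy0) w0.
have [e eo ei] := orthonormal_frame_exists (gsym Dy0) (gpos Dy0) (i0 := i0) tu erefl.
have sc : inner (s_mx G g y0) (t *: w) (t *: w) = cc y0.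
  have : inner (s_mx G g y0 - cc y0 *: g y0) (t *: w) (t *: w) = 0.
    by rewrite innerZl innerZr sw !mulr0.
  by rewrite innerBm innerZm tu mulr1 => /eqP; rewrite subr_eq0 => /eqP.
(* The left side is [delta] times the positive Laplacian of the barrier; the right side is
   nonpositive because [cc y0] lies in [0, 1] and tr s >= [cc y0]. *)
have := eigenvalue_estimate L' ccs y0_int psd sc tu eo.
rewrite (laplacian_at_affine L vs delta c e Dy0) (laplacian_atE L vs Dy0 eo).
have [_ lap _] := KP _ Ky0.
have lp : 0 < delta * laplacian g v y0 by rewrite mulr_gt0.
have /andP[_ cc1] := eigenvalue_bounds L Dy0 tu sc.
have cc0 : 0 <= cc y0 by rewrite -sc; exact: s0.
have tr := trace_difference_ge L i0 Dy0 eo (fun w => s0 w Dy0).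
rewrite ei sc in tr.
set N := \sum_k _; have N0 : 0 <= N.
  apply: sumr_ge0 => i _; apply: addr_ge0; apply: positive_definite_ge0.
    by case: (mgd_G L) => _ _ _; apply.
  by case: (mgd_H L) => _ _ _; apply; exact: mgd_map L _ Dy0.
move=> est; have : 0 < - 4 * cc y0 * N - sigma * ((1 - cc y0 ^+ 2) *
    (trace_difference G H phi y0 e - cc y0)) by exact: lt_le_trans est.
rewrite ltNge => /negP; apply.
have h1 : 0 <= cc y0 * N by exact: mulr_ge0.
have h2 : 0 <= sigma * ((1 - cc y0 ^+ 2) * (trace_difference G H phi y0 e - cc y0)).
  apply: mulr_ge0; first exact: ltW (mgd_sigma L).
  by apply: mulr_ge0; rewrite subr_ge0 // exprn_ile1.
by rewrite -mulrA; lra.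
Unshelve. all: by end_near. Qed.

End touching_ball.

(* Otherwise take a degenerate point z nearest to some definite point q near p; the
   ball with diameter from q to z touches the degenerate set only at z. *)
Lemma degenerate_open p : D p -> (forall a b, inner (s_mx G g p) a b = 0) ->
  \forall y \near p, forall a b, inner (s_mx G g y) a b = 0.
Proof.
move=> Dp sp; apply: contrapT => notnear.
have [d d0 dP] : exists2 d : R, 0 < d & forall y : 'rV[R]_m, `|y - p| < d -> D y.
  have := open_near oD Dp (fun y Dy => Dy).
  rewrite (near_shift 0) /= subr0 => /nbhs_norm0P[d d0 dP].
  by exists d => // y yd; have := dP (y - p) yd; rewrite /= subrK.
(* [q] will be within [r] of [p] and the nearest degenerate point within [r] of [q], so the search
   takes place in the ball of radius 2 r, well inside the domain. *)
pose r := d / 3; have r0 : 0 < r by rewrite divr_gt0.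
have inD (t : R) y : 0 <= t -> t < 3 -> esq (y - p) <= (t * r) ^+ 2 -> D y.
  move=> t0 t3 yp; apply: dP; apply: (le_lt_trans (norm_le_esq _ yp)).
    by rewrite mulr_ge0 // ltW.
  by rewrite /r mulrCA gtr_pMr // ltr_pdivrMr // mul1r.
have [q qp nq] : exists2 q, esq (q - p) < r ^+ 2 &
    ~ (forall a b, inner (s_mx G g q) a b = 0).
  apply: contrapT => nex; apply: notnear.
  have e0 : esq (p + - p) < r ^+ 2 by rewrite subrr /esq inner0l exprn_gt0.
  have n1 := cvgr_lt _ (@esq_continuous R m p p) _ e0.
  near=> y; apply: contrapT => ny; apply: nex; exists y => //.
  by near: y; exact: n1.
have Dq : D q by apply: (inD 1); rewrite ?ltr1n // mul1r ltW.
have posq : positive_definite (s_mx G g q).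
  by apply: contrapT => np; apply: nq; apply/(vanishingP Dq).
pose K := [set y : 'rV[R]_m | esq (y + - p) <= (2 * r) ^+ 2
                              /\ ~ positive_definite (s_mx G g y)].
have KD y : K y -> D y by move=> [yp _]; apply: (inD 2); rewrite ?ltr_nat.
have cK : compact K.
  apply: bounded_closed_compact.
    exists (2 * r + `|p|); split; first exact: num_real.
    move=> M rM y [yp _]; apply: ltW; apply: le_lt_trans rM.
    rewrite -{1}(subrK p y); apply: le_trans (ler_normD _ _) _.
    by rewrite lerD2r; apply: (norm_le_esq _ yp); rewrite mulr_ge0 // ltW.
  rewrite -openC openE => y nK; rewrite /interior.
  have [yp|yp] := leP (esq (y + - p)) ((2 * r) ^+ 2).
    have Dy : D y by apply: (inD 2); rewrite ?ltr_nat.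
    have py : positive_definite (s_mx G g y).
      by apply: contrapT => ny; apply: nK; split.
    have n1 := posdef_near (fun i j => s_mx_continuous L Dy) py.
    by near=> y' => -[_]; apply; near: y'; exact: n1.
  have n1 := cvgr_gt _ (@esq_continuous R m p y) _ yp.
  near=> y' => -[]; rewrite leNgt => /negP + _; apply.
  by near: y'; exact: n1.
have Kp : K p.
  split; first by rewrite subrr /esq inner0l sqr_ge0.
  by apply/(vanishingP Dp).
have K0 : K !=set0 by exists p.
have ce : {within K, continuous (fun y => esq (y + - q))}.
  by apply: continuous_subspaceT; exact: esq_continuous.
have [z] := compact_EVT_min K0 cK ce; rewrite inE => Kz zmin.
have Dz := KD _ Kz; have [zp nz] := Kz.
have zq_le y : K y -> esq (z - q) <= esq (y - q) by move=> Ky; apply: zmin; rewrite inE.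
have zq_lt : esq (z - q) < r ^+ 2.
  apply: le_lt_trans (zq_le _ Kp) _.
  by rewrite -opprB /esq innerNl innerNr opprK.
have zq0 : 0 < esq (z - q).
  apply: id_posdef; rewrite subr_eq0; apply/eqP => zq; by apply: nz; rewrite zq.
pose w := 2^-1 *: (z - q); pose q' := 2^-1 *: (z + q).
have zq' : z - q' = w.
  by apply/rowP => i; rewrite /w /q' !mxE; field.
have qq' : q' - q = w.
  by apply/rowP => i; rewrite /w /q' !mxE; field.
have ew : esq w = esq (z - q) / 4 by rewrite /esq /w innerZl innerZr; field.
apply: (@no_touching_ball z q' (esq (z - q) / 4)) => //.
- by rewrite divr_gt0.
- by rewrite zq'.
- by apply/(vanishingP Dz).
move=> y Dy yz yq'; apply: contrapT => ny.
(* At the midpoint q' the law gives |y - q|^2 + |y - z|^2 <= |z - q|^2 on the smaller ball, so a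
   second degenerate point [y] would be strictly closer to [q] than [z]. *)
have par := parallelogram (y - q') w.
have E1 : y - q' + w = y - q by rewrite -qq' addrA subrK.
have E2 : y - q' - w = y - z by rewrite -zq' opprB addrA subrK.
rewrite E1 E2 ew in par.
have yz0 : 0 < esq (y - z) by apply: id_posdef; rewrite subr_eq0.
have yq : esq (y - q) < esq (z - q) by lra.
have yp : esq (y - p) <= (2 * r) ^+ 2.
  (* This bounds |y - p|^2 by 2 |y - q|^2 + 2 |q - p|^2, hence by (2 r)^2, and [y] competes in the
     minimisation that produced [z]. *)
  have := parallelogram (y - q) (q - p); rewrite addrA subrK => h.
  have : 0 <= esq (y - q - (q - p)) := positive_definite_ge0 _ (@id_posdef R m); rewrite exprMn; lra.
by have := zq_le y (conj yp ny); rewrite leNgt yq.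
Unshelve. all: by end_near. Qed.

End hopf.

(** * Manifolds and graphs *)

Section locality.
Context {R : realType} {m n : nat}.
Variable D : set 'rV[R]_m.
Hypothesis oD : open D.

Lemma eq_gamma (A B : 'rV[R]_m -> 'M[R]_m) y u v :
  metric_on D A -> metric_on D B -> D y -> (forall z, D z -> A z = B z) ->
  gamma A y u v = gamma B y u v.
Proof.
move=> mA mB Dy AB; have Ap : positive_definite (A y) by case: mA => _ _ _; apply.
apply: (inner_injl (positive_definite_unit Ap)) => w.
rewrite (gamma_inner mA) // (AB _ Dy) (gamma_inner mB) // /koszul.
by rewrite !(eq_dmx oD Dy _ AB).
Qed.

Lemma eq_metric_on (A B : 'rV[R]_m -> 'M[R]_m) :
  (forall z, D z -> A z = B z) -> metric_on D A -> metric_on D B.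
Proof.
move=> AB [_ As Asym Apos]; split=> //.
- exact: (eq_msmooth oD AB As).
- by move=> z Dz; rewrite -AB //; exact: Asym.
- by move=> z Dz; rewrite -AB //; exact: Apos.
Qed.

(** Both sides of the Koszul formula scale by [k]. This compares the connections of [g] and of the
    pulled-back metric once f is isometric. *)
Lemma gamma_scale (A B : 'rV[R]_m -> 'M[R]_m) (k : R) y u v : k != 0 ->
  metric_on D A -> metric_on D B -> D y -> (forall z, D z -> B z = k *: A z) ->
  gamma B y u v = gamma A y u v.
Proof.
move=> k0 mA mB Dy BA; have Ap : positive_definite (A y) by case: mA => _ _ _; apply.
have As : msmooth D A by case: mA.
apply: (inner_injl (positive_definite_unit Ap)) => w; apply: (mulfI k0).
rewrite -innerZm -(BA _ Dy) (gamma_inner mB) // (gamma_inner mA) //.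
have E a b c : inner (dmx B a y) b c = k * inner (dmx A a y) b c.
  rewrite -(dscal_metric mB a b c Dy) -(dscal_metric mA a b c Dy).
  have is' : smooth D (fun z => inner (A z) b c).
    exact: (smooth_inner oD As (msmooth_cst oD b) (msmooth_cst oD c)).
  have ks : smooth D (fun=> k) by exact: smooth_cst.
  have Ez z : D z -> inner (B z) b c = k * inner (A z) b c.
    by move=> Dz; rewrite BA // innerZm.
  by rewrite (eq_dscal oD Dy a Ez) (dscalM Dy a ks is') dscal_cst mul0r add0r.
by rewrite /koszul !E; ring.
Qed.

Lemma eq_sff (g g' : 'rV[R]_m -> 'M[R]_m) (H : 'rV[R]_n -> 'M[R]_n)
    (psi psi' : 'rV[R]_m -> 'rV[R]_n) y u v :
  metric_on D g -> metric_on D g' -> D y -> (forall z, D z -> g z = g' z) ->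
  (forall z, D z -> psi z = psi' z) ->
  sff g H psi y u v = sff g' H psi' y u v.
Proof.
move=> mg mg' Dy gg pp; rewrite !(sffE _ _ _ _ _ Dy) (eq_gamma _ _ mg mg' Dy gg).
rewrite !covE (pp _ Dy) !(eq_dmx oD Dy _ pp).
by rewrite (eq_dmx oD Dy u (fun z Dz => eq_dmx oD Dz v pp)).
Qed.

Lemma pullbackE (H : 'rV[R]_n -> 'M[R]_n) (psi : 'rV[R]_m -> 'rV[R]_n) y a b :
  msmooth D psi -> D y -> inner (pullback psi H y) a b = pull H psi a b y.
Proof.
move=> psis Dy; have dl := dmx_linear Dy psis.
rewrite /pull {2}(row_sum_delta a) {2}(row_sum_delta b) !(linear_fun_sum dl) innerE.
rewrite inner_suml; apply: eq_bigr => i _; rewrite inner_sumr; apply: eq_bigr => j _.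
rewrite !(linear_funZ dl) innerZl innerZr mxE mulrA.
by rewrite (dmxE psi) (dmxE psi).
Qed.

End locality.

Section product_metric.
Context {R : realType} {m n : nat}.
Variables (UG : set 'rV[R]_m) (G : 'rV[R]_m -> 'M[R]_m).
Variables (UH : set 'rV[R]_n) (H : 'rV[R]_n -> 'M[R]_n).
Hypotheses (mG : metric_on UG G) (mH : metric_on UH H).
Implicit Types (z w a b : 'rV[R]_(m + n)).

Definition prod_mx z : 'M[R]_(m + n) := block_mx (G (lsubmx z)) 0 0 (H (rsubmx z)).
Definition prod_dom : set 'rV[R]_(m + n) := [set z | UG (lsubmx z) /\ UH (rsubmx z)].

Let oG : open UG. Proof. by case: mG. Qed.
Let oH : open UH. Proof. by case: mH. Qed.

Lemma prod_mxE z a b : inner (prod_mx z) a b =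
  inner (G (lsubmx z)) (lsubmx a) (lsubmx b) + inner (H (rsubmx z)) (rsubmx a) (rsubmx b).
Proof.
rewrite /inner /prod_mx -{1}(hsubmxK a) -{1}(hsubmxK b) tr_row_mx mul_row_block.
by rewrite !mulmx0 addr0 add0r mul_row_col mxE.
Qed.

Lemma prod_dom_open : open prod_dom.
Proof.
have -> : prod_dom = (@lsubmx R 1 m n @^-1` UG) `&` (@rsubmx R 1 m n @^-1` UH) by [].
apply: openI; apply: open_comp => // z _.
  by apply: differentiable_continuous; exact: differentiable_lsubmx.
by apply: differentiable_continuous; exact: differentiable_rsubmx.
Qed.

Section projections.
Variable D : set 'rV[R]_(m + n).
Hypothesis oD : open D.

Lemma msmooth_lsubmx : msmooth D (@lsubmx R 1 m n).
Proof.
move=> i j k; rewrite ord1; apply: (eq_Ck oD _ (@Ck_coord R (m + n) D oD k (lshift n j))) => y _.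
by rewrite mxE.
Qed.

Lemma msmooth_rsubmx : msmooth D (@rsubmx R 1 m n).
Proof.
move=> i j k; rewrite ord1; apply: (eq_Ck oD _ (@Ck_coord R (m + n) D oD k (rshift m j))) => y _.
by rewrite mxE.
Qed.

Lemma dmx_lsubmx w z : D z -> dmx (@lsubmx R 1 m n) w z = lsubmx w.
Proof.
move=> Dz; apply/rowP => j; rewrite (dmx_entry Dz _ _ _ msmooth_lsubmx) mxE.
rewrite -(derive_coord (lshift n j) w z) dscalE; congr ('D_w _ z).
by apply/funext => y; rewrite mxE.
Qed.

Lemma dmx_rsubmx w z : D z -> dmx (@rsubmx R 1 m n) w z = rsubmx w.
Proof.
move=> Dz; apply/rowP => j; rewrite (dmx_entry Dz _ _ _ msmooth_rsubmx) mxE.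
rewrite -(derive_coord (rshift m j) w z) dscalE; congr ('D_w _ z).
by apply/funext => y; rewrite mxE.
Qed.

End projections.

Let Gl : msmooth prod_dom (fun z => G (lsubmx z)).
Proof.
have lU y : prod_dom y -> UG (lsubmx y) by case.
have Gs : msmooth UG G by case: mG.
exact: (msmooth_comp prod_dom_open (msmooth_lsubmx prod_dom_open) lU Gs).
Qed.

Let Hr : msmooth prod_dom (fun z => H (rsubmx z)).
Proof.
have rU y : prod_dom y -> UH (rsubmx y) by case.
have Hs : msmooth UH H by case: mH.
exact: (msmooth_comp prod_dom_open (msmooth_rsubmx prod_dom_open) rU Hs).
Qed.

Lemma prod_metric : metric_on prod_dom prod_mx.
Proof.
split; first exact: prod_dom_open.
- move=> i j k; case: (split_ordP i) => i' ->; case: (split_ordP j) => j' ->.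
  + by apply: (eq_Ck prod_dom_open _ (Gl i' j' k)) => z _; rewrite block_mxEul.
  + by apply: (eq_Ck prod_dom_open _ (Ck_cst prod_dom_open k 0)) => z _; rewrite block_mxEur mxE.
  + by apply: (eq_Ck prod_dom_open _ (Ck_cst prod_dom_open k 0)) => z _; rewrite block_mxEdl mxE.
  + by apply: (eq_Ck prod_dom_open _ (Hr i' j' k)) => z _; rewrite block_mxEdr.
- move=> z [Uz Uz']; rewrite /symmetric_matrix /prod_mx tr_block_mx !trmx0.
  by case: mG => _ _ -> // _; case: mH => _ _ -> // _.
- move=> z [Uz Uz'] u u0; rewrite prod_mxE.
  have Gp : positive_definite (G (lsubmx z)) by case: mG => _ _ _; apply.
  have Hp : positive_definite (H (rsubmx z)) by case: mH => _ _ _; apply.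
  have [l0|l0] := eqVneq (lsubmx u) 0; last first.
    by apply: ltr_pwDl; [exact: Gp|exact: positive_definite_ge0].
  rewrite l0 inner0l add0r; apply: Hp; apply: contra u0 => /eqP r0.
  by rewrite -(hsubmxK u) l0 r0 row_mx0.
Qed.

Lemma dmx_prod_mx w z a b : prod_dom z -> inner (dmx prod_mx w z) a b =
  inner (dmx G (lsubmx w) (lsubmx z)) (lsubmx a) (lsubmx b)
  + inner (dmx H (rsubmx w) (rsubmx z)) (rsubmx a) (rsubmx b).
Proof.
move=> Dz; have oP := prod_dom_open; have cs k A := @msmooth_cst R (m + n) prod_dom oP 1 k A.
rewrite -(dscal_metric prod_metric _ _ _ Dz) (eq_dscal oP Dz w (fun y _ => prod_mxE y a b)).
have Gs : msmooth UG G by case: mG. have Hs : msmooth UH H by case: mH.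
rewrite (dscalD Dz w (smooth_inner oP Gl (cs _ _) (cs _ _)) (smooth_inner oP Hr (cs _ _) (cs _ _))).
rewrite (dscal_inner oP Dz w Gl (cs _ _) (cs _ _)) (dscal_inner oP Dz w Hr (cs _ _) (cs _ _)).
rewrite !dmx_cst !inner0l !inner0r !addr0.
have lU y : prod_dom y -> UG (lsubmx y) by case.
have rU y : prod_dom y -> UH (rsubmx y) by case.
rewrite (dmx_comp oP Dz w (msmooth_lsubmx oP) lU Gs) (dmx_lsubmx oP _ Dz).
by rewrite (dmx_comp oP Dz w (msmooth_rsubmx oP) rU Hs) (dmx_rsubmx oP _ Dz).
Qed.

Lemma gamma_prod z u v : prod_dom z -> gamma prod_mx z u v =
  row_mx (gamma G (lsubmx z) (lsubmx u) (lsubmx v)) (gamma H (rsubmx z) (rsubmx u) (rsubmx v)).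
Proof.
move=> Dz; have Pp : positive_definite (prod_mx z) by case: prod_metric => _ _ _; apply.
apply: (inner_injl (positive_definite_unit Pp)) => w.
rewrite (gamma_inner prod_metric) // prod_mxE row_mxKl row_mxKr.
case: (Dz) => Uz Uz'; rewrite (gamma_inner mG) // (gamma_inner mH) //.
by rewrite /koszul !dmx_prod_mx //; ring.
Qed.

Section map_to_product.
Variables (d : nat) (D : set 'rV[R]_d) (g : 'rV[R]_d -> 'M[R]_d).
Variables (tau : 'rV[R]_d -> 'rV[R]_m) (phi : 'rV[R]_d -> 'rV[R]_n).
Hypotheses (oD : open D) (taus : msmooth D tau) (phis : msmooth D phi).
Hypotheses (tauU : forall y, D y -> UG (tau y)) (phiU : forall y, D y -> UH (phi y)).

Lemma msmooth_row_mx (X : 'rV[R]_d -> 'rV[R]_m) (Y : 'rV[R]_d -> 'rV[R]_n) :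
  msmooth D X -> msmooth D Y -> msmooth D (fun y => row_mx (X y) (Y y)).
Proof.
move=> Xs Ys i j k; case: (split_ordP j) => j' ->.
  by apply: (eq_Ck oD _ (Xs i j' k)) => y _; rewrite row_mxEl.
by apply: (eq_Ck oD _ (Ys i j' k)) => y _; rewrite row_mxEr.
Qed.

Lemma dmx_row_mx (X : 'rV[R]_d -> 'rV[R]_m) (Y : 'rV[R]_d -> 'rV[R]_n) u y :
  D y -> msmooth D X -> msmooth D Y ->
  dmx (fun y => row_mx (X y) (Y y)) u y = row_mx (dmx X u y) (dmx Y u y).
Proof.
move=> Dy Xs Ys; apply/rowP => j; rewrite (dmx_entry Dy _ _ _ (msmooth_row_mx Xs Ys)).
case: (split_ordP j) => j' ->.
  rewrite row_mxEl (dmx_entry Dy _ _ _ Xs); apply: (eq_dscal oD Dy) => z _.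
  by rewrite row_mxEl.
rewrite row_mxEr (dmx_entry Dy _ _ _ Ys); apply: (eq_dscal oD Dy) => z _.
by rewrite row_mxEr.
Qed.

Lemma pull_prod (a b y : 'rV[R]_d) : D y ->
  pull prod_mx (fun y => row_mx (tau y) (phi y)) a b y = pull G tau a b y + pull H phi a b y.
Proof.
move=> Dy; rewrite /pull !(dmx_row_mx _ Dy taus phis) prod_mxE.
by rewrite !row_mxKl !row_mxKr.
Qed.

Lemma sff_prod u v y : D y ->
  sff g prod_mx (fun y => row_mx (tau y) (phi y)) y u v =
  row_mx (sff g G tau y u v) (sff g H phi y u v).
Proof.
move=> Dy; rewrite !(sffE _ _ _ _ _ Dy) !covE !(dmx_row_mx _ Dy taus phis).
rewrite (eq_dmx oD Dy u (fun t Dt => dmx_row_mx v Dt taus phis)).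
rewrite (dmx_row_mx _ Dy (msmooth_dmx oD v taus) (msmooth_dmx oD v phis)).
rewrite gamma_prod; last by split; rewrite ?row_mxKl ?row_mxKr; [exact: tauU|exact: phiU].
by rewrite !row_mxKl !row_mxKr opp_row_mx !add_row_mx.
Qed.

End map_to_product.
End product_metric.

Lemma inner_mx_inj (R : realType) m (A B : 'M[R]_m) :
  (forall u v, inner A u v = inner B u v) -> A = B.
Proof. by move=> AB; apply/matrixP => i j; rewrite -!inner_delta AB. Qed.

Section manifold_charts.
Context {R : realType} {m : nat}.
Variable M : metric_atlas R m.
Hypothesis hM : riemannian_manifold M.
Implicit Types (a b : chart_index M) (x : M).

Lemma chart_dom_open a : open (chart_dom a).
Proof. by case: hM => -[_ _ _ /(_ a)[]]. Qed.

Lemma chart_image_open a : open (chart a @` chart_dom a).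
Proof. by case: hM => -[_ _ _ /(_ a)[]]. Qed.

Lemma chart_invK a x : chart_dom a x -> chart_inv a (chart a x) = x.
Proof. by case: hM => -[_ _ _ /(_ a)[_ _ + _ _]] _ _; apply. Qed.

Lemma chart_continuous a x : chart_dom a x -> {for x, continuous (@chart R m M a)}.
Proof. by case: hM => -[_ _ _ /(_ a)[_ _ _ + _]] _ _; apply. Qed.

Lemma chart_inv_continuous a x : chart_dom a x ->
  {for chart a x, continuous (@chart_inv R m M a)}.
Proof. by case: hM => -[_ _ _ /(_ a)[_ _ _ _ +]] _ _; apply. Qed.

Lemma chart_exists x : exists a, chart_dom a x.
Proof. by case: hM => -[_ _ + _ _] _; apply. Qed.

Lemma open_chart_image a (W : set M) : open W -> open (chart a @` (chart_dom a `&` W)).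
Proof.
move=> oW; rewrite openE => y [x [ax Wx] <-]; rewrite /interior.
have cx : (chart a @` chart_dom a) (chart a x) by exists x.
have n1 := open_near (@chart_image_open a) cx (fun y h => h).
have Wx' : W (chart_inv a (chart a x)) by rewrite chart_invK.
have n2 : \forall z \near chart a x, W (chart_inv a z).
  by apply: (chart_inv_continuous ax); apply: open_nbhs_nbhs.
near=> z.
have [x' ax' xz] : (chart a @` chart_dom a) z by near: z; exact: n1.
have Wz : W (chart_inv a z) by near: z; exact: n2.
by exists x' => //; split=> //; move: Wz; rewrite -xz chart_invK.
Unshelve. all: by end_near. Qed.

Lemma metric_on_chart a : metric_on (chart a @` chart_dom a) (@metric R m M a).
Proof.
have [_ [ms mp _]] := hM; split; first exact: chart_image_open.
- exact: (smooth_on_msmooth (@chart_image_open a) (ms a)).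
- by move=> _ [x ax <-]; have [] := mp a x ax.
- by move=> _ [x ax <-]; have [] := mp a x ax.
Qed.

Definition overlap a b : set 'rV[R]_m := chart a @` (chart_dom a `&` chart_dom b).

Lemma overlap_open a b : open (overlap a b).
Proof. by apply: open_chart_image; exact: chart_dom_open. Qed.

Lemma transitionE a b x : chart_dom a x -> in_charts (@id M) a b (chart a x) = chart b x.
Proof. by move=> ax; rewrite /in_charts /= chart_invK. Qed.

Lemma transition_msmooth a b : msmooth (overlap a b) (in_charts (@id M) a b).
Proof.
apply: (smooth_on_msmooth (@overlap_open a b)).
by case: hM => -[_ _ _ _ +] _; apply.
Qed.

Lemma transition_metric a b x u v : chart_dom a x -> chart_dom b x ->
  inner (metric a (chart a x)) u v =
  pull (@metric R m M b) (in_charts (@id M) a b) u v (chart a x).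
Proof.
move=> ax bx; have [_ [_ _ law]] := hM; rewrite (law a b x ax bx).
by apply: pullbackE; [exact: transition_msmooth|exists x].
Qed.

Lemma transition_self a y : (chart a @` chart_dom a) y -> in_charts (@id M) a a y = y.
Proof. by move=> [x ax <-]; rewrite transitionE. Qed.

End manifold_charts.

Section maps_in_charts.
Context {R : realType} {m n : nat}.
Variables (M : metric_atlas R m) (N : metric_atlas R n) (f : M -> N).
Hypotheses (hM : riemannian_manifold M) (hN : riemannian_manifold N).
Hypothesis f_smooth : smooth_map f.
Implicit Types (a : chart_index M) (b : chart_index N) (x : M).

Definition map_dom a b : set 'rV[R]_m :=
  chart a @` (chart_dom a `&` f @^-1` chart_dom b).

Let preim_open b : open (f @^-1` chart_dom b).
Proof.
apply: open_comp; last exact: (chart_dom_open hN).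
by move=> x _; case: f_smooth => + _; apply.
Qed.

Lemma map_dom_open a b : open (map_dom a b).
Proof. by apply: (open_chart_image hM); exact: preim_open. Qed.

Lemma map_msmooth a b : msmooth (map_dom a b) (in_charts f a b).
Proof.
apply: (smooth_on_msmooth (@map_dom_open a b)).
by case: f_smooth => _; apply.
Qed.

Lemma map_inE a b x : chart_dom a x -> in_charts f a b (chart a x) = chart b (f x).
Proof. by move=> ax; rewrite /in_charts /= (chart_invK hM). Qed.

Lemma map_dom_range a b y : map_dom a b y -> (chart b @` chart_dom b) (in_charts f a b y).
Proof. by move=> [x [ax bx] <-]; rewrite map_inE //; exists (f x). Qed.

Lemma map_dom_near a b x : chart_dom a x -> chart_dom b (f x) ->
  \forall z \near x, chart_dom a z /\ chart_dom b (f z).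
Proof.
move=> ax bx; apply: (open_nbhs_nbhs (A := chart_dom a `&` f @^-1` chart_dom b)).
by split=> //; apply: openI; [exact: (chart_dom_open hM)|exact: preim_open].
Qed.

Lemma map_dom_sub a b : map_dom a b `<=` chart a @` chart_dom a.
Proof. by move=> y [x [ax _] <-]; exists x. Qed.

Lemma pullback_metricE a b y u v : map_dom a b y ->
  inner (pullback_metric f a b y) u v = pull (@metric R n N b) (in_charts f a b) u v y.
Proof. by move=> Dy; exact: (pullbackE _ _ _ (@map_msmooth a b) Dy). Qed.

Lemma graph_metricE a b y u v : map_dom a b y ->
  inner (graph_metric f a b y) u v =
  inner (metric a y) u v + pull (@metric R n N b) (in_charts f a b) u v y.
Proof. by move=> Dy; rewrite innerDm pullback_metricE. Qed.

Lemma metric_on_map_dom a b : metric_on (map_dom a b) (@metric R m M a).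
Proof.
exact: metric_on_subset (@map_dom_open a b) (@map_dom_sub a b) (metric_on_chart hM a).
Qed.

Lemma graph_metric_on a b : metric_on (map_dom a b) (graph_metric f a b).
Proof.
have oD := @map_dom_open a b; have mD := metric_on_map_dom a b.
have mN := metric_on_chart hN b; have ps := map_msmooth a b.
have sp := @smooth_pull _ _ _ _ _ mN _ _ _ mD ps (@map_dom_range a b).
have Gs : msmooth (map_dom a b) (@metric R m M a) by case: mD.
split=> //.
- move=> i j k; apply: (eq_Ck oD _ (CkD oD (Gs i j k) (sp (delta_mx 0 i) (delta_mx 0 j) k))).
  by move=> y Dy; rewrite -[RHS]inner_delta graph_metricE // inner_delta.
- move=> y Dy; apply: inner_mx_inj => u v.
  have -> : inner (graph_metric f a b y)^T u v = inner (graph_metric f a b y) v u.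
    by rewrite /inner -[in RHS](trmxK (_ *m _)) [RHS]mxE !trmx_mul trmxK mulmxA.
  rewrite !graph_metricE //; congr (_ + _).
    by apply: innerC; case: mD => _ _ + _; apply.
  by apply: innerC; case: mN => _ _ + _; apply; exact: map_dom_range.
- move=> y Dy u u0; rewrite graph_metricE //; apply: ltr_pwDl.
    by case: mD => _ _ _; apply.
  by apply: positive_definite_ge0; case: mN => _ _ _; apply; exact: map_dom_range.
Qed.

Section three_charts.
Variables (a a' : chart_index M) (b : chart_index N).

Let F := in_charts (M := M) (N := product M N) (graph f) a (a', b).
Let g := graph_metric f a b.
Let tau := in_charts (@id M) a a'.
Let phi := in_charts f a b.
Let HP := prod_mx (@metric R m M a') (@metric R n N b).

(** Three charts, because a chart of the product may use on its factor M another chart than the one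
    on the source. *)
Definition graph_dom : set 'rV[R]_m :=
  chart a @` (chart_dom a `&` (chart_dom a' `&` f @^-1` chart_dom b)).

Lemma graph_dom_open : open graph_dom.
Proof.
by apply: (open_chart_image hM); apply: openI; [exact: (chart_dom_open hM)|exact: preim_open].
Qed.

Lemma graph_dom_map : graph_dom `<=` map_dom a b.
Proof. by move=> y [x [ax [_ bx]] <-]; exists x. Qed.

Lemma graph_dom_overlap : graph_dom `<=` overlap a a'.
Proof. by move=> y [x [ax [ax' _]] <-]; exists x. Qed.

Let oD := graph_dom_open.
Let taus : msmooth graph_dom tau.
Proof.
by move=> i j; apply: smooth_subset graph_dom_overlap _; exact: (transition_msmooth hM).
Qed.
Let phis : msmooth graph_dom phi.
Proof. by move=> i j; apply: smooth_subset graph_dom_map _; exact: map_msmooth. Qed.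
Let tauU y : graph_dom y -> (chart a' @` chart_dom a') (tau y).
Proof. by move=> [x [ax [ax' bx]] <-]; rewrite /tau (transitionE hM) //; exists x. Qed.
Let phiU y : graph_dom y -> (chart b @` chart_dom b) (phi y).
Proof. by move=> /graph_dom_map; exact: map_dom_range. Qed.
Let gD : metric_on graph_dom g.
Proof. exact: metric_on_subset graph_dom_open graph_dom_map (graph_metric_on a b). Qed.
Let mG := metric_on_chart hM a'.
Let mH := metric_on_chart hN b.
Let FE : F = fun y => row_mx (tau y) (phi y). Proof. by []. Qed.
Let Fs : msmooth graph_dom F. Proof. by rewrite FE; exact: msmooth_row_mx. Qed.

Lemma graph_pullback_metric y : graph_dom y ->
  pullback_metric (N := product M N) (graph f) a (a', b) y = g y.
Proof.
move=> Dy; apply: inner_mx_inj => u v.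
have -> : inner (pullback_metric (N := product M N) (graph f) a (a', b) y) u v
    = pull HP F u v y by exact: (pullbackE _ _ _ Fs Dy).
rewrite FE (pull_prod _ _ oD taus phis) // graph_metricE; last exact: graph_dom_map.
by congr (_ + _); case: Dy => x [ax [ax' bx]] <-; rewrite -(transition_metric hM).
Qed.

(** The first component of the graph is the transition map from [a] to [a'], so the second
    fundamental form splits along the product metric. *)
Lemma second_form_graph y u v : graph_dom y ->
  second_form (P := product M N) (graph f) a (a', b) y u v =
  row_mx (sff g (@metric R m M a') tau y u v) (sff g (@metric R n N b) phi y u v).
Proof.
move=> Dy; rewrite -(sff_prod mG mH g oD taus phis tauU phiU u v Dy).
transitivity (sff (pullback_metric (N := product M N) (graph f) a (a', b)) HP F y u v).
  by rewrite sff.unlock.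
apply: (eq_sff oD _ _ _ _ gD Dy graph_pullback_metric) => //.
by apply: (eq_metric_on oD _ gD) => z Dz; rewrite graph_pullback_metric.
Qed.

Lemma second_form_graph_linear y : graph_dom y ->
  (forall u, linear (second_form (P := product M N) (graph f) a (a', b) y u)) /\
  (forall u, linear ((second_form (P := product M N) (graph f) a (a', b) y)^~ u)).
Proof.
move=> Dy; have FU z : graph_dom z ->
    prod_dom (chart a' @` chart_dom a') (chart b @` chart_dom b) (F z).
  by move=> Dz; rewrite FE; split; rewrite /= ?row_mxKl ?row_mxKr; [exact: tauU|exact: phiU].
have E u v : second_form (P := product M N) (graph f) a (a', b) y u v = sff g HP F y u v.
  by rewrite second_form_graph // (sff_prod mG mH g oD taus phis tauU phiU).
have mP := prod_metric mG mH.
split=> u k v w; rewrite !E.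
  exact: (sff_linearr mP gD Fs FU).
exact: (sff_linearl mP gD Fs FU).
Qed.

End three_charts.
End maps_in_charts.

(** * Sectional curvature bounds in Gram form *)

Section sectional_curvature.
Context {R : realType} {m : nat}.
Implicit Types (u v a b z : 'rV[R]_m).

Definition gram (G : 'M[R]_m) u v : R := inner G u u * inner G v v - inner G u v ^+ 2.

Lemma dependentP u v : ~ independent u v -> u = 0 \/ exists k, v = k *: u.
Proof.
move=> /negP; rewrite -kermx_eq0 => /rowV0Pn[w /sub_kermxP].
rewrite -{1 2}(hsubmxK w) mul_row_col (mx11_scalar (lsubmx w)) (mx11_scalar (rsubmx w)).
rewrite !mul_scalar_mx; set s := lsubmx w _ _; set t := rsubmx w _ _ => st w0.
have [t0|t0] := eqVneq t 0.
  left; apply/eqP; move: st; rewrite t0 scale0r addr0 => /eqP.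
  rewrite scaler_eq0 => /orP[/eqP s0|//]; move: w0.
  by rewrite s0 t0 raddf0 row_mx0 eqxx.
right; exists (- (t^-1 * s)); rewrite scaleNr -scalerA.
move/eqP: st; rewrite addrC addr_eq0 => /eqP st.
by rewrite -scalerN -st scalerA mulVf // scale1r.
Qed.

Lemma independent_free u v (s t : R) : independent u v -> s *: u + t *: v = 0 -> s = 0 /\ t = 0.
Proof.
move=> uv st; have : row_mx s%:M t%:M *m col_mx u v == 0.
  by rewrite mul_row_col !mul_scalar_mx st.
rewrite mulmx_free_eq0 // => /eqP E.
have := congr1 (fun A : 'M[R]_(1, 1 + 1) => (lsubmx A ord0 ord0, rsubmx A ord0 ord0)) E.
by rewrite row_mxKl row_mxKr !mxE eqxx !mulr1n => -[].
Qed.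

Variables (U : set 'rV[R]_m) (G : 'rV[R]_m -> 'M[R]_m).
Hypothesis mG : metric_on U G.
Variable z : 'rV[R]_m.
Hypothesis Uz : U z.

Let Gsym : symmetric_matrix (G z). Proof. by case: mG => _ _ + _; apply. Qed.
Let Gpos : positive_definite (G z). Proof. by case: mG => _ _ _; apply. Qed.

Lemma gram_gt0 u v : independent u v -> 0 < gram (G z) u v.
Proof.
move=> uv; have u0 : u != 0.
  apply/eqP => u0; have [] := @independent_free u v 1 0 uv.
    by rewrite u0 scaler0 scale0r addr0.
  by move=> /eqP; rewrite oner_eq0.
have uu := Gpos u0; pose t := inner (G z) u v / inner (G z) u u.
have w0 : v - t *: u != 0.
  apply/eqP => w0; have [] := @independent_free u v (- t) 1 uv.
    by rewrite scale1r scaleNr addrC.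
  by move=> _ /eqP; rewrite oner_eq0.
have := Gpos w0; rewrite !innerBl !innerBr !innerZl !innerZr (innerC v u Gsym).
have -> : inner (G z) v v - t * inner (G z) u v - (t * inner (G z) u v - t * (t * inner (G z) u u))
    = gram (G z) u v / inner (G z) u u.
  by rewrite /gram /t; field; rewrite gt_eqF.
by move=> h; have := mulr_gt0 h uu; rewrite divfK // gt_eqF.
Qed.

Lemma sectionalE u v : sectional G z u v =
  - inner (G z) (riemann G z u v u) v / gram (G z) u v.
Proof.
rewrite /sectional -/(gram _ u v); congr (_ / _).
have -> : curvature G z u v v = riemann G z u v v by rewrite riemann.unlock.
by rewrite (riemann_skew mG) // (innerC _ _ Gsym).
Qed.

Lemma riemann_self a b : riemann G z a a b = 0.
Proof.
have := riemannN G a a b Uz => /eqP; rewrite -addr_eq0 -mulr2n -scaler_nat scaler_eq0.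
by rewrite pnatr_eq0 /= => /eqP.
Qed.

Lemma riemann_dependent u v : ~ independent u v ->
  inner (G z) (riemann G z u v u) v = 0 /\ gram (G z) u v = 0.
Proof.
move=> /dependentP[->|[k ->]].
  have := riemannZ mG 0 0 v 0 Uz; rewrite scale0r scale0r => ->.
  by rewrite /gram !inner0l mul0r expr0n subr0.
rewrite (riemannN _ _ _ _ Uz) (riemannZ mG) // riemann_self scaler0 oppr0 inner0l /gram.
by rewrite !innerZr !innerZl; split=> //; ring.
Qed.

(** Multiplying by the Gram determinant extends the bound to dependent pairs, for which both sides
    vanish. The sign reverses because R(a, b) a is paired with b instead of R(a, b) b with a. *)
Lemma riemann_le sigma : (forall u v, independent u v -> sigma <= sectional G z u v) ->
  forall a b, inner (G z) (riemann G z a b a) b <= - sigma * gram (G z) a b.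
Proof.
move=> sec a b; have [ab|ab] := pselect (independent a b); last first.
  by have [-> ->] := riemann_dependent ab; rewrite mulr0.
have := sec a b ab; rewrite sectionalE ler_pdivlMr ?gram_gt0 // => h.
by rewrite mulNr lerNr.
Qed.

Lemma riemann_ge sigma : (forall u v, independent u v -> sectional G z u v <= sigma) ->
  forall a b, - sigma * gram (G z) a b <= inner (G z) (riemann G z a b a) b.
Proof.
move=> sec a b; have [ab|ab] := pselect (independent a b); last first.
  by have [-> ->] := riemann_dependent ab; rewrite mulr0.
have := sec a b ab; rewrite sectionalE ler_pdivrMr ?gram_gt0 // => h.
by rewrite mulNr lerNl.
Qed.

Lemma sectional_eq sigma u v : independent u v ->
  inner (G z) (riemann G z u v u) v = - sigma * gram (G z) u v -> sectional G z u v = sigma.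
Proof.
move=> uv E; rewrite sectionalE E mulNr opprK mulfK // gt_eqF //; exact: gram_gt0.
Qed.

Lemma riemann_homogeneous (k l : R) u v :
  inner (G z) (riemann G z (k *: u) (l *: v) (k *: u)) (l *: v) =
  k ^+ 2 * l ^+ 2 * inner (G z) (riemann G z u v u) v.
Proof.
have Z1 a b w (t : R) : riemann G z (t *: a) b w = t *: riemann G z a b w.
  exact: (riemannZ mG).
have Z2 a b w (t : R) : riemann G z a (t *: b) w = t *: riemann G z a b w.
  by rewrite (riemannN _ _ _ _ Uz) Z1 -scalerN -(riemannN _ _ _ _ Uz).
rewrite Z1 Z2 !innerZl innerZr (riemann_skew mG u v (k *: u) v Uz).
rewrite innerZl (riemann_skew mG u v u v Uz); ring.
Qed.

Lemma gram_homogeneous (k l : R) u v :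
  gram (G z) (k *: u) (l *: v) = k ^+ 2 * l ^+ 2 * gram (G z) u v.
Proof. by rewrite /gram !innerZl !innerZr; ring. Qed.

End sectional_curvature.

(** * Independence of charts, and the data of a minimal map in charts *)

Section chart_change.
Context {R : realType} {m n : nat}.
Variables (M : metric_atlas R m) (N : metric_atlas R n) (f : M -> N).
Hypotheses (hM : riemannian_manifold M) (hN : riemannian_manifold N).
Hypothesis f_smooth : smooth_map f.

Definition chart_form a b (c : R) (x : M) : 'M[R]_m :=
  s_mx (@metric R m M a) (graph_metric f a b) (chart a x)
  - c *: graph_metric f a b (chart a x).

Lemma chart_formE a b c x u v : chart_dom a x -> chart_dom b (f x) ->
  inner (chart_form a b c x) u v = (1 - c) * inner (metric a (chart a x)) u v
    - (1 + c) * pull (@metric R n N b) (in_charts f a b) u v (chart a x).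
Proof.
move=> ax bx; have Dx : map_dom f a b (chart a x) by exists x.
rewrite /chart_form /s_mx !innerBm !innerZm (graph_metricE hM hN f_smooth) //; ring.
Qed.

Variables (a a' : chart_index M) (b b' : chart_index N) (x : M).
Hypotheses (ax : chart_dom a x) (ax' : chart_dom a' x).
Hypotheses (bx : chart_dom b (f x)) (bx' : chart_dom b' (f x)).

Let J u := dmx (in_charts (@id M) a a') u (chart a x).

(** f in the charts (a, b) is f in (a', b') composed with transition maps on both sides; the
    transformation law of the metric of N absorbs the outer one, and the inner one becomes [J]. *)
Lemma pull_chart_change u v :
  pull (@metric R n N b) (in_charts f a b) u v (chart a x) =
  pull (@metric R n N b') (in_charts f a' b') (J u) (J v) (chart a' x).
Proof.
pose t := in_charts (@id M) a a'; pose phi' := in_charts f a' b'.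
pose tN := in_charts (@id N) b' b.
pose W := chart a @` (chart_dom a `&` (chart_dom a' `&` (f @^-1` (chart_dom b `&` chart_dom b')))).
have cf : continuous f by case: f_smooth.
have oW : open W.
  apply: (open_chart_image hM); apply: openI; first exact: (chart_dom_open hM).
  apply: open_comp; first by move=> w _; exact: cf.
  by apply: openI; exact: (chart_dom_open hN).
have Wx : W (chart a x) by exists x.
have ts : msmooth W t.
  move=> i j; apply: smooth_subset _ (transition_msmooth hM a a' i j).
  by move=> y [w [aw [aw' _]] <-]; exists w.
have tW y : W y -> map_dom f a' b' (t y).
  by move=> [w [aw [aw' [bw bw']]] <-]; rewrite /t (transitionE hM) //; exists w.
have phi's : msmooth (map_dom f a' b') phi' by exact: (map_msmooth hM hN f_smooth).
have hs := msmooth_comp oW ts tW phi's.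
have hW y : W y -> overlap b' b (phi' (t y)).
  move=> [w [aw [aw' [bw bw']]] <-]; rewrite /t (transitionE hM) // /phi' (map_inE _ hM) //.
  by exists (f w).
have tNs := transition_msmooth hN b' b.
have E y : W y -> in_charts f a b y = tN (phi' (t y)).
  move=> [w [aw [aw' [bw bw']]] <-]; rewrite (map_inE _ hM) // /t (transitionE hM) //.
  by rewrite /phi' (map_inE _ hM) // /tN (transitionE hN).
have D w : dmx (in_charts f a b) w (chart a x) =
    dmx tN (dmx phi' (J w) (chart a' x)) (chart b' (f x)).
  rewrite (eq_dmx oW Wx w E) (dmx_comp oW Wx w hs hW tNs) (dmx_comp oW Wx w ts tW phi's).
  by rewrite /t (transitionE hM) // /phi' (map_inE _ hM).
rewrite /pull (D u) (D v) (map_inE _ hM) // -(transitionE hN b bx').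
rewrite -/(pull (@metric R n N b) tN _ _ (chart b' (f x))).
by rewrite -(transition_metric hN) // (map_inE _ hM).
Qed.

Lemma chart_form_change c u v :
  inner (chart_form a b c x) u v = inner (chart_form a' b' c x) (J u) (J v).
Proof.
apply: (etrans (chart_formE c u v ax bx)).
apply: (etrans _ (esym (chart_formE c (J u) (J v) ax' bx'))).
rewrite (pull_chart_change u v); congr (_ * _ - _).
have := transition_metric hM u v ax ax'.
by rewrite /pull (transitionE hM a' ax).
Qed.

Lemma chart_change_inj u : u != 0 -> J u != 0.
Proof.
move=> u0; apply/eqP => Ju.
have [_ [_ mp _]] := hM; have [_ /(_ u u0)] := mp a x ax.
rewrite (transition_metric hM u u ax ax') /pull -/(J u) Ju inner0l ltxx //.
Qed.

Lemma chart_form_posdef c : positive_definite (chart_form a' b' c x) ->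
  positive_definite (chart_form a b c x).
Proof. by move=> pos u u0; rewrite chart_form_change; apply: pos; exact: chart_change_inj. Qed.

End chart_change.

Section local_data.
Context {R : realType} {m n : nat}.
Variables (M : metric_atlas R m) (N : metric_atlas R n) (f : M -> N) (sigma : R).
Hypotheses (hM : riemannian_manifold M) (hN : riemannian_manifold N).
Hypotheses (f_smooth : smooth_map f) (f_minimal : minimal_map f).
Hypotheses (m0 : (0 < m)%N) (sigma_gt0 : 0 < sigma).
Hypothesis sec_N_le : all_sectional N (fun K => K <= sigma).
Hypothesis sec_M_ge : all_sectional M (fun K => sigma <= K).
Variables (a : chart_index M) (b : chart_index N).

Lemma frame_exists y : map_dom f a b y ->
  exists e : 'I_m -> 'rV[R]_m, orthonormal_frame (graph_metric f a b y) e.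
Proof.
move=> Dy; have mg := graph_metric_on hM hN f_smooth a b.
have gsym : symmetric_matrix (graph_metric f a b y) by case: mg => _ _ + _; apply.
have gpos : positive_definite (graph_metric f a b y) by case: mg => _ _ _; apply.
have [k _ ku] := normalize gpos (delta_neq0 (Ordinal m0)).
have [e eo _] := orthonormal_frame_exists gsym gpos (i0 := Ordinal m0) ku erefl.
by exists e.
Qed.

Lemma graph_dom_self y : map_dom f a b y -> graph_dom f a a b y.
Proof. by move=> [x [ax bx] <-]; exists x. Qed.

Lemma sff_transition_self y u v : map_dom f a b y ->
  sff (graph_metric f a b) (@metric R m M a) (in_charts (@id M) a a) y u v =
  sff (graph_metric f a b) (@metric R m M a) id y u v.
Proof.
move=> Dy; have mg := graph_metric_on hM hN f_smooth a b.
apply: (eq_sff (@map_dom_open _ _ _ _ _ _ hM hN f_smooth a b) _ _ _ mg mg Dy) => // z Dz.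
by apply: (transition_self hM); exact: map_dom_sub Dz.
Qed.

(** The mean curvature vector of the graph lies in a product, and its two components are the tension
    fields of id and f. *)
Lemma graph_tension y e : map_dom f a b y -> orthonormal_frame (graph_metric f a b y) e ->
  \sum_k sff (graph_metric f a b) (@metric R m M a) id y (e k) (e k) = 0 /\
  \sum_k sff (graph_metric f a b) (@metric R n N b) (in_charts f a b) y (e k) (e k) = 0.
Proof.
move=> Dy eo; have Gy := graph_dom_self Dy.
have : \sum_(k < m) second_form (P := product M N) (graph f) a (a, b) y (e k) (e k) = 0.
  have [x [ax bx] xy] := Dy; rewrite -xy; apply: (f_minimal (c := (a, b))) => //.
  by rewrite xy (graph_pullback_metric hM hN f_smooth).
move=> E; split.
  have := congr1 lsubmx E; rewrite raddf_sum raddf0 => {}E; apply: etrans E.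
  apply: eq_bigr => k _; rewrite (second_form_graph hM hN f_smooth _ _ Gy) /= row_mxKl.
  by rewrite sff_transition_self.
have := congr1 rsubmx E; rewrite raddf_sum raddf0 => {}E; apply: etrans E.
by apply: eq_bigr => k _; rewrite (second_form_graph hM hN f_smooth _ _ Gy) /= row_mxKr.
Qed.

Lemma minimal_data : minimal_graph_data (map_dom f a b) (chart b @` chart_dom b)
  (@metric R m M a) (graph_metric f a b) (@metric R n N b) (in_charts f a b) sigma.
Proof.
have oD := @map_dom_open _ _ _ _ _ _ hM hN f_smooth a b.
have mG := metric_on_map_dom hM hN f_smooth a b.
have mg := graph_metric_on hM hN f_smooth a b.
have mH := metric_on_chart hN b.
have phis : msmooth (map_dom f a b) (in_charts f a b) by exact: (map_msmooth hM hN f_smooth).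
have phiU y : map_dom f a b y -> (chart b @` chart_dom b) (in_charts f a b y).
  exact: (map_dom_range hM).
have ids : msmooth (map_dom f a b) id by exact: msmooth_id.
split=> //.
- by move=> y Dy u v; exact: (graph_metricE hM hN f_smooth).
- move=> y Dy; have [e eo] := frame_exists Dy; have [+ _] := graph_tension Dy eo.
  rewrite (frame_trace_bilinear eo) //.
    by move=> w; exact: (sff_linearr mG mg ids (fun z Dz => Dz)).
  by move=> w; exact: (sff_linearl mG mg ids (fun z Dz => Dz)).
- move=> y Dy; have [e eo] := frame_exists Dy; have [_] := graph_tension Dy eo.
  rewrite (frame_trace_bilinear eo) //.
    by move=> w; exact: (sff_linearr mH mg phis phiU).
  by move=> w; exact: (sff_linearl mH mg phis phiU).
- move=> y Dy u v; apply: (riemann_le mG Dy) => u' v' uv.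
  by have [x [ax _] xy] := Dy; move: uv; rewrite -xy; exact: sec_M_ge.
- move=> y Dy u v; apply: (riemann_ge mH (phiU y Dy)) => u' v' uv.
  have [x [ax bx] xy] := Dy; rewrite -xy (map_inE _ hM _ ax); exact: sec_N_le.
Qed.

End local_data.

(* Equality at c = (1 - q) / (1 + q) is where the constant kappa^2 / (kappa^4 - 1) comes from. *)
Lemma threshold_coefficient (R : realFieldType) (q c : R) :
  1 < q -> (1 - q) / (1 + q) <= c -> c < 0 ->
  - 4 * c * (q / (q ^+ 2 - 1)) <= 1 - c ^+ 2.
Proof.
move=> q1 cq c0; have q1' : 0 < 1 + q by lra.
move: cq; rewrite ler_pdivrMr // => cq.
have d0 : 0 < q ^+ 2 - 1 by nra.
rewrite mulrA ler_pdivrMr //.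
(* The product expands to (1 - c^2) (q^2 - 1) + 4 c q; the first factor vanishes exactly at the
   lower bound for [c]. *)
have : 0 <= (c * (1 + q) - (1 - q)) * (1 + q + c * (1 - q)).
  by apply: mulr_ge0; nra.
lra.
Qed.

Section degenerate_geometry.
Context {R : realType} {m n : nat}.
Variables (D : set 'rV[R]_m) (U : set 'rV[R]_n).
Variables (G g : 'rV[R]_m -> 'M[R]_m) (H : 'rV[R]_n -> 'M[R]_n).
Variables (phi : 'rV[R]_m -> 'rV[R]_n) (sigma : R).
Hypothesis L : minimal_graph_data D U G g H phi sigma.
Hypothesis isometric : forall z a b, D z -> pull H phi a b z = inner (G z) a b.
Variable y : 'rV[R]_m.
Hypothesis Dy : D y.
Hypothesis sffG : forall a b, sff g G id y a b = 0.
Hypothesis sffH : forall a b, sff g H phi y a b = 0.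

Let oD : open D. Proof. by case: (mgd_g L). Qed.

(** Since s = 0, every [v] is a null vector for the constant 0, and A = 0 reduces [laplacian_le] to
    a nonnegative sum of R1 - R2 over the frame. The curvature bounds give R1 <= - sigma gram <= R2
    term by term, so equality holds throughout; [u] is the first frame vector up to scale. *)
Lemma degenerate_curvature u v : u != 0 -> v != 0 ->
  inner (G y) (riemann G y u v u) v = - sigma * gram (G y) u v /\
  inner (H (phi y)) (riemann H (phi y) (dmx phi u y) (dmx phi v y) (dmx phi u y))
    (dmx phi v y) = - sigma * gram (G y) u v.
Proof.
move=> u0 v0; have m0 : (0 < m)%N.
  by case: posnP => // m0; case/eqP: u0; apply/rowP => -[j jm]; exfalso; rewrite m0 in jm.
have gsym : symmetric_matrix (g y) by case: (mgd_g L) => _ _ + _; apply.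
have gpos : positive_definite (g y) by case: (mgd_g L) => _ _ _; apply.
have [k k0 ku] := normalize gpos u0; have [l l0 lv] := normalize gpos v0.
have [e eo ei] := orthonormal_frame_exists gsym gpos (i0 := Ordinal m0) ku erefl.
pose R1 a := inner (G y) (riemann G y a (l *: v) a) (l *: v).
pose R2 a := inner (H (phi y)) (riemann H (phi y) (dmx phi a y) (dmx phi (l *: v) y)
  (dmx phi a y)) (dmx phi (l *: v) y).
pose S a := - sigma * gram (G y) a (l *: v).
have gramE a b : gram (H (phi y)) (dmx phi a y) (dmx phi b y) = gram (G y) a b.
  by rewrite /gram -!(isometric _ _ Dy).
have R1S a : R1 a <= S a by exact: (mgd_secM L Dy).
have R2S a : S a <= R2 a by rewrite /S -gramE; exact: (mgd_secN L Dy).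
have null z a b : D z -> weighted_form G H phi (fun=> 0) a b z = 0.
  by move=> Dz; rewrite (weighted_formE L) // scale0r subr0 (s_mxE L) // isometric // subrr.
have := laplacian_le (mgd_G L) (mgd_g L) (mgd_H L) (mgd_smooth L) (mgd_map L) (mgd_gE L)
  (mgd_harm1 L) (mgd_harm2 L) (smooth_cst oD 0) Dy
  (fun z w Dz => eq_ind_r (fun t => 0 <= t) (lexx 0) (null z w w Dz)) (null _ _ _ Dy) lv eo.
rewrite laplacian_at_cst !(big1 _ _ (fun k => inner _ (sff _ _ _ _ _ _) _)); last 2 first.
- by move=> i _; rewrite sffH inner0l.
- by move=> i _; rewrite sffG inner0l.
rewrite !mulr0 subrr mulr0 add0r subr0 addr0 !mul1r pmulr_rge0 // -sumrB => sum_ge0.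
have sum0 : \sum_i (R2 (e i) - R1 (e i)) = 0.
  apply/eqP; rewrite eq_le; apply/andP; split.
    rewrite -oppr_ge0 -sumrN; apply: le_trans sum_ge0 _.
    by apply: ler_sum => i _; rewrite opprB.
  by apply: sumr_ge0 => i _; rewrite subr_ge0; exact: le_trans (R1S _) (R2S _).
have R12 i : R2 (e i) - R1 (e i) = 0.
  apply: (psumr_eq0P (P := predT) (F := fun i => R2 (e i) - R1 (e i))) => // j _.
  by rewrite subr_ge0; exact: le_trans (R1S _) (R2S _).
have := R12 (Ordinal m0); rewrite ei => /eqP; rewrite subr_eq0 => /eqP E.
have E1 : R1 (k *: u) = S (k *: u) by apply/eqP; rewrite eq_le R1S -E R2S.
have kl : k ^+ 2 * l ^+ 2 != 0 by rewrite mulf_neq0 // expf_neq0 // gt_eqF.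
have dl := dmx_linear Dy (mgd_smooth L).
split; apply: (mulfI kl); rewrite [RHS]mulrCA -(gram_homogeneous G).
  by rewrite -(riemann_homogeneous (mgd_G L) Dy).
rewrite -(riemann_homogeneous (mgd_H L) (mgd_map L Dy)).
have Z t a : dmx phi (t *: a) y = t *: dmx phi a y by exact: (linear_funZ dl).
by rewrite -!Z -/(R2 _) E E1.
Qed.

(** The second fundamental form of f refers to the pulled-back metric, which is half of [g] and so
    has the same connection. *)
Lemma degenerate_sff_image u v : sff (pullback phi H) H phi y u v = 0.
Proof.
have mG := mgd_G L; have phis := mgd_smooth L.
have PG z : D z -> pullback phi H z = G z.
  by move=> Dz; apply: inner_mx_inj => a b; rewrite (pullbackE _ _ _ phis) // isometric.
have mP : metric_on D (pullback phi H) by apply: (eq_metric_on oD _ mG) => z Dz; rewrite PG.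
have gP z : D z -> g z = 2 *: pullback phi H z.
  move=> Dz; apply: inner_mx_inj => a b; rewrite PG // (mgd_gE L) // isometric // innerZm.
  by rewrite mulr_natl mulr2n.
rewrite -(sffH u v) !(sffE _ _ _ _ _ Dy); congr (_ - dmx phi _ y).
have two0 : 2 != 0 :> R by rewrite pnatr_eq0.
by rewrite (gamma_scale oD u v two0 mP (mgd_g L) Dy gP).
Qed.

End degenerate_geometry.

(** * The global argument *)

Section energy.
Context {R : realType} {m n : nat}.
Variables (M : metric_atlas R m) (N : metric_atlas R n) (f : M -> N).
Hypotheses (hM : riemannian_manifold M) (hN : riemannian_manifold N).
Hypothesis f_smooth : smooth_map f.
Variables (a : chart_index M) (b : chart_index N) (y : 'rV[R]_m).
Hypothesis Dy : map_dom f a b y.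

Let G := @metric R m M a.
Let H := @metric R n N b.
Let g := graph_metric f a b.
Let phi := in_charts f a b.

Lemma second_form_energy u v (A := second_form (P := product M N) (graph f) a (a, b) y u v) :
  inner (metric (m := product M N) (a, b)
      (in_charts (N := product M N) (graph f) a (a, b) y)) A A =
  inner (G y) (sff g G id y u v) (sff g G id y u v)
  + inner (H (phi y)) (sff g H phi y u v) (sff g H phi y u v).
Proof.
rewrite /A (second_form_graph hM hN f_smooth _ _ (graph_dom_self Dy)).
rewrite (sff_transition_self hM hN f_smooth u v Dy).
rewrite -[metric _ _]/(prod_mx G H (row_mx (in_charts (@id M) a a y) (phi y))).
rewrite prod_mxE !row_mxKl !row_mxKr (transition_self hM) //; exact: map_dom_sub Dy.
Qed.

(** The eigenvalue estimate involves A only in one slot filled with the extremal vector, that is one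
    column of the full norm. *)
Lemma second_form_norm2_ge e (j : 'I_m) :
  \sum_k (inner (G y) (sff g G id y (e k) (e j)) (sff g G id y (e k) (e j))
    + inner (H (phi y)) (sff g H phi y (e k) (e j)) (sff g H phi y (e k) (e j)))
  <= second_form_norm2 (P := product M N) (graph f) a (a, b) y e.
Proof.
have Gpos : positive_definite (G y).
  by case: (metric_on_map_dom hM hN f_smooth a b) => _ _ _; apply.
have Hpos : positive_definite (H (phi y)).
  by case: (metric_on_chart hN b) => _ _ _; apply; exact: (map_dom_range hM).
apply: ler_sum => k _.
rewrite [leRHS](eq_bigr _ (fun i _ => second_form_energy (e k) (e i))) (bigD1 j) //= lerDl.
by apply: sumr_ge0 => i _; apply: addr_ge0; exact: positive_definite_ge0.
Qed.

Lemma s_tensor_trace e :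
  frame_trace (s_tensor f a b y) e = trace_difference G H phi y e.
Proof.
apply: eq_bigr => k _; rewrite /s_tensor innerBm; congr (_ - _).
exact: (pullback_metricE hM hN f_smooth).
Qed.

End energy.

Section threshold.
Context {R : realType} {m n : nat}.
Variables (M : metric_atlas R m) (N : metric_atlas R n) (f : M -> N) (sigma kappa : R).
Hypotheses (hM : riemannian_manifold M) (hN : riemannian_manifold N).
Hypotheses (f_smooth : smooth_map f) (f_minimal : minimal_map f).
Hypothesis M_compact : compact [set: M].
Hypotheses (m0 : (0 < m)%N) (sigma_gt0 : 0 < sigma).
Hypothesis sec_N_le : all_sectional N (fun K => K <= sigma).
Hypothesis sec_M_ge : all_sectional M (fun K => sigma <= K).
Hypothesis kappa_gt1 : 1 < kappa ^+ 2.
Hypothesis pullback_lt : forall (a : chart_index M) (b : chart_index N) (x : M),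
  chart_dom a x -> chart_dom b (f x) ->
  positive_definite (kappa ^+ 2 *: metric a (chart a x) - pullback_metric f a b (chart a x)).

Let L a b := minimal_data hM hN f_smooth f_minimal m0 sigma_gt0 sec_N_le sec_M_ge a b.

Definition form_psd c := forall a b (x : M), chart_dom a x -> chart_dom b (f x) ->
  forall w, 0 <= inner (chart_form f a b c x) w w.

(** Quantifying over all charts makes this a condition on the point alone; [form_posP] reduces it to
    a single pair. *)
Definition form_pos c : set M := [set x | forall a b, chart_dom a x -> chart_dom b (f x) ->
  positive_definite (chart_form f a b c x)].

Lemma charts_exist x : exists a b, chart_dom a x /\ chart_dom b (f x).
Proof.
have [a ax] := chart_exists hM x; have [b bx] := chart_exists hN (f x).
by exists a, b.
Qed.

Lemma form_posP c a b x : chart_dom a x -> chart_dom b (f x) ->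
  positive_definite (chart_form f a b c x) -> form_pos c x.
Proof.
move=> ax bx pos a' b' a'x b'x.
exact: (chart_form_posdef hM hN f_smooth a'x ax b'x bx pos).
Qed.

Lemma form_pos_open c x : form_pos c x -> exists2 c', c < c' & \forall y \near x, form_pos c' y.
Proof.
have [a [b [ax bx]]] := charts_exist x => /(_ a b ax bx) pos.
have Dx : map_dom f a b (chart a x) by exists x.
have gs : msmooth (map_dom f a b) (graph_metric f a b) by case: (mgd_g (L a b)).
pose A x' := s_mx (@metric R m M a) (graph_metric f a b) (chart a x').
pose B x' := graph_metric f a b (chart a x').
have cA i j : {for x, continuous (fun x' => A x' i j)}.
  apply: (@continuous_comp _ _ _ (@chart R m M a)
    (fun y => s_mx (@metric R m M a) (graph_metric f a b) y i j) x).
    exact: (chart_continuous hM ax).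
  exact: (s_mx_continuous (L a b) Dx).
have cB i j : {for x, continuous (fun x' => B x' i j)}.
  apply: (@continuous_comp _ _ _ (@chart R m M a) (fun y => graph_metric f a b y i j) x).
    exact: (chart_continuous hM ax).
  exact: (smooth_continuous (gs i j) Dx).
have [c' cc' nc'] := posdef_near_right cA cB pos.
exists c' => //.
have n1 := map_dom_near hM hN f_smooth ax bx.
near=> y.
have [ay fy] : chart_dom a y /\ chart_dom b (f y) by near: y; exact: n1.
apply: (form_posP ay fy).
by near: y; exact: nc'.
Unshelve. all: by end_near. Qed.

Lemma form_shift c c' a b x w : inner (chart_form f a b c x) w w =
  inner (chart_form f a b c' x) w w + (c' - c) * inner (graph_metric f a b (chart a x)) w w.
Proof. by rewrite /chart_form !innerBm !innerZm; ring. Qed.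

Let gpos a b x : chart_dom a x -> chart_dom b (f x) ->
  positive_definite (graph_metric f a b (chart a x)).
Proof.
by move=> ax bx; case: (mgd_g (L a b)) => _ _ _; apply; exists x.
Qed.

Lemma form_pos_mono c c' : c <= c' -> form_pos c' `<=` form_pos c.
Proof.
move=> cc' x pos a b ax bx w w0; rewrite (form_shift c c').
rewrite ltr_pwDl ?(pos a b ax bx) // mulr_ge0 ?subr_ge0 //.
exact: positive_definite_ge0 (gpos ax bx).
Qed.

(** At this level the form is a positive multiple of kappa^2 g_M - f^* g_N, which is where the level
    comes from. *)
Lemma form_pos_lower : [set: M] `<=` form_pos ((1 - kappa ^+ 2) / (1 + kappa ^+ 2)).
Proof.
move=> x _ a b ax bx w w0; rewrite (chart_formE hM hN f_smooth) //.
have Dx : map_dom f a b (chart a x) by exists x.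
have := pullback_lt ax bx w0; rewrite innerBm innerZm (pullback_metricE hM hN f_smooth) //.
set p := inner _ w w; set r := pull _ _ _ _ _; set q := kappa ^+ 2 => h.
have q0 : 0 < 1 + q by have := kappa_gt1; rewrite -/q; lra.
have -> : (1 - (1 - q) / (1 + q)) * p - (1 + (1 - q) / (1 + q)) * r = 2 / (1 + q) * (q * p - r).
  by field; rewrite gt_eqF.
by rewrite mulr_gt0 // divr_gt0.
Qed.

(** At level 1 only - 2 f^* g_N is left. *)
Lemma form_pos_upper (x : M) : ~ [set: M] `<=` form_pos 1.
Proof.
move=> /(_ x I) pos; have [a [b [ax bx]]] := charts_exist x.
have := pos a b ax bx _ (delta_neq0 (Ordinal m0)); rewrite (chart_formE hM hN f_smooth) // subrr mul0r sub0r.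
rewrite oppr_gt0 pmulr_rlt0 ?addr_gt0 // ltNge => /negP; apply.
by apply: (pull_ge0 (L a b)); exists x.
Qed.

Lemma threshold (x1 : M) : exists c : R, [/\ (1 - kappa ^+ 2) / (1 + kappa ^+ 2) <= c,
  form_psd c & exists a b (x : M) v, [/\ chart_dom a x, chart_dom b (f x),
    inner (graph_metric f a b (chart a x)) v v = 1 &
    inner (s_mx (@metric R m M a) (graph_metric f a b) (chart a x)) v v = c]].
Proof.
have [c [c0 below [x _ nx]]] := compact_threshold M_compact
  (fun c x _ => @form_pos_open c x) form_pos_mono form_pos_lower (form_pos_upper x1).
have psd : form_psd c.
  move=> a b z az bz w; have [->|w0] := eqVneq w 0; first by rewrite inner0l.
  have gw := gpos az bz w0; rewrite leNgt; apply/negP => lt0.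
  set r := inner (graph_metric f a b (chart a z)) w w in gw.
  (* Definiteness is known strictly below [c] only. If the form at [c] were negative on [w], it
     would vanish on [w] at this lower level, where it has to be positive. *)
  pose c' := c + inner (chart_form f a b c z) w w / r.
  have cc' : c' < c by rewrite gtrDl pmulr_llt0 // invr_gt0.
  have := below c' cc' z I a b az bz w w0.
  rewrite (form_shift c' c) -/r /c' opprD addrA subrr sub0r mulNr divfK ?gt_eqF //.
  by rewrite subrr ltxx.
exists c; split=> //.
have [a [b [ax bx]]] := charts_exist x.
have Dx : map_dom f a b (chart a x) by exists x.
have npos : ~ positive_definite (chart_form f a b c x).
  by move=> pos; apply: nx; exact: form_posP pos.
have [w w0 fw] : exists2 w, w != 0 & inner (chart_form f a b c x) w w = 0.
  by apply: null_vector_exists => // u; exact: psd ax bx u.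
have [k k0 ku] := normalize (gpos ax bx) w0.
exists a, b, x, (k *: w); split=> //.
have : inner (chart_form f a b c x) (k *: w) (k *: w) = 0 by rewrite innerZl innerZr fw !mulr0.
by rewrite /chart_form innerBm innerZm ku mulr1 => /eqP; rewrite subr_eq0 => /eqP.
Qed.

End threshold.

Lemma connected_clopen (T : topologicalType) (B : set T) :
  connected [set: T] -> open B -> open (~` B) -> B !=set0 -> B = setT.
Proof.
move=> cT oB oB' B0; apply: cT => //; exists B; rewrite ?setTI //.
by rewrite -[B]setCK; exact: open_closedC.
Qed.

Lemma locally_constant (R : realType) m n (U : set 'rV[R]_m) (F : 'rV[R]_m -> 'rV[R]_n) x :
  open U -> msmooth U F -> U x -> (forall y v, U y -> dmx F v y = 0) ->
  \forall y \near x, F y = F x.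
Proof.
move=> oU Fs Ux dF0; have : nbhs x U by apply: open_nbhs_nbhs.
move=> /nbhs_normP[e /= e0 eU]; apply/nbhs_normP; exists e => //= y /= xy.
have Us (s : R) : `|s| <= `|1 : R| -> U (s *: (y - x) + x).
  move=> s1; apply: eU => /=; rewrite opprD addrCA subrr addr0 normrN normrZ distrC.
  by apply: le_lt_trans xy; rewrite -[leRHS]mul1r ler_wpM2r // -[leRHS]normr1.
apply/rowP => j; have [|s s1] := @mvt_line R m (fun z => F z ord0 j) x (y - x) 1.
  by move=> s s1; apply: diff_derivable; exact: (smooth_diff (Fs ord0 j) (Us s s1)).
rewrite -dscalE -(dmx_entry (Us s s1)) // (dF0 _ _ (Us s s1)) mxE mulr0 scale1r subrK.
by move=> /eqP; rewrite subr_eq0 => /eqP.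
Qed.

Section cases.
Context {R : realType} {m n : nat}.
Variables (M : metric_atlas R m) (N : metric_atlas R n) (f : M -> N) (sigma kappa : R).
Hypotheses (hM : riemannian_manifold M) (hN : riemannian_manifold N).
Hypotheses (f_smooth : smooth_map f) (f_minimal : minimal_map f).
Hypothesis M_connected : connected [set: M].
Hypotheses (m2 : (2 <= m)%N) (sigma_gt0 : 0 < sigma).
Hypothesis sec_N_le : all_sectional N (fun K => K <= sigma).
Hypothesis sec_M_ge : all_sectional M (fun K => sigma <= K).

Let m0 : (0 < m)%N. Proof. exact: ltnW. Qed.
Let L a b := minimal_data hM hN f_smooth f_minimal m0 sigma_gt0 sec_N_le sec_M_ge a b.

Section extremal_point.
Variable c : R.
Hypothesis c_psd : form_psd f c.
Variables (a : chart_index M) (b : chart_index N) (x : M) (v : 'rV[R]_m).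
Hypotheses (ax : chart_dom a x) (bx : chart_dom b (f x)).
Let y := chart a x.
Hypothesis gv : inner (graph_metric f a b y) v v = 1.
Hypothesis sv : inner (s_mx (@metric R m M a) (graph_metric f a b) y) v v = c.

Let Dy : map_dom f a b y. Proof. by exists x. Qed.
Let psd z w : map_dom f a b z ->
  0 <= inner (s_mx (@metric R m M a) (graph_metric f a b) z - c *: graph_metric f a b z) w w.
Proof. by move=> [x' [ax' bx'] <-]; exact: (c_psd ax' bx'). Qed.

Lemma extremal_frame : exists e (i : 'I_m), [/\ orthonormal_frame (graph_metric f a b y) e,
  e i = v & 0 <= - 4 * c *
    \sum_k (inner (metric a y) (sff (graph_metric f a b) (@metric R m M a) id y (e k) v)
        (sff (graph_metric f a b) (@metric R m M a) id y (e k) v)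
      + inner (metric b (in_charts f a b y))
        (sff (graph_metric f a b) (@metric R n N b) (in_charts f a b) y (e k) v)
        (sff (graph_metric f a b) (@metric R n N b) (in_charts f a b) y (e k) v))
    - sigma * ((1 - c ^+ 2) *
      (trace_difference (@metric R m M a) (@metric R n N b) (in_charts f a b) y e - c))].
Proof.
have mg := mgd_g (L a b).
have gsym : symmetric_matrix (graph_metric f a b y) by case: mg => _ _ + _; apply.
have gpos : positive_definite (graph_metric f a b y) by case: mg => _ _ _; apply.
have [e eo ei] := orthonormal_frame_exists gsym gpos (i0 := Ordinal m0) gv erefl.
exists e, (Ordinal m0); split=> //.
have oD : open (map_dom f a b) by case: mg.
have := eigenvalue_estimate (L a b) (smooth_cst oD c) Dy psd sv gv eo.
by rewrite laplacian_at_cst.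
Qed.

Lemma extremal_bounds : -1 <= c <= 1.
Proof. exact: (eigenvalue_bounds (L a b) Dy gv sv). Qed.

Lemma threshold_ge0 : 1 < kappa ^+ 2 -> (1 - kappa ^+ 2) / (1 + kappa ^+ 2) <= c ->
  (forall e, orthonormal_frame (graph_metric f a b y) e ->
    0 <= frame_trace (s_tensor f a b y) e) ->
  (forall e, orthonormal_frame (graph_metric f a b y) e ->
    second_form_norm2 (P := product M N) (graph f) a (a, b) y e
    <= kappa ^+ 2 * sigma / (kappa ^+ 4 - 1) * frame_trace (s_tensor f a b y) e) ->
  0 <= c.
Proof.
move=> k1 ck tr0 Ab; have [e [i [eo ei est]]] := extremal_frame.
rewrite leNgt; apply/negP => c0.
have := second_form_norm2_ge hM hN f_smooth Dy e i; rewrite ei => E1.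
have := le_trans E1 (Ab e eo); have := tr0 e eo.
rewrite (s_tensor_trace hM hN f_smooth Dy e) => {}tr0 {}E1.
have coef := threshold_coefficient k1 ck c0.
move: est E1; set S := \sum_k _; set tr := trace_difference _ _ _ _ _ in tr0 * => est E1.
(* Makes 1 - c^2 positive, so that the final inequality is strict. *)
have c1 : -1 < c.
  apply: lt_le_trans ck; rewrite ltr_pdivlMr; lra.
have d0 : 0 < kappa ^+ 4 - 1.
  by rewrite (exprM kappa 2 2) subr_gt0 exprn_egt1.
(* With the bound on A, this cancels the trace in the estimate and leaves 0 <= sigma (1 - c^2) c,
   impossible for negative [c]. *)
have E2 : - 4 * c * S <= (1 - c ^+ 2) * (sigma * tr).
  have h1 : - 4 * c * S <= - 4 * c * (kappa ^+ 2 * sigma / (kappa ^+ 4 - 1) * tr).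
    by apply: ler_wpM2l => //; lra.
  apply: le_trans h1 _.
  have -> : - 4 * c * (kappa ^+ 2 * sigma / (kappa ^+ 4 - 1) * tr) =
      - 4 * c * (kappa ^+ 2 / ((kappa ^+ 2) ^+ 2 - 1)) * (sigma * tr).
    by rewrite -exprM; field; rewrite gt_eqF.
  by apply: ler_wpM2r => //; rewrite mulr_ge0 // ltW.
have : 0 < sigma * ((1 - c ^+ 2) * - c).
  by apply: mulr_gt0 => //; apply: mulr_gt0; nra.
lra.
Qed.

Lemma threshold_01 : 0 <= c -> c = 0 \/ c = 1.
Proof.
move=> c0; have [e [i [eo ei est]]] := extremal_frame; have /andP[_ c1] := extremal_bounds.
have [->|cn0] := eqVneq c 0; first by left.
have [->|cn1] := eqVneq c 1; first by right.
have cp : 0 < c by rewrite lt_neqAle eq_sym cn0.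
have cl : c < 1 by rewrite lt_neqAle cn1.
have Gpos : positive_definite (metric a y) by case: (mgd_G (L a b)) => _ _ _; apply.
have Hpos : positive_definite (metric b (in_charts f a b y)).
  by case: (mgd_H (L a b)) => _ _ _; apply; exact: (mgd_map (L a b) Dy).
move: est; set S := \sum_k _; set tr := trace_difference _ _ _ _ _ => est.
have S0 : 0 <= S by apply: sumr_ge0 => k _; apply: addr_ge0; exact: positive_definite_ge0.
(* Each diagonal entry of s in the frame is at least [c], and there are [m >= 2] of them. *)
have trc : 2 * c <= tr.
  apply: le_trans (_ : m%:R * c <= tr); first by rewrite ler_wpM2r // ler_nat.
  rewrite mulr_natl -[m in c *+ m]card_ord -sumr_const; apply: ler_sum => k _.
  rewrite -(s_mxE (L a b)) //; have := psd (e k) Dy.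
  by rewrite innerBm innerZm eo eqxx mulr1 subr_ge0.
have h1 : 0 <= c * S by rewrite mulr_ge0.
have h2 : 0 < sigma * ((1 - c ^+ 2) * (tr - c)).
  by apply: mulr_gt0 => //; apply: mulr_gt0; nra.
exfalso; lra.
Qed.

End extremal_point.

(** At level 1 the form is - 2 f^* g_N, so semidefiniteness forces df = 0; the level sets of f are
    then open, and M is connected. *)
Lemma constant_map : form_psd f 1 -> forall x x', f x = f x'.
Proof.
move=> psd.
have dphi0 a b z w : map_dom f a b z -> dmx (in_charts f a b) w z = 0.
  move=> Dz; have Hpos : positive_definite (metric b (in_charts f a b z)).
    by case: (mgd_H (L a b)) => _ _ _; apply; exact: (mgd_map (L a b) Dz).
  apply: (positive_definite_eq0 Hpos); apply/eqP; rewrite eq_le.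
  rewrite positive_definite_ge0 // andbT.
  have [x [ax bx] xz] := Dz; have := psd a b x ax bx w.
  rewrite (chart_formE hM hN f_smooth) // subrr mul0r sub0r oppr_ge0 xz.
  by rewrite pmulr_rle0 // addr_gt0.
have loc x : \forall z \near x, f z = f x.
  have [a [b [ax bx]]] := charts_exist f hM hN x.
  have n1 := map_dom_near hM hN f_smooth ax bx.
  have oD : open (map_dom f a b) by case: (mgd_g (L a b)).
  have Dx : map_dom f a b (chart a x) by exists x.
  have := locally_constant oD (mgd_smooth (L a b)) Dx (@dphi0 a b).
  move=> /(chart_continuous hM ax) n3.
  near=> z.
  have [az bz] : chart_dom a z /\ chart_dom b (f z) by near: z; exact: n1.
  have : in_charts f a b (chart a z) = in_charts f a b (chart a x) by near: z; exact: n3.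
  rewrite !(map_inE _ hM) // => /(congr1 (@chart_inv R n N b)).
  by rewrite !(chart_invK hN).
move=> x x'; have BT : [set z | f z = f x'] = setT.
  apply: connected_clopen => //; last by exists x'.
    rewrite openE => z Bz; rewrite /interior; have := loc z.
    by apply: filterS => w /= ->.
  rewrite openE => z Bz; rewrite /interior; have := loc z.
  by apply: filterS => w /= ->.
have : [set: M] x by [].
by rewrite -BT.
Unshelve. all: by end_near. Qed.

End cases.

Lemma independent_neq0 (R : realType) m (u v : 'rV[R]_m) :
  independent u v -> u != 0 /\ v != 0.
Proof.
move=> uv; split; apply/eqP => w0.
  have [] := @independent_free R m u v 1 0 uv; first by rewrite w0 scaler0 scale0r addr0.
  by move=> /eqP; rewrite oner_eq0.
have [] := @independent_free R m u v 0 1 uv; first by rewrite w0 scaler0 scale0r addr0.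
by move=> _ /eqP; rewrite oner_eq0.
Qed.

Section degenerate_maps.
Context {R : realType} {m n : nat}.
Variables (M : metric_atlas R m) (N : metric_atlas R n) (f : M -> N) (sigma : R).
Hypotheses (hM : riemannian_manifold M) (hN : riemannian_manifold N).
Hypotheses (f_smooth : smooth_map f) (f_minimal : minimal_map f).
Hypothesis M_connected : connected [set: M].
Hypotheses (m0 : (0 < m)%N) (sigma_gt0 : 0 < sigma).
Hypothesis sec_N_le : all_sectional N (fun K => K <= sigma).
Hypothesis sec_M_ge : all_sectional M (fun K => sigma <= K).
Hypothesis psd : form_psd f 0.

Let L a b := minimal_data hM hN f_smooth f_minimal m0 sigma_gt0 sec_N_le sec_M_ge a b.

Let s0 a b z w : map_dom f a b z ->
  0 <= inner (s_mx (@metric R m M a) (graph_metric f a b) z) w w.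
Proof.
by move=> [x [ax bx] <-]; have := psd ax bx w; rewrite /chart_form scale0r subr0.
Qed.

Let degenerateP a b x : chart_dom a x -> chart_dom b (f x) -> ~ form_pos f 0 x <->
  (forall u v, inner (s_mx (@metric R m M a) (graph_metric f a b) (chart a x)) u v = 0).
Proof.
move=> ax bx; have Dx : map_dom f a b (chart a x) by exists x.
split=> [nx|].
  apply/(vanishingP (L a b) (@s0 a b) m0 Dx) => pos; apply: nx.
  by apply: (form_posP hM hN f_smooth ax bx); rewrite /chart_form scale0r subr0.
move=> /(vanishingP (L a b) (@s0 a b) m0 Dx) npos pos; apply: npos.
by have := pos a b ax bx; rewrite /chart_form scale0r subr0.
Qed.

(** Hopf's argument in a chart makes the degenerate set open, openness of definiteness makes it
    closed, and M is connected. *)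
Lemma degenerate_everywhere x0 : ~ form_pos f 0 x0 -> forall x, ~ form_pos f 0 x.
Proof.
move=> nx0 x; have : [set: M] x by [].
have <- : [set z | ~ form_pos f 0 z] = setT; last by [].
apply: connected_clopen => //; last by exists x0.
- rewrite openE => z nz; rewrite /interior.
  have [a [b [az bz]]] := charts_exist f hM hN z.
  have Dz : map_dom f a b (chart a z) by exists z.
  have := degenerate_open (L a b) (@s0 a b) m0 Dz ((degenerateP az bz).1 nz).
  move=> /(chart_continuous hM az) n3.
  have n1 := map_dom_near hM hN f_smooth az bz.
  near=> z'.
  have [az' bz'] : chart_dom a z' /\ chart_dom b (f z') by near: z'; exact: n1.
  apply/(degenerateP az' bz').
  by near: z'; exact: n3.
- rewrite openE => z /contrapT pz; rewrite /interior.
  have [c c0] := form_pos_open hM hN f_smooth f_minimal m0 sigma_gt0 sec_N_le sec_M_ge pz.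
  apply: filterS => z' pz'; apply; move: z' pz'.
  exact: (form_pos_mono hM hN f_smooth f_minimal m0 sigma_gt0 sec_N_le sec_M_ge (ltW c0)).
Unshelve. all: by end_near. Qed.

Hypothesis degenerate : forall x, ~ form_pos f 0 x.

Let isometric a b z u v : map_dom f a b z ->
  pull (@metric R n N b) (in_charts f a b) u v z = inner (metric a z) u v.
Proof.
move=> Dz; have [x [ax bx] xz] := Dz.
have := (degenerateP ax bx).1 (@degenerate x) u v.
by rewrite xz (s_mxE (L a b)) // => /eqP; rewrite subr_eq0 => /eqP.
Qed.

Lemma degenerate_isometric : isometric_immersion f.
Proof.
move=> a b x ax bx; apply: inner_mx_inj => u v; have Dx : map_dom f a b (chart a x) by exists x.
by rewrite (pullback_metricE hM hN f_smooth) // isometric.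
Qed.

(** An unspecified factor [k] is enough here, since tr s = 0. *)
Hypothesis A_bound : forall (a a' : chart_index M) (b : chart_index N) (x : M)
    (e : 'I_m -> 'rV[R]_m),
  chart_dom a x -> chart_dom a' x -> chart_dom b (f x) ->
  orthonormal_frame (graph_metric f a b (chart a x)) e ->
  exists k, second_form_norm2 (P := product M N) (graph f) a (a', b) (chart a x) e
    <= k * frame_trace (s_tensor f a b (chart a x)) e.

(** The bound makes the norm of A zero, hence A vanishes on an orthonormal frame; bilinearity
    extends this to all pairs. *)
Lemma degenerate_totally_geodesic_graph : totally_geodesic_immersion (graph f).
Proof.
move=> a [a' b] x u v ax [a'x bx].
have Dx : map_dom f a b (chart a x) by exists x.
have Gx : graph_dom f a a' b (chart a x) by exists x.
have [e eo] := frame_exists hM hN f_smooth m0 Dx.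
have [k] := A_bound ax a'x bx eo.
have -> : frame_trace (s_tensor f a b (chart a x)) e = 0.
  rewrite (s_tensor_trace hM hN f_smooth Dx) /trace_difference big1 // => i _.
  by rewrite isometric // subrr.
rewrite mulr0 /second_form_norm2; set P := metric _ _; set A := second_form _ _ _ _.
move=> norm_le0.
have Ppos : positive_definite P.
  have [_ _ _ pos] := prod_metric (metric_on_chart hM a') (metric_on_chart hN b).
  apply: pos; split; rewrite /= ?row_mxKl ?row_mxKr.
    by rewrite (chart_invK hM) //; exists x.
  by rewrite (chart_invK hM) //; exists (f x).
have row0 i : \sum_(j < m) inner P (A (e i) (e j)) (A (e i) (e j)) = 0.
  apply: (psumr_eq0P (P := predT)
    (F := fun i => \sum_(j < m) inner P (A (e i) (e j)) (A (e i) (e j)))) => // [i' _|].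
    by apply: sumr_ge0 => j _; exact: positive_definite_ge0.
  apply/eqP; rewrite eq_le norm_le0 /=.
  by apply: sumr_ge0 => i' _; apply: sumr_ge0 => j _; exact: positive_definite_ge0.
have A0 i j : A (e i) (e j) = 0.
  apply: (positive_definite_eq0 Ppos).
  apply: (psumr_eq0P (P := predT) (F := fun j => inner P (A (e i) (e j)) (A (e i) (e j)))) => //.
  by move=> j' _; exact: positive_definite_ge0.
have [lr ll] := second_form_graph_linear hM hN f_smooth Gx.
rewrite -/A in lr ll *.
rewrite (frame_expansion eo u) (linear_fun_sum (ll v)) big1 // => i _.
rewrite (linear_funZ (ll v)) (frame_expansion eo v) (linear_fun_sum (lr (e i))) big1 ?scaler0 //.
by move=> j _; rewrite (linear_funZ (lr (e i))) A0 scaler0.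
Qed.

Let sff0 a b x u v : chart_dom a x -> chart_dom b (f x) ->
  sff (graph_metric f a b) (@metric R m M a) id (chart a x) u v = 0 /\
  sff (graph_metric f a b) (@metric R n N b) (in_charts f a b) (chart a x) u v = 0.
Proof.
move=> ax bx; have Dx : map_dom f a b (chart a x) by exists x.
have := degenerate_totally_geodesic_graph u v ax (conj ax bx : chart_dom (m := product M N) (a, b) (graph f x)).
rewrite (second_form_graph hM hN f_smooth _ _ (graph_dom_self Dx)).
rewrite (sff_transition_self hM hN f_smooth u v Dx) => E; split.
  by have := congr1 lsubmx E; rewrite row_mxKl raddf0.
by have := congr1 rsubmx E; rewrite row_mxKr raddf0.
Qed.

Lemma degenerate_totally_geodesic : totally_geodesic_immersion f.
Proof.
move=> a b x u v ax bx; have Dx : map_dom f a b (chart a x) by exists x.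
have := degenerate_sff_image (L a b) (@isometric a b) Dx
  (fun u v => (sff0 u v ax bx).2) u v.
by rewrite sff.unlock.
Qed.

Lemma degenerate_sectional : all_sectional M (fun K => K = sigma).
Proof.
move=> a x u v ax uv; have [b bx] := chart_exists hN (f x).
have Dx : map_dom f a b (chart a x) by exists x.
have [u0 v0] := independent_neq0 uv; have [E _] := degenerate_curvature (L a b) (@isometric a b) Dx
  (fun u v => (sff0 u v ax bx).1) (fun u v => (sff0 u v ax bx).2) u0 v0.
exact: (sectional_eq (mgd_G (L a b)) Dx uv E).
Qed.

Lemma degenerate_sectional_image : all_sectional_on_image f (fun K => K = sigma).
Proof.
move=> a b x u v ax bx; rewrite /= -!dmxE => duv.
have Dx : map_dom f a b (chart a x) by exists x.
have dl := dmx_linear Dx (mgd_smooth (L a b)).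
have [du0 dv0] := independent_neq0 duv.
have d0 : dmx (in_charts f a b) 0 (chart a x) = 0.
  by rewrite -(scale0r (0 : 'rV[R]_m)) (linear_funZ dl) scale0r.
have u0 : u != 0 by apply: contra_neq du0 => ->.
have v0 : v != 0 by apply: contra_neq dv0 => ->.
have [_] := degenerate_curvature (L a b) (@isometric a b) Dx
  (fun u v => (sff0 u v ax bx).1) (fun u v => (sff0 u v ax bx).2) u0 v0.
rewrite -(map_inE f hM b ax).
have -> : gram (metric a (chart a x)) u v = gram (metric b (in_charts f a b (chart a x)))
    (dmx (in_charts f a b) u (chart a x)) (dmx (in_charts f a b) v (chart a x)).
  by rewrite /gram -!(isometric _ _ Dx).
exact: (sectional_eq (mgd_H (L a b)) (mgd_map (L a b) Dx) duv).
Qed.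

End degenerate_maps.

Theorem theorem1 (R : realType) (m n : nat)
    (M : metric_atlas R m) (N : metric_atlas R n)
    (f : M -> N) (sigma kappa : R)
    (hM : riemannian_manifold M) (hN : riemannian_manifold N)
    (M_connected : connected [set: M]) (N_connected : connected [set: N])
    (M_compact : compact [set: M]) (dim_M : (2 <= m)%N)
    (sigma_gt0 : 0 < sigma)
    (sec_N_le : all_sectional N (fun K => K <= sigma))
    (sec_M_ge : all_sectional M (fun K => sigma <= K))
    (f_smooth : smooth_map f) (f_minimal : minimal_map f)
    (tr_s_ge0 : forall (a : chart_index M) (b : chart_index N) (x : M)
       (e : 'I_m -> 'rV[R]_m),
       chart_dom a x -> chart_dom b (f x) ->
       orthonormal_frame (graph_metric f a b (chart a x)) e ->
       0 <= frame_trace (s_tensor f a b (chart a x)) e)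
    (kappa_gt1 : 1 < kappa ^+ 2)
    (pullback_lt : forall (a : chart_index M) (b : chart_index N) (x : M),
       chart_dom a x -> chart_dom b (f x) ->
       positive_definite (kappa ^+ 2 *: metric a (chart a x)
                          - pullback_metric f a b (chart a x)))
    (A_bound : forall (a a' : chart_index M) (b : chart_index N) (x : M)
       (e : 'I_m -> 'rV[R]_m),
       chart_dom a x -> chart_dom a' x -> chart_dom b (f x) ->
       orthonormal_frame (graph_metric f a b (chart a x)) e ->
       second_form_norm2 (P := product M N) (graph f) a (a', b) (chart a x) e
       <= kappa ^+ 2 * sigma / (kappa ^+ 4 - 1)
          * frame_trace (s_tensor f a b (chart a x)) e) :
  (forall x y : M, f x = f y) \/
  [/\ isometric_immersion f /\ totally_geodesic_immersion f,
      all_sectional M (fun K => K = sigma),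
      all_sectional_on_image f (fun K => K = sigma) &
      totally_geodesic_immersion (graph f)].
Proof.
have m0 : (0 < m)%N by exact: ltnW.
(* The empty manifold is allowed by the hypotheses, and there f is vacuously constant. *)
have [[x1 _]|M0] := pselect ([set: M] !=set0); last first.
  by left=> x; case: M0; exists x.
have [c [ck psd [a [b [x [v [ax bx gv sv]]]]]]] := threshold hM hN f_smooth f_minimal
  M_compact m0 sigma_gt0 sec_N_le sec_M_ge kappa_gt1 pullback_lt x1.
have c0 : 0 <= c.
  apply: (threshold_ge0 hM hN f_smooth f_minimal dim_M sigma_gt0 sec_N_le sec_M_ge psd
    ax bx gv sv kappa_gt1 ck) => e eo; first exact: tr_s_ge0.
  exact: A_bound.
have [cz|c1] := threshold_01 hM hN f_smooth f_minimal dim_M sigma_gt0 sec_N_le sec_M_ge psd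
  ax bx gv sv c0; last first.
  left; rewrite c1 in psd.
  exact: (constant_map hM hN f_smooth f_minimal M_connected dim_M sigma_gt0 sec_N_le sec_M_ge psd).
right; rewrite cz in psd sv.
(* The extremal unit vector is a null vector of s, so [x] is a first degenerate point. *)
have nx : ~ form_pos f 0 x.
  move=> pos; have v0 : v != 0.
    by apply/eqP => v0; move: gv; rewrite v0 inner0l => /eqP; rewrite eq_sym oner_eq0.
  by have := pos a b ax bx v v0; rewrite /chart_form scale0r subr0 sv ltxx.
have deg := degenerate_everywhere hM hN f_smooth f_minimal M_connected m0 sigma_gt0
  sec_N_le sec_M_ge psd nx.
have Ab a1 a' b1 x2 e : chart_dom a1 x2 -> chart_dom a' x2 -> chart_dom b1 (f x2) ->
    orthonormal_frame (graph_metric f a1 b1 (chart a1 x2)) e ->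
    exists k, second_form_norm2 (P := product M N) (graph f) a1 (a', b1) (chart a1 x2) e
      <= k * frame_trace (s_tensor f a1 b1 (chart a1 x2)) e.
  by move=> a1x a'x b1x eo; exists (kappa ^+ 2 * sigma / (kappa ^+ 4 - 1)); exact: A_bound.
split; first split.
- exact: (degenerate_isometric hM hN f_smooth f_minimal m0 sigma_gt0 sec_N_le sec_M_ge psd deg).
- exact: (degenerate_totally_geodesic hM hN f_smooth f_minimal m0 sigma_gt0 sec_N_le sec_M_ge
    psd deg Ab).
- exact: (degenerate_sectional hM hN f_smooth f_minimal m0 sigma_gt0 sec_N_le sec_M_ge
    psd deg Ab).
- exact: (degenerate_sectional_image hM hN f_smooth f_minimal m0 sigma_gt0 sec_N_le sec_M_ge
    psd deg Ab).
- exact: (degenerate_totally_geodesic_graph hM hN f_smooth f_minimal m0 sigma_gt0 sec_N_le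
    sec_M_ge psd deg Ab).
Qed.
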